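(* Let $\Omega\subset\mathbb R^n$ be a bounded domain with smooth boundary and $\delta(x)=d(x,\partial\Omega)$. Let $u$ be a measurable function with $u\,\delta^{-1}\in L^1(\Omega)$ such that $-\Delta u\le0$ in $\mathscr D'(\Omega)$, i.e. $$-\int_\Omega u\,\Delta\varphi\le0\qquad\forall\varphi\in\mathscr C_c^\infty(\Omega),\ \varphi\ge0.$$ Then $u\le0$ a.e. in $\Omega$.
   Context: No boundary condition on $u$ is imposed other than $u\,\delta^{-1}\in L^1(\Omega)$. *)

(* Defs.v *)
From HB Require Import structures.
From mathcomp Require Import all_boot all_order all_algebra.
From mathcomp Require Import all_classical all_reals all_analysis.

Set Implicit Arguments.
Unset Strict Implicit.
Unset Printing Implicit Defensive.

Import Order.TTheory GRing.Theory Num.Theory.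
Import numFieldNormedType.Exports.

Local Open Scope classical_set_scope.
Local Open Scope ring_scope.

(* Points of R^n are row vectors ['rV[R]_n].  The library norm on ['rV[R]_n] is
   the sup norm, hence the Euclidean norm [enorm] below. *)

(* Lebesgue measure on R^n: the n-fold product of the one-dimensional Lebesgue
   measure is built on [n.-tuple R] (the type that carries the product
   sigma-algebra in the library), transported to row vectors, and completed by
   Caratheodory's construction. *)

Section product_cons.
Context d (T : measurableType d) (R : realType) (n : nat).
Variable m1 : {sigma_finite_measure set T -> \bar R}.
Variable m2 : {sigma_finite_measure set (n.-tuple T) -> \bar R}.

Let consp (p : T * n.-tuple T) : n.+1.-tuple T := [tuple of p.1 :: p.2].

Let measurable_consp : measurable_fun setT consp.
Proof. exact: measurable_cons. Qed.

Definition product_cons : set (n.+1.-tuple T) -> \bar R :=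
  pushforward (m1 \x m2)%E (fun p => [tuple of p.1 :: p.2]).

Let product_cons0 : product_cons set0 = 0%E.
Proof. by rewrite /product_cons /pushforward preimage_set0 measure0. Qed.

Let product_cons_ge0 A : (0 <= product_cons A)%E.
Proof. exact: measure_ge0. Qed.

Let product_cons_sigma_additive : semi_sigma_additive product_cons.
Proof.
have mpre A : measurable A -> measurable (consp @^-1` A).
  by move=> mA; rewrite -[X in measurable X]setTI; exact: measurable_consp.
move=> F mF tF mUF; rewrite /product_cons /pushforward preimage_bigcup.
apply: measure_semi_sigma_additive => [k||]; first exact: mpre.
- apply/trivIsetP => i j _ _ ij; rewrite -preimage_setI.
  by move/trivIsetP : tF => /(_ _ _ _ _ ij) ->//; rewrite preimage_set0.
- by rewrite -preimage_bigcup; exact: mpre.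
Qed.

HB.instance Definition _ := isMeasure.Build _ _ _ product_cons
  product_cons0 product_cons_ge0 product_cons_sigma_additive.

Let product_cons_sigma_finite : sigma_finite setT product_cons.
Proof.
have /sigma_finiteP[F [FT ndF Foo]] := sigma_finiteT m1.
have /sigma_finiteP[G [GT ndG Goo]] := sigma_finiteT m2.
pose g (t : n.+1.-tuple T) := (thead t, [tuple of behead t]).
have mg : measurable_fun setT g.
  apply/measurable_fun_pairP; split; first exact: measurable_tnth.
  exact: measurable_behead.
exists (fun k => g @^-1` (F k `*` G k)).
  apply/seteqP; split=> // t _.
  have [i _ Fi] : (\bigcup_k F k) (thead t) by rewrite -FT.
  have [j _ Gj] : (\bigcup_k G k) [tuple of behead t] by rewrite -GT.
  exists (maxn i j) => //; split => /=.
    by move: Fi; exact/subsetPset/ndF/leq_maxl.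
  by move: Gj; exact/subsetPset/ndG/leq_maxr.
move=> k; have [mF Fk] := Foo k; have [mG Gk] := Goo k.
have mFG : measurable (F k `*` G k) by exact: measurableX.
split; first by rewrite -[X in measurable X]setTI; exact: mg.
rewrite /product_cons /pushforward (_ : _ @^-1` _ = F k `*` G k).
  by rewrite product_measure1E// lte_mul_pinfty// ge0_fin_numE.
have gK (p : T * n.-tuple T) : g (consp p) = p.
  by case: p => x t; congr pair; exact: val_inj.
by apply/funext => p; exact: (congr1 (F k `*` G k) (gK p)).
Qed.

HB.instance Definition _ := Measure_isSigmaFinite.Build _ _ _ product_cons
  product_cons_sigma_finite.

End product_cons.

Fixpoint lebesgue_tuple (R : realType) (n : nat) :
    {sigma_finite_measure set (n.-tuple (measurableTypeR R)) -> \bar R} :=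
  if n is m.+1 then product_cons (@lebesgue_measure R) (lebesgue_tuple R m)
  else \d_ [tuple].

Section lebesgue_Rn.
Context (R : realType) (n : nat).
Local Open Scope ereal_scope.

Definition lebesgue_outer (A : set 'rV[R]_n) : \bar R :=
  mu_ext (lebesgue_tuple R n) [set t | A (\row_i tnth t i)%R].

Let lebesgue_outer0 : lebesgue_outer set0 = 0.
Proof. exact: outer_measure0. Qed.

Let lebesgue_outer_ge0 A : 0 <= lebesgue_outer A.
Proof. exact: outer_measure_ge0. Qed.

Let le_lebesgue_outer : {homo lebesgue_outer : A B / A `<=` B >-> A <= B}.
Proof. by move=> A B AB; apply: le_outer_measure => t; exact: AB. Qed.

Let lebesgue_outer_sigma_subadditive : sigma_subadditive lebesgue_outer.
Proof.
by move=> F; rewrite /lebesgue_outer;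
  exact: (outer_measure_sigma_subadditive (mu_ext (lebesgue_tuple R n))).
Qed.

HB.instance Definition _ := isOuterMeasure.Build R 'rV[R]_n lebesgue_outer
  lebesgue_outer0 lebesgue_outer_ge0 le_lebesgue_outer
  lebesgue_outer_sigma_subadditive.

(* R^n with the sigma-algebra of all Lebesgue (not only Borel) measurable
   sets. *)
Definition lebesgue_space := caratheodory_type lebesgue_outer.
HB.instance Definition _ := Measurable.on lebesgue_space.

Definition lebesgue_Rn : set lebesgue_space -> \bar R := lebesgue_outer.
HB.instance Definition _ := isMeasure.Build _ lebesgue_space _ lebesgue_Rn
  (@caratheodory_measure0 _ _ lebesgue_outer)
  (@caratheodory_measure_ge0 _ _ lebesgue_outer)
  (@caratheodory_measure_sigma_additive _ _ lebesgue_outer).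

End lebesgue_Rn.
Arguments lebesgue_Rn : clear implicits.

Section calculus.
Context (R : realType) (n : nat).
Implicit Types (f phi : 'rV[R]_n -> R) (U : set 'rV[R]_n).

Definition partial (i : 'I_n) f : 'rV[R]_n -> R := 'D_(delta_mx 0 i) f.

Definition iter_partial (s : seq 'I_n) f := foldr partial f s.

(* C^oo: every iterated partial derivative exists and is continuous. *)
Definition smooth f := forall s : seq 'I_n,
  continuous (iter_partial s f) /\
  forall (i : 'I_n) x, derivable (iter_partial s f) x (delta_mx 0 i).

Definition laplacian f (x : 'rV[R]_n) : R :=
  \sum_(i < n) partial i (partial i f) x.

Definition supp f : set 'rV[R]_n := closure [set x | f x != 0].

(* C_c^oo(U), each function being identified with its extension by zero. *)
Definition test_function U phi :=
  [/\ smooth phi, compact (supp phi) & supp phi `<=` U].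

End calculus.

Section domains.
Context (R : realType) (n : nat).
Implicit Types (x : 'rV[R]_n) (U : set 'rV[R]_n).

Definition boundary U := closure U `\` interior U.

Definition enorm x : R := Num.sqrt (\sum_(i < n) x 0 i ^+ 2).

Definition dist_boundary U x : R := inf [set enorm (x - y) | y in boundary U].

Definition domain U := [/\ U !=set0, open U & connected U].

(* Near each boundary point, U is, for some coordinate i and some orientation
   (-1)^b of its axis, the set of points lying strictly above the graph of a
   C^oo function g of the remaining n - 1 coordinates. *)
Definition smooth_boundary U := forall x, boundary U x ->
  exists (i : 'I_n) (b : bool) (g : 'rV[R]_n.-1 -> R),
    smooth g /\
    \forall y \near x, U y <-> g (col' i y) < (-1) ^+ b * y 0 i.

End domains.

(* Main.v *)
(* Let d be the distance to the complement of Omega. A smooth bounded domain satisfies a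
   uniform exterior ball condition: for some r > 0, each x in Omega has a centre c with
   |x - c| = r + d(x), while |y - c| >= r + d(y) for all y in Omega. Hence the function
   zeta = A - exp (- lam (r + d)^2), with A = exp (- lam r^2), is touched from above at x by
   A - exp (- lam |y - c|^2), which is smooth and strictly superharmonic for |y - c| >= r when
   lam = n / r^2. For a convex C^2 cutoff Phi_k vanishing on s <= k and of slope 1 on
   s >= 3 k, the compactly supported function Phi_k(zeta) then has Laplacian at most
   C Phi_k''(zeta) - m Phi_k'(zeta) in the sense of second differences, and testing the
   positive part of u with it gives, for Lipschitz 0 <= chi <= m Phi_k'(zeta),
     int u chi <= int u^+ m Phi_k'(zeta) <= C int |u| Phi_k''(zeta).
   As Phi_k'' <= 1/k lives on k <= zeta <= 3 k and zeta is comparable to d, the right-hand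
   side is at most a multiple of the integral of |u|/d over this strip, so it tends to 0 with
   k. Thus int u chi <= 0 for all Lipschitz chi >= 0 with compact support in Omega, and u <= 0
   almost everywhere by regularity of the measure |u| dx.

   Since zeta is not C^2 and u is only integrable, the test with the positive part is done on
   a lattice of mesh h: a mollification v of u satisfies Delta_h v >= - o(h^2), so does its
   positive part, and summation by parts on the lattice is exact. The mollifier is a smooth
   partition of unity over the lattice translates, so lattice sums of v against a Lipschitz
   function are integrals of u up to the mollification radius. Then h tends to 0, and the
   radius after it. *)
Require Import Defs.
From HB Require Import structures.
From mathcomp Require Import all_boot all_order all_algebra.
From mathcomp Require Import all_classical all_reals all_analysis.
From mathcomp Require Import measurable_realfun.
From mathcomp Require Import ring lra.

Set Implicit Arguments.
Unset Strict Implicit.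
Unset Printing Implicit Defensive.

Import Order.TTheory GRing.Theory Num.Theory.
Import numFieldNormedType.Exports.

Local Open Scope classical_set_scope.
Local Open Scope ring_scope.

(** * A smooth partition of unity on a lattice *)

(** Differentiability to finite order, so that closure under products and inverses goes by induction
    on [k]. Smoothness is the conjunction over all [k], converted to [derive1n] by
    [times_derivable_derive1n]. *)
Fixpoint times_derivable (R : realType) (k : nat) (f : R -> R) : Prop :=
  if k is k'.+1 then (forall x : R, derivable f x 1) /\ times_derivable k' (derive1 f)
  else True.

Lemma times_derivableS (R : realType) k (f : R -> R) :
  times_derivable k.+1 f -> times_derivable k f.
Proof.
elim: k f => [//|k IH] f [df Df]; split=> //; exact: IH.
Qed.

Lemma times_derivable_is_derive (R : realType) k (f df : R -> R) :
  (forall x : R, is_derive x 1 f (df x)) -> times_derivable k df ->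
  times_derivable k.+1 f.
Proof.
move=> h hk; split=> [x|]; first exact: ex_derive.
by rewrite (_ : (derive1 f) = df)//; apply/funext => x; rewrite derive1E derive_val.
Qed.

Lemma derivable_is_derive1 (R : realType) (f : R -> R) :
  (forall x : R, derivable f x 1) -> forall x : R, is_derive x 1 f ((derive1 f) x).
Proof. by move=> h x; rewrite derive1E; exact/derivableP. Qed.

Lemma times_derivable_cst (R : realType) k (c : R) :
  times_derivable k (cst c).
Proof.
elim: k c => [//|k IH] c.
by apply: (@times_derivable_is_derive R k _ (cst 0)).
Qed.

Lemma times_derivableD (R : realType) k (f g : R -> R) :
  times_derivable k f -> times_derivable k g -> times_derivable k (f \+ g).
Proof.
elim: k f g => [//|k IH] f g [df Df] [dg Dg].
apply: (@times_derivable_is_derive R k _ ((derive1 f) \+ (derive1 g))); last exact: IH.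
by move=> x; apply: is_deriveD; exact: derivable_is_derive1.
Qed.

Lemma times_derivableM (R : realType) k (f g : R -> R) :
  times_derivable k f -> times_derivable k g -> times_derivable k (f \* g).
Proof.
elim: k f g => [//|k IH] f g hf hg.
have [df Df] := hf; have [dg Dg] := hg.
apply: (@times_derivable_is_derive R k _ ((f \* (derive1 g)) \+ (g \* (derive1 f)))).
  by move=> x; apply: is_deriveM; exact: derivable_is_derive1.
by apply: times_derivableD; apply: IH => //; exact: times_derivableS.
Qed.

(** The derivative [- (1/f)^2 f'] involves [1/f] only to order [k], which the induction hypothesis
    supplies. *)
Lemma times_derivableV (R : realType) k (f : R -> R) :
  (forall x, f x != 0) -> times_derivable k f ->
  times_derivable k (fun x => (f x)^-1).
Proof.
move=> f0; elim: k => [//|k IH] hf; have [df Df] := hf.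
have Vk := IH (times_derivableS hf).
apply: (@times_derivable_is_derive R k _
  (cst (-1) \* ((fun x => (f x)^-1) \* (fun x => (f x)^-1)) \* (derive1 f))).
  move=> x; apply: is_derive_eq.
    by apply: is_deriveV => //; exact: derivable_is_derive1.
  by rewrite /= derive1E /GRing.scale /= expr2 invfM mulN1r.
by do 2 (apply: times_derivableM => //); [exact: times_derivable_cst
  | exact: times_derivableM].
Qed.

Lemma is_derive_affine (R : realType) (a b x : R) :
  is_derive x 1 (fun y => a * y + b) a.
Proof.
have h := is_deriveD (is_deriveZ a (is_derive_id x (1 : R)))
                     (is_derive_cst b x (1 : R)).
by apply: is_derive_eq h _; rewrite addr0 /GRing.scale /= mulr1.
Qed.

Lemma times_derivable_affine (R : realType) k (f : R -> R) (a b : R) :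
  times_derivable k f -> times_derivable k (fun x => f (a * x + b)).
Proof.
elim: k f => [//|k IH] f [df Df].
apply: (@times_derivable_is_derive R k (fun x => f (a * x + b))
  (fun x => (derive1 f) (a * x + b) * a)).
  move=> x; have h : is_derive (a * x + b) 1 f ((derive1 f) (a * x + b)).
    exact: derivable_is_derive1.
  exact: (@is_derive1_comp R f (fun x => a * x + b) x _ a h (is_derive_affine a b x)).
exact: (times_derivableM (IH _ Df) (times_derivable_cst k a)).
Qed.

Section flat.
Context {R : realType}.

(* Derivatives of [exp (-1/x)] stay in the span of these functions, hence the
   factor [x^-j]. *)
Definition flat (j : nat) (x : R) : R :=
  if 0 < x then x^-1 ^+ j * expR (- x^-1) else 0.

Lemma flat_ge0 j x : 0 <= flat j x.
Proof.
rewrite /flat; case: ifPn => // x0.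
by rewrite mulr_ge0 ?expR_ge0// exprn_ge0// invr_ge0 ltW.
Qed.

Lemma flat_gt0 j x : 0 < x -> 0 < flat j x.
Proof. by move=> x0; rewrite /flat x0 mulr_gt0 ?expR_gt0// exprn_gt0// invr_gt0. Qed.

(** Bound [exp y] from below by the term of degree [j + 2] of its series at [y = 1/x]. The quadratic
    decay makes the difference quotient at [0] of order [h], hence the zero derivative there. *)
Lemma flat_le j x : 0 < x -> flat j x <= j.+2`!%:R * x ^+ 2.
Proof.
move=> x0; rewrite /flat x0 expRN ler_pdivrMr ?expR_gt0//.
have y0 : 0 <= x^-1 by rewrite invr_ge0 ltW.
have := expR_ge1Dxn j.+1 y0.
move=> h.
have h2 : x^-1 ^+ j.+2 / j.+2`!%:R <= expR x^-1.
  by apply: le_trans h; rewrite lerDr.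
rewrite ler_pdivrMr ?ltr0n ?fact_gt0// in h2.
have -> : x^-1 ^+ j = x^-1 ^+ j.+2 * x ^+ 2.
  rewrite -addn2 exprD -mulrA -exprMn mulVf ?gt_eqF// expr1n mulr1 //.
rewrite [leRHS]mulrAC; apply: ler_wpM2r; first by rewrite exprn_ge0// ltW.
by rewrite mulrC.
Qed.

Lemma is_derive_flat_gt0 j (x : R) : 0 < x ->
  is_derive x 1 (flat j) (- j%:R * flat j.+1 x + flat j.+2 x).
Proof.
move=> x0.
have E : \near x, ((fun y => y^-1) ^+ j * (expR \o (fun y : R => - y^-1))) x = flat j x.
  near=> y; rewrite /flat ifT.
    by rewrite /GRing.mul /= fctE.
  by near: y; exact: lt_nbhsr.
have xn0 : x != 0 by rewrite gt_eqF.
apply: (near_eq_is_derive E).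
have dV : is_derive x 1 (fun y : R => y^-1) (- x ^- 2).
  apply: is_derive_eq; first by apply: (@is_deriveV R id x 1 1).
  by rewrite /GRing.scale /= mulr1.
have dN : is_derive x 1 (fun y : R => - y^-1) (x ^- 2).
  by apply: is_derive_eq (is_deriveN dV) _; rewrite opprK.
have dE : is_derive x 1 (expR \o (fun y : R => - y^-1))
    (expR (- x^-1) * x ^- 2) by exact: is_derive1_comp.
apply: (is_derive_eq (is_deriveM (is_deriveX j dV) dE)).
have sc (a b : R) : a *: (b : R^o) = a * b by [].
rewrite [(_ \o _) x]/(expR (- x^-1)) /flat x0 !sc {E dV dN dE}.
rewrite -!exprVn fctE.
move: (x^-1) => y; rewrite -[limn _]/(expR (- y)); move: (expR _) => e.
case: j => [|j]; first by ring.
rewrite (_ : j.+1.-1 = j)//; move: (j.+1%:R) => c.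
by rewrite !exprS; ring.
Unshelve. all: by end_near.
Qed.

Lemma is_derive_flat_le0 j (x : R) : x <= 0 -> is_derive x 1 (flat j) 0.
Proof.
rewrite le_eqVlt => /predU1P[->|x0]; last first.
  have E : \near x, cst 0 x = flat j x.
    near=> y; rewrite /flat ifF//; apply/negbTE; rewrite -leNgt ltW//.
    by near: y; exact: lt_nbhsl.
  by apply: (near_eq_is_derive E).
have f0 : flat j 0 = 0 by rewrite /flat ltxx.
have H : h^-1 *: (flat j (h *: 1 + 0) - flat j 0) @[h --> (0:R)^'] --> (0 : R).
  apply/cvgrPdist_le => /= e e0.
  near=> h.
  rewrite f0 subr0 addr0 sub0r normrN normrM.
  rewrite /GRing.scale /= mulr1.
  have [hp|hn] := ltP 0 h; last first.
    by rewrite /flat ltNge hn /= normr0 mulr0 ltW.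
  rewrite normfV gtr0_norm// ger0_norm ?flat_ge0//.
  rewrite mulrC ler_pdivrMr//; apply: (le_trans (flat_le j hp)).
  rewrite expr2 mulrA ler_pM2r// mulrC -ler_pdivlMr ?ltr0n ?fact_gt0//.
  apply: (le_trans (ler_norm h)).
  near: h; apply: dnbhs0_le.
  by rewrite divr_gt0// ltr0n fact_gt0.
split.
  by apply/cvg_ex; exists 0.
exact: cvg_lim.
Unshelve. all: by end_near.
Qed.

Lemma is_derive_flat j (x : R) :
  is_derive x 1 (flat j) (- j%:R * flat j.+1 x + flat j.+2 x).
Proof.
have [x0|x0] := leP x 0; last exact: is_derive_flat_gt0.
rewrite {2 3}/flat ltNge x0 /= mulr0 addr0; exact: is_derive_flat_le0.
Qed.

Lemma times_derivable_flat k j : times_derivable k (flat j).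
Proof.
elim: k j => [//|k IH] j.
apply: (@times_derivable_is_derive R k _
  ((cst (- j%:R) \* flat j.+1) \+ flat j.+2)).
  by move=> x; exact: is_derive_flat.
apply: times_derivableD => //; apply: times_derivableM => //.
exact: times_derivable_cst.
Qed.

(** The classical smooth transition from [0] on [x <= 0] to [1] on [1 <= x]; the two terms of the
    denominator never vanish together. *)
Definition smoothstep (x : R) : R :=
  flat 0 x * (flat 0 x + flat 0 (- 1 * x + 1))^-1.

Let den_gt0 x : 0 < flat 0 x + flat 0 (- 1 * x + 1).
Proof.
have [x0|x0] := ltP 0 x.
  by rewrite ltr_pwDl ?flat_gt0 ?flat_ge0.
by rewrite ltr_wpDl ?flat_gt0 ?flat_ge0//; lra.
Qed.

Lemma times_derivable_smoothstep k : times_derivable k smoothstep.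
Proof.
apply: times_derivableM; first exact: times_derivable_flat.
apply: times_derivableV => [x|]; first by rewrite gt_eqF.
apply: times_derivableD; first exact: times_derivable_flat.
exact: (times_derivable_affine (-1) 1 (times_derivable_flat k 0)).
Qed.

Lemma smoothstep_ge0 x : 0 <= smoothstep x.
Proof. by rewrite mulr_ge0 ?flat_ge0// invr_ge0 ltW. Qed.

Lemma smoothstep_le1 x : smoothstep x <= 1.
Proof. by rewrite ler_pdivrMr// mul1r lerDl flat_ge0. Qed.

Lemma smoothstep_eq0 x : x <= 0 -> smoothstep x = 0.
Proof. by move=> x0; rewrite /smoothstep {1}/flat ltNge x0 mul0r. Qed.

Lemma smoothstep_eq1 x : 1 <= x -> smoothstep x = 1.
Proof.
move=> x1; have f0 : flat 0 (- 1 * x + 1) = 0.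
  by rewrite /flat ifF//; apply/negbTE; rewrite -leNgt; lra.
by have := den_gt0 x; rewrite /smoothstep f0 addr0 => ?; rewrite divff// gt_eqF.
Qed.

(* As a difference of two translates of the same step, [bump] sums to a constant
   over the lattice [Z/m] by telescoping; this is [sum_bump]. The factors [1] and
   [-1] match [times_derivable_affine]. *)
Definition bump (x : R) : R := smoothstep (1 * x + 1) + - 1 * smoothstep x.

Lemma times_derivable_bump k : times_derivable k bump.
Proof.
apply: (@times_derivableD R k (fun x => smoothstep (1 * x + 1))
  (cst (-1) \* smoothstep)).
  exact: times_derivable_affine (times_derivable_smoothstep k).
apply: times_derivableM; first exact: times_derivable_cst.
exact: times_derivable_smoothstep.
Qed.

Lemma bumpE x : bump x = smoothstep (x + 1) - smoothstep x.
Proof. by rewrite /bump mul1r mulN1r. Qed.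

Lemma bump_ge0 x : 0 <= bump x.
Proof.
rewrite bumpE; have [x0|/ltW x0] := leP x 0.
  by rewrite (smoothstep_eq0 x0) subr0 smoothstep_ge0.
by rewrite (@smoothstep_eq1 (x + 1)) ?subr_ge0 ?smoothstep_le1// lerDr.
Qed.

Lemma bump_eq0 x : 1 <= `|x| -> bump x = 0.
Proof.
rewrite bumpE ler_normr => /orP[x1|x1].
  by rewrite !smoothstep_eq1 ?subrr//; lra.
by rewrite !smoothstep_eq0 ?subrr//; lra.
Qed.

Lemma sum_bump (m N : nat) (z : R) : (0 < m)%N -> 1 <= z ->
  z + 1 <= N%:R / m%:R -> \sum_(k < N) bump (z - k%:R / m%:R) = m%:R.
Proof.
move=> m0 z1 zN.
have m0R : 0 < m%:R :> R by rewrite ltr0n.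
pose s k := smoothstep (z + 1 - k%:R / m%:R).
(* Telescoping with stride [m] leaves the first [m] values of [s] minus the last [m]. The first are
   all [1] because [1 <= z], the last all [0] because [z + 1 <= N / m]. *)
have Hs N' : \sum_(k < N') (s k - s (k + m)%N) =
             \sum_(k < m) s k - \sum_(k < m) s (N' + k)%N.
  elim: N' => [|N' IH]; first by rewrite big_ord0 subrr.
  rewrite big_ord_recr /= IH -!addrA; congr +%R.
    have := telescope_sumr (fun k => s (N' + k)%N) (leq0n m).
  rewrite big_mkord sumrB addn0.
  under [X in X - _]eq_bigr do rewrite addnS -addSn.
  by lra.
rewrite (eq_bigr (fun k : 'I_N => s k - s (k + m)%N)) => [|k _]; last first.
  rewrite bumpE /s natrD mulrDl divff ?gt_eqF//.
  by congr (smoothstep _ - smoothstep _); ring.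
rewrite Hs (eq_bigr (fun=> 1)) => [|k _]; last first.
  rewrite /s smoothstep_eq1//.
  have : k%:R / m%:R <= 1 :> R by rewrite ler_pdivrMr// mul1r ler_nat ltnW.
  by move: z1; lra.
rewrite sumr_const card_ord big1 ?subr0// => k _.
rewrite /s smoothstep_eq0//.
have : N%:R / m%:R <= (N + k)%:R / m%:R :> R.
  by rewrite ler_pM2r ?invr_gt0// ler_nat leq_addr.
by move: zN; lra.
Qed.

End flat.

(** * Calculus on row vectors *)

Lemma rV_norm_leP (R : realType) n (x : 'rV[R]_n) (M : R) : 0 <= M ->
  reflect (forall j, `|x 0 j| <= M) (`|x| <= M).
Proof.
move=> M0; rewrite [X in X <= _]mx_normrE.
apply: (iffP (bigmax_leP _ _ _ _)) => [[_ h] j|h]; first exact: (h (0, j)).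
by split=> // -[i j] _ /=; rewrite (ord1 i).
Qed.

Lemma coord_le_norm (R : realType) n (x : 'rV[R]_n) j : `|x 0 j| <= `|x|.
Proof. by have /rV_norm_leP := lexx `|x|; apply. Qed.

Lemma compact_norm_le (R : realType) n (M : R) :
  compact [set x : 'rV[R]_n | `|x| <= M].
Proof.
apply: bounded_closed_compact.
  by exists M; split; [exact: num_real|move=> N MN x /= /le_trans; apply; exact: ltW].
apply: (@preimage_closed _ _ (fun x : 'rV[R]_n => `|x|) [set y : R | y <= M]).
  by move=> x _; exact: norm_continuous.
exact: closed_le.
Qed.

(** Only [x] is confined to the compact ball, [y] may leave it. The covering form of compactness
    applies because, near each centre, half of the radius of continuity serves all nearby [x]. *)
Lemma unif_continuous_bounded (R : realType) n (f : 'rV[R]_n -> R) (M e : R) :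
  continuous f -> 0 < e ->
  exists2 d : R, 0 < d &
    forall x y : 'rV[R]_n, `|x| <= M -> `|x - y| < d -> `|f x - f y| < e.
Proof.
move=> cf e0.
have /compact_near_coveringP := @compact_norm_le R n M.
move=> /(_ R (0^'+) (fun d x => forall y : 'rV[R]_n, `|x - y| < d -> `|f x - f y| < e)).
case=> [x _|d /= d0 h].
  have e2 : 0 < e / 2 by rewrite divr_gt0.
  have /cvgrPdist_lt/(_ _ e2)/nbhs_ballP[r /= r0 hr] := cf x.
  have r2 : 0 < r / 2 by rewrite divr_gt0.
  exists (ball x (r / 2), [set d : R | 0 < d <= r / 2]).
    split; first exact: nbhsx_ballx.
    near=> d => /=; apply/andP; split; near: d; first exact: nbhs_right_gt.
    exact: nbhs_right_le.
  move=> [x' d] [/= bx /andP[d0 dr]] y xy.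
  have h1 : `|f x - f x'| < e / 2.
    apply: hr; rewrite -ball_normE /= in bx *.
    by apply: lt_le_trans bx _; lra.
  have h2 : `|f x - f y| < e / 2.
    apply: hr; rewrite -ball_normE /= in bx *.
    rewrite -(subrKA x'); apply: (le_lt_trans (ler_normD _ _)); lra.
  have -> : f x' - f y = (f x - f y) - (f x - f x') by ring.
  by apply: (le_lt_trans (ler_normB _ _)); lra.
exists (d / 2); first by rewrite divr_gt0.
move=> x y xM; apply: h => //=; last by rewrite divr_gt0.
by rewrite sub0r normrN gtr0_norm ?divr_gt0//; lra.
Unshelve. all: by end_near.
Qed.

(** Both sides have literally the same difference quotient; this reduces directional derivatives to
    calculus in one variable. *)
Lemma is_derive_line (R : realType) n (f : 'rV[R]_n -> R) (x v : 'rV[R]_n)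
    (t df : R) :
  is_derive (x + t *: v) v f df <->
  is_derive t 1 (fun s : R => f (x + s *: v)) df.
Proof.
have E : (fun h : R => h^-1 *: ((f \o shift (x + t *: v)) (h *: v) - f (x + t *: v)))
  = (fun h : R => h^-1 *: (((fun s : R => f (x + s *: v)) \o shift t) (h *: (1 : R))
       - f (x + t *: v))).
  apply/funext => h /=; congr (_ *: (f _ - _)).
  by rewrite [h *: 1]mulr1 scalerDl addrCA.
have dE : derivable f (x + t *: v) v = derivable (fun s : R => f (x + s *: v)) t 1.
  by rewrite /derivable E.
have vE : 'D_v f (x + t *: v) = 'D_1 (fun s : R => f (x + s *: v)) t.
  by rewrite /derive E.
by split=> -[h1 h2]; split; [rewrite -dE|rewrite -vE|rewrite dE|rewrite vE].
Qed.

Lemma MVT_sym (R : realType) (f df : R -> R) (a : R) :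
  (forall x : R, is_derive x 1 f (df x)) ->
  exists2 c : R, `|c| <= `|a| & f a - f 0 = df c * a.
Proof.
move=> hf.
have cf (b c : R) : {within `[b, c], continuous f}.
  by apply: derivable_within_continuous => x _; exact: ex_derive.
have [a0|a0] := leP 0 a.
  have [c + h] := MVT_segment a0 (fun x _ => hf x) (@cf _ _).
  rewrite in_itv /= => /andP[c0 ca]; exists c; last by rewrite h subr0.
  by rewrite !ger0_norm.
have [c + h] := MVT_segment (ltW a0) (fun x _ => hf x) (@cf _ _).
rewrite in_itv /= => /andP[c0 ca]; exists c; first by rewrite !ler0_norm ?lerN2// ltW.
by move: h; lra.
Qed.

(** Two mean value theorems: one for [s |-> f (x + s v) - f (x + (s - t) v)] on [[0, t]], one for
    [g] on the resulting interval of length [t]. Continuity of [h] is not involved. *)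
Lemma second_difference (R : realType) n (f g h : 'rV[R]_n -> R)
    (v x : 'rV[R]_n) (t : R) :
  (forall x : 'rV[R]_n, is_derive x v f (g x)) -> (forall x : 'rV[R]_n, is_derive x v g (h x)) ->
  0 <= t ->
  exists2 s : R, `|s| <= t &
    f (x + t *: v) + f (x - t *: v) - 2 * f x = t ^+ 2 * h (x + s *: v).
Proof.
move=> fg gh t0.
have dF (s : R) : is_derive s 1 (fun s : R => f (x + s *: v)) (g (x + s *: v)).
  exact/is_derive_line.
have dG (s : R) : is_derive s 1 (fun s : R => g (x + s *: v)) (h (x + s *: v)).
  exact/is_derive_line.
have dF' (s : R) : is_derive s 1 (fun s : R => f (x + (s - t) *: v)) (g (x + (s - t) *: v)).
  rewrite -[g _]mulr1; apply: (@is_derive1_comp R (fun s => f (x + s *: v)) (fun s => s - t)).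
  have -> : (fun s : R => s - t) = (fun s => 1 * s + - t) by apply/funext => y; ring.
  exact: is_derive_affine.
have dD (s : R) : is_derive s 1 (fun s : R => f (x + s *: v) - f (x + (s - t) *: v))
    (g (x + s *: v) - g (x + (s - t) *: v)).
  exact: (is_deriveB (dF s) (dF' s)).
have cD (b c : R) : {within `[b, c], continuous (fun s : R => f (x + s *: v) - f (x + (s - t) *: v))}.
  by apply: derivable_within_continuous => y _; exact: ex_derive.
have cG (b c : R) : {within `[b, c], continuous (fun s : R => g (x + s *: v))}.
  by apply: derivable_within_continuous => y _; exact: ex_derive.
have [a + Ea] := MVT_segment t0 (fun x _ => dD x) (@cD _ _).
rewrite in_itv /= => /andP[a0 at_].
have aa : a - t <= a by lra.
have [b + Eb] := MVT_segment aa (fun x _ => dG x) (@cG _ _).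
rewrite in_itv /= => /andP[b0 bt]; exists b.
  by rewrite ler_norml; apply/andP; split; lra.
rewrite subrr sub0r scale0r addr0 scaleNr subr0 Eb in Ea.
have -> : f (x + t *: v) + f (x - t *: v) - 2 * f x =
  f (x + t *: v) - f x - (f x - f (x - t *: v)) by ring.
by rewrite Ea; ring.
Qed.

Lemma second_difference_unif (R : realType) n (f g h : 'rV[R]_n -> R)
    (v : 'rV[R]_n) (M e : R) :
  (forall x : 'rV[R]_n, is_derive x v f (g x)) -> (forall x : 'rV[R]_n, is_derive x v g (h x)) ->
  continuous h -> 0 < e ->
  exists2 d : R, 0 < d & forall (x : 'rV[R]_n) (t : R), `|x| <= M -> 0 < t < d ->
    `|f (x + t *: v) + f (x - t *: v) - 2 * f x - t ^+ 2 * h x| <= e * t ^+ 2.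
Proof.
move=> fg gh ch e0; have [d d0 hd] := unif_continuous_bounded M ch e0.
exists (d / (1 + `|v|)); first by rewrite divr_gt0// ltr_pwDl.
move=> x t xM /andP[t0 td].
have [s st ->] := second_difference x fg gh (ltW t0).
have t2 : 0 <= t ^+ 2 by rewrite exprn_ge0// ltW.
rewrite -mulrBr normrM ger0_norm// mulrC; apply: ler_wpM2r => //.
rewrite distrC ltW// hd// opprD addrA subrr sub0r normrN normrZ.
rewrite ltr_pdivlMr ?ltr_pwDl// in td.
apply: le_lt_trans td; rewrite ler_pM//.
by rewrite lerDr.
Qed.

Lemma coordinate_path_bound (R : realType) n (f : 'rV[R]_n -> R)
    (g : 'I_n -> 'rV[R]_n -> R) (M : R) (y z : 'rV[R]_n) :
  (forall (x : 'rV[R]_n) i, is_derive x (delta_mx 0 i) f (g i x)) ->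
  (forall (x : 'rV[R]_n) i, `|x - y| <= `|z - y| -> `|g i x| <= M) ->
  `|f z - f y| <= M * n%:R * `|z - y|.
Proof.
move=> fg gM.
pose p (k : nat) : 'rV[R]_n := \row_j (if (j < k)%N then z 0 j else y 0 j).
have p0 : p 0%N = y by apply/rowP => j; rewrite mxE.
have pn : p n = z by apply/rowP => j; rewrite mxE ltn_ord.
have -> : f z - f y = \sum_(k < n) (f (p k.+1) - f (p k)).
  by rewrite -p0 -{1}pn -(telescope_sumr (f \o p) (leq0n n)) big_mkord.
apply: (le_trans (ler_norm_sum _ _ _)).
have -> : M * n%:R * `|z - y| = \sum_(k < n) M * `|z - y|.
  by rewrite sumr_const card_ord -[RHS]mulr_natr; ring.
apply: ler_sum => k _.
pose a := z 0 k - y 0 k.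
have pE : p k.+1 = p k + a *: delta_mx 0 k.
  apply/rowP => j; rewrite !mxE eqxx /= -val_eqE /= ltnS leq_eqVlt.
  case: eqP => [/ord_inj ->|_] /=; last by rewrite mulr0 addr0.
  by rewrite ltnn mulr1 addrC subrK.
have dF (s : R) : is_derive s 1 (fun s : R => f (p k + s *: delta_mx 0 k)) (g k (p k + s *: delta_mx 0 k)).
  exact/is_derive_line.
have [c ca] := MVT_sym a dF; rewrite scale0r addr0 -pE => ->.
have aM : `|a| <= `|z - y| by have := coord_le_norm (z - y) k; rewrite !mxE.
rewrite normrM ler_pM//; apply: gM; apply/rV_norm_leP => // j.
rewrite !mxE eqxx /= -val_eqE /=.
have := coord_le_norm (z - y) j; rewrite !mxE.
case: ltngtP => jk; rewrite ?mulr0 ?addr0 ?mulr1 //= ?subrr ?normr0 => h.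
  by [].
by rewrite addrAC subrr add0r (le_trans ca).
Qed.

Section coordinate_products.
Context (R : realType) (n : nat).
Implicit Type b : 'I_n -> R -> R.

(** Tensor products of functions of one variable: a partial derivative acts on a single factor, so
    the class is stable and [smooth] is read off factor by factor. *)
Definition prod_coord b (x : 'rV[R]_n) : R := \prod_j b j (x 0 j).

Lemma is_derive_prod_coord b i x :
  (forall j (y : R), derivable (b j) y 1) ->
  is_derive x (delta_mx 0 i) (prod_coord b)
    (prod_coord (fun j => if j == i then derive1 (b j) else b j) x).
Proof.
move=> db.
have h : is_derive (0 : R) 1 (fun s : R => prod_coord b (x + s *: delta_mx 0 i))
  (prod_coord (fun j => if j == i then derive1 (b j) else b j) x).
  have -> : (fun s : R => prod_coord b (x + s *: delta_mx 0 i)) =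
      (\prod_(j | j != i) b j (x 0 j)) *: (fun s : R => b i (1 * s + x 0 i)).
    apply/funext => s; rewrite /prod_coord (bigD1 i)//= mulrC /GRing.scale /=.
    congr (_ * _).
      by apply: eq_bigr => j ji; rewrite !mxE (negbTE ji) andbF mulr0 addr0.
    by rewrite !mxE !eqxx mulr1 mul1r addrC.
  have hb : is_derive (0 : R) 1 (fun s : R => b i (1 * s + x 0 i)) (derive1 (b i) (x 0 i)).
    rewrite -[derive1 _ _]mulr1; apply: is_derive1_comp.
      by rewrite mulr0 add0r; exact: derivable_is_derive1.
    exact: is_derive_affine.
  apply: is_derive_eq (is_deriveZ _ hb) _.
  rewrite /prod_coord [RHS](bigD1 i)//= eqxx mulrC; congr (_ * _).
  by apply: eq_bigr => j /negbTE ->.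
have {}h := (is_derive_line (prod_coord b) x (delta_mx 0 i) 0
  (prod_coord (fun j => if j == i then derive1 (b j) else b j) x)).2 h.
by rewrite scale0r addr0 in h.
Qed.

Lemma continuous_prod_coord b :
  (forall j, continuous (b j)) -> continuous (prod_coord b).
Proof.
move=> cb.
have H (s : seq 'I_n) : continuous (fun x : 'rV[R]_n => \prod_(j <- s) b j (x 0 j)).
  elim: s => [|j s IH] x.
    have -> : (fun x : 'rV[R]_n => \prod_(j <- [::]) b j (x 0 j)) = cst 1.
      by apply/funext => y; rewrite big_nil.
    exact: cst_continuous.
  have -> : (fun x : 'rV[R]_n => \prod_(j <- j :: s) b j (x 0 j)) =
    (fun x : 'rV[R]_n => b j (x 0 j) * \prod_(j <- s) b j (x 0 j)).
    by apply/funext => y; rewrite big_cons.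
  apply: continuousM; last exact: IH.
  apply: (@continuous_comp _ _ _ (fun x : 'rV[R]_n => x 0 j) (b j)).
    exact: coord_continuous.
  exact: cb.
exact: H.
Qed.

Lemma derivable_continuous1 (f : R -> R) :
  (forall x : R, derivable f x 1) -> continuous f.
Proof. by move=> df x; apply/differentiable_continuous/derivable1_diffP. Qed.

Lemma iter_partial_prod_coord b s :
  (forall j k (y : R), derivable (derive1n k (b j)) y 1) ->
  iter_partial s (prod_coord b) =
  prod_coord (fun j => derive1n (count_mem j s) (b j)).
Proof.
move=> db; elim: s => [//|i s IH] /=.
rewrite /partial IH; apply/funext => x.
have := @is_derive_prod_coord (fun j => derive1n (count_mem j s) (b j)) i x.
move=> /(_ (fun j => db j _)) h; rewrite derive_val.
apply: eq_bigr => j _; rewrite eq_sym.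
by case: (i == j); rewrite ?add1n ?derive1nS.
Qed.

Lemma smooth_prod_coord b :
  (forall j k (y : R), derivable (derive1n k (b j)) y 1) ->
  smooth (prod_coord b).
Proof.
move=> db s; rewrite iter_partial_prod_coord//; split.
  by apply: continuous_prod_coord => j; exact: derivable_continuous1.
by move=> i x; apply: ex_derive; apply: is_derive_prod_coord => j.
Qed.

End coordinate_products.

Lemma times_derivable_derive1n (R : realType) k (f : R -> R) :
  (forall k, times_derivable k f) -> forall y : R, derivable (derive1n k f) y 1.
Proof.
move=> h y; have := h k.+1.
by elim: k f h => [|k IH] f h; [case|case=> _; rewrite derive1Sn; apply: IH => k'; have [] := h k'.+1].
Qed.

(** * Cutoff and barrier functions *)

Section cutoff.
Context {R : realType}.
Implicit Types k s : R.

(** The exponent is at least [2], so at the kink the difference quotient is at most [|h|] once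
    [|h| <= 1]. *)
Lemma is_derive_maxX (j : nat) (x : R) :
  is_derive x 1 (fun y : R => Num.max y 0 ^+ j.+2)
    (j.+2%:R * Num.max x 0 ^+ j.+1).
Proof.
have [x0|x0|->] := ltgtP x 0.
- have E : \near x, cst 0 x = Num.max x 0 ^+ j.+2 :> R.
    near=> y; rewrite max_r ?expr0n//; apply: ltW.
    by near: y; exact: lt_nbhsl.
  rewrite expr0n mulr0.
  by apply: (near_eq_is_derive E).
- have E : \near x, ((@id R) ^+ j.+2) x = Num.max x 0 ^+ j.+2 :> R.
    near=> y; have y0 : 0 < y by near: y; exact: lt_nbhsr.
    by rewrite (max_l (ltW y0)) fctE.
  apply: (near_eq_is_derive E).
  by apply: is_derive_eq (is_deriveX _ (is_derive_id x (1 : R))) _; rewrite [_ *: _]mulr1.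
have H : h^-1 *: (Num.max (h *: (1 : R) + 0) 0 ^+ j.+2 - Num.max 0 0 ^+ j.+2) @[h --> (0 : R)^'] --> (0 : R).
  apply/cvgrPdist_le => /= e e0.
  near=> h.
  have h0 : h != 0 by near: h; exact: nbhs_dnbhs_neq.
  rewrite maxxx expr0n subr0 addr0 sub0r normrN [h *: 1]mulr1 normrM.
  rewrite [`|h^-1|]normfV.
  have hm : `|Num.max h 0 ^+ j.+2| <= `|h| * `|h|.
    rewrite normrX.
    have mh : `|Num.max h 0| <= `|h|.
      by case: (leP h 0) => hh; rewrite ?normr0.
    have h1 : `|h| <= 1 by near: h; apply: dnbhs0_le.
    apply: (@le_trans _ _ (`|h| ^+ j.+2)); first by rewrite lerXn2r ?nnegrE.
    by rewrite !exprS mulrA ler_piMr ?mulr_ge0// exprn_ile1.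
  rewrite mulrC ler_pdivrMr ?normr_gt0//; apply: (le_trans hm).
  rewrite ler_wpM2r//.
  by near: h; apply: dnbhs0_le.
rewrite expr0n mulr0; split; first by apply/cvg_ex; exists 0.
exact: cvg_lim.
Unshelve. all: by end_near.
Qed.

(* [cutoff2 k] is the hat function on [[k, 3 k]] with integral [1], and [cutoff1 k],
   [cutoff k] are its successive primitives vanishing on [s <= k]. *)
Definition cutoff k s : R :=
  (Num.max (s - k) 0 ^+ 3 - 2 * Num.max (s - 2 * k) 0 ^+ 3
   + Num.max (s - 3 * k) 0 ^+ 3) / (6 * k ^+ 2).

Definition cutoff1 k s : R :=
  (Num.max (s - k) 0 ^+ 2 - 2 * Num.max (s - 2 * k) 0 ^+ 2
   + Num.max (s - 3 * k) 0 ^+ 2) / (2 * k ^+ 2).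

Definition cutoff2 k s : R :=
  (Num.max (s - k) 0 - 2 * Num.max (s - 2 * k) 0 + Num.max (s - 3 * k) 0)
  / k ^+ 2.

Lemma is_derive_maxX_shift (j : nat) (c x : R) :
  is_derive x 1 (fun y : R => Num.max (y - c) 0 ^+ j.+2)
    (j.+2%:R * Num.max (x - c) 0 ^+ j.+1).
Proof.
have ds : is_derive x 1 (fun y : R => y - c) 1.
  have -> : (fun y : R => y - c) = (fun y => 1 * y + - c).
    by apply/funext => y; rewrite mul1r.
  exact: is_derive_affine.
rewrite -[_ * _]mulr1.
exact: (@is_derive1_comp R (fun y => Num.max y 0 ^+ j.+2) (fun y => y - c)
  x _ _ (is_derive_maxX j (x - c)) ds).
Qed.

Let is_derive_comb (j : nat) (c k x : R) :
  is_derive x 1 (fun s : R => (Num.max (s - k) 0 ^+ j.+2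
     - 2 * Num.max (s - 2 * k) 0 ^+ j.+2 + Num.max (s - 3 * k) 0 ^+ j.+2) / c)
   ((Num.max (x - k) 0 ^+ j.+1
     - 2 * Num.max (x - 2 * k) 0 ^+ j.+1 + Num.max (x - 3 * k) 0 ^+ j.+1)
     * (j.+2%:R / c)).
Proof.
have h := is_deriveZ c^-1 (is_deriveD (is_deriveB
   (is_derive_maxX_shift j k x)
   (is_deriveZ 2 (is_derive_maxX_shift j (2 * k) x)))
   (is_derive_maxX_shift j (3 * k) x)).
have -> : (fun s : R => (Num.max (s - k) 0 ^+ j.+2
     - 2 * Num.max (s - 2 * k) 0 ^+ j.+2 + Num.max (s - 3 * k) 0 ^+ j.+2) / c) =
  c^-1 *: ((fun y : R => Num.max (y - k) 0 ^+ j.+2) -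
          2 *: (fun y : R => Num.max (y - 2 * k) 0 ^+ j.+2) +
          (fun y : R => Num.max (y - 3 * k) 0 ^+ j.+2)).
  by apply/funext => s; rewrite mulrC.
apply: is_derive_eq h _.
have sc (a b : R) : a *: (b : R^o) = a * b by [].
by rewrite !sc; move: (j.+2%:R) (c^-1) => u v; ring.
Qed.

Lemma is_derive_cutoff k x : k != 0 ->
  is_derive (x : R) 1 (cutoff k) (cutoff1 k x).
Proof.
move=> k0; apply: is_derive_eq (is_derive_comb 1 _ k x) _.
by rewrite /cutoff1; congr (_ * _); field.
Qed.

Lemma is_derive_cutoff1 k x : k != 0 ->
  is_derive (x : R) 1 (cutoff1 k) (cutoff2 k x).
Proof.
move=> k0; apply: is_derive_eq (is_derive_comb 0 _ k x) _.
by rewrite /cutoff2 !expr1; congr (_ * _); field.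
Qed.

Lemma cutoff2_ge0 k s : 0 < k -> 0 <= cutoff2 k s.
Proof.
move=> k0; have k0' := ltW k0; rewrite divr_ge0 ?exprn_ge0//.
by case: (leP (s - k)); case: (leP (s - 2 * k)); case: (leP (s - 3 * k)); lra.
Qed.

Lemma cutoff2_le k s : 0 < k -> cutoff2 k s <= k^-1.
Proof.
move=> k0; rewrite ler_pdivrMr ?exprn_gt0//.
rewrite expr2 mulrA mulVf ?gt_eqF// mul1r.
by case: (leP (s - k)); case: (leP (s - 2 * k)); case: (leP (s - 3 * k)); lra.
Qed.

Lemma cutoff2_eq0 k s : 0 < k -> (s <= k) || (3 * k <= s) -> cutoff2 k s = 0.
Proof.
move=> k0 h; rewrite /cutoff2.
suff -> : Num.max (s - k) 0 - 2 * Num.max (s - 2 * k) 0 + Num.max (s - 3 * k) 0 = 0 by rewrite mul0r.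
case/orP: h => h.
  by rewrite !max_r; lra.
by rewrite !max_l; lra.
Qed.

Lemma cutoff1_ge0 k s : 0 < k -> 0 <= cutoff1 k s.
Proof.
move=> k0; have k0' := ltW k0; rewrite divr_ge0 ?mulr_ge0 ?exprn_ge0//.
by case: (leP (s - k)); case: (leP (s - 2 * k)); case: (leP (s - 3 * k)); nra.
Qed.

Lemma cutoff1_eq0 k s : 0 < k -> s <= k -> cutoff1 k s = 0.
Proof.
by move=> k0 h; rewrite /cutoff1 !max_r; try lra; rewrite expr0n /= mulr0 subr0 addr0 mul0r.
Qed.

Lemma cutoff1_eq1 k s : 0 < k -> 3 * k <= s -> cutoff1 k s = 1.
Proof.
move=> k0 h; rewrite /cutoff1 !max_l; try lra.
apply: (canLR (mulfK _)); first by rewrite mulf_neq0// expf_neq0// gt_eqF.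
by ring.
Qed.

Lemma cutoff_eq0 k s : 0 < k -> s <= k -> cutoff k s = 0.
Proof.
by move=> k0 h; rewrite /cutoff !max_r; try lra; rewrite expr0n /= mulr0 subr0 addr0 mul0r.
Qed.

Lemma le_cutoff k s t : 0 < k -> s <= t -> cutoff k s <= cutoff k t.
Proof.
move=> k0 st.
have dc x : is_derive (x : R) 1 (cutoff k) (cutoff1 k x).
  by apply: is_derive_cutoff; rewrite gt_eqF.
have cc : {within `[s, t], continuous (cutoff k)}.
  by apply: derivable_within_continuous => y _; exact: ex_derive.
have [c _] := MVT_segment st (fun x _ => dc x) cc.
rewrite -subr_ge0 => ->; rewrite mulr_ge0 ?subr_ge0//; exact: cutoff1_ge0.
Qed.

Lemma cutoff_ge0 k s : 0 < k -> 0 <= cutoff k s.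
Proof.
move=> k0; have [sk|/ltW sk] := leP s k; first by rewrite cutoff_eq0.
by rewrite -(cutoff_eq0 k0 (lexx k)); exact: le_cutoff.
Qed.

(** The constant [4 = 1 + 2 + 1] adds up the absolute weights of the three 1-Lipschitz terms. *)
Lemma lipschitz_cutoff2 k s t : 0 < k ->
  `|cutoff2 k s - cutoff2 k t| <= 4 / k ^+ 2 * `|s - t|.
Proof.
move=> k0; wlog st : s t / t <= s.
  by move=> H; have [/H//|/ltW /H] := leP t s; rewrite distrC (distrC t).
have k0' := ltW k0.
rewrite /cutoff2 -mulrBl normrM [`|(k ^+ 2)^-1|]ger0_norm ?invr_ge0 ?exprn_ge0//.
rewrite mulrAC ler_pM2r ?invr_gt0 ?exprn_gt0//.
rewrite (ger0_norm (_ : 0 <= s - t)) ?subr_ge0// ler_norml.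
have H c : 0 <= Num.max (s - c) 0 - Num.max (t - c) 0 <= s - t.
  by case: (leP (s - c) 0); case: (leP (t - c) 0) => ? ?; apply/andP; split; lra.
have := H k; have := H (2 * k); have := H (3 * k).
by move=> /andP[? ?] /andP[? ?] /andP[? ?]; apply/andP; split; lra.
Qed.

Lemma continuous_cutoff1 k : 0 < k -> continuous (cutoff1 k).
Proof.
move=> k0; apply: derivable_continuous1 => x; apply: ex_derive.
by apply: is_derive_cutoff1; rewrite gt_eqF.
Qed.

Lemma continuous_cutoff2 k : 0 < k -> continuous (cutoff2 k).
Proof.
move=> k0 x; have c0 : 0 < 4 / k ^+ 2 by rewrite divr_gt0// exprn_gt0.
apply/cvgrPdist_le => /= e e0; near=> y.
apply: (le_trans (lipschitz_cutoff2 x y k0)).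
rewrite -ler_pdivlMl// mulrC.
near: y; apply: cvgr_dist_le; first exact: cvg_id.
exact: divr_gt0.
Unshelve. all: by end_near.
Qed.

End cutoff.

Lemma is_derive_comp_rV (R : realType) n (f : R -> R) (g : 'rV[R]_n -> R)
    (x v : 'rV[R]_n) (a b : R) :
  is_derive (g x) 1 f a -> is_derive x v g b -> is_derive x v (f \o g) (a * b).
Proof.
move=> df dg.
have x0 : x + 0 *: v = x by rewrite scale0r addr0.
rewrite -x0; apply/is_derive_line.
apply: (@is_derive1_comp R f (fun s : R => g (x + s *: v))); first by rewrite x0.
by apply/is_derive_line; rewrite x0.
Qed.

Section barrier.
Context (R : realType) (n : nat) (k A lam : R) (k0 : 0 < k).
Implicit Types y : 'rV[R]_n.

Definition sqnorm y : R := \sum_j y 0 j ^+ 2.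

Let E y : R := expR (- lam * sqnorm y).

(** The smooth comparison function, to be translated to the centre of an exterior ball. As [cutoff]
    is only a cubic spline, its first and pure second partial derivatives are given explicitly by
    [barrier1] and [barrier2]. *)
Definition barrier y : R := cutoff k (A - E y).

Definition barrier1 (i : 'I_n) y : R := cutoff1 k (A - E y) * (2 * lam * y 0 i * E y).

Definition barrier2 (i : 'I_n) y : R :=
  cutoff2 k (A - E y) * (2 * lam * y 0 i * E y) ^+ 2 +
  cutoff1 k (A - E y) * ((2 * lam - 4 * lam ^+ 2 * y 0 i ^+ 2) * E y).

Lemma is_derive_sqnorm y (i : 'I_n) : is_derive y (delta_mx 0 i) sqnorm (2 * y 0 i).
Proof.
have h : is_derive (0 : R) 1 (fun s : R => sqnorm (y + s *: delta_mx 0 i)) (2 * y 0 i).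
  have -> : (fun s : R => sqnorm (y + s *: delta_mx 0 i)) =
     (2 * y 0 i) *: (@id R) + cst (sqnorm y) + (@id R) ^+ 2.
    apply/funext => s; rewrite /sqnorm !fctE (bigD1 i)//= [in RHS](bigD1 i)//=.
    rewrite !mxE !eqxx mulr1 /GRing.scale /=.
    rewrite [X in _ + X = _](eq_bigr (fun j => y 0 j ^+ 2)) => [|j ji]; last first.
      by rewrite !mxE (negbTE ji) andbF mulr0 addr0.
    by move: (\sum_(_ < _ | _) _) => S; ring.
  have h := is_deriveD (is_deriveD (is_deriveZ (2 * y 0 i) (is_derive_id (0 : R) (1 : R)))
     (is_derive_cst (sqnorm y) (0 : R) (1 : R))) (is_deriveX 2 (is_derive_id (0 : R) (1 : R))).
  apply: is_derive_eq h _; rewrite /GRing.scale /=.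
  by rewrite !mulr1 addr0 expr1 mulr0 addr0.
by have := (is_derive_line sqnorm y (delta_mx 0 i) 0 _).2 h; rewrite scale0r addr0.
Qed.

Let is_derive_E y (i : 'I_n) : is_derive y (delta_mx 0 i) E (- (2 * lam * y 0 i * E y)).
Proof.
have h1 := is_deriveZ (- lam) (is_derive_sqnorm y i).
have h2 := is_derive_comp_rV (is_derive_expR (((- lam) *: sqnorm) y)) h1.
by apply: is_derive_eq h2 _; rewrite /GRing.scale /= /E; ring.
Qed.

Let is_derive_AE y (i : 'I_n) :
  is_derive y (delta_mx 0 i) (fun y => A - E y) (2 * lam * y 0 i * E y).
Proof.
have h := is_deriveB (is_derive_cst A y (delta_mx 0 i)) (is_derive_E y i).
by apply: is_derive_eq h _; rewrite sub0r opprK.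
Qed.

Lemma is_derive_barrier y (i : 'I_n) :
  is_derive y (delta_mx 0 i) barrier (barrier1 i y).
Proof.
apply: is_derive_comp_rV (is_derive_AE y i).
by apply: is_derive_cutoff; rewrite gt_eqF.
Qed.

Lemma is_derive_coord y (i j : 'I_n) :
  is_derive y (delta_mx 0 i) (fun y => y 0 j) ((i == j)%:R).
Proof.
have h : is_derive (0 : R) 1 (fun s : R => (y + s *: delta_mx 0 i) 0 j) ((i == j)%:R).
  have -> : (fun s : R => (y + s *: delta_mx 0 i) 0 j) =
     (fun s => (i == j)%:R * s + y 0 j).
    by apply/funext => s; rewrite !mxE eqxx /= eq_sym addrC mulrC.
  exact: is_derive_affine.
by have := (is_derive_line (fun y => y 0 j) y (delta_mx 0 i) 0 _).2 h;
  rewrite scale0r addr0.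
Qed.

Lemma is_derive_barrier1 y (i : 'I_n) :
  is_derive y (delta_mx 0 i) (barrier1 i) (barrier2 i y).
Proof.
have kn0 : k != 0 by rewrite gt_eqF.
have h1 := is_derive_comp_rV (is_derive_cutoff1 (A - E y) kn0) (is_derive_AE y i).
have h2 := is_deriveM (is_deriveZ (2 * lam) (is_derive_coord y i i)) (is_derive_E y i).
apply: is_derive_eq (is_deriveM h1 h2) _.
rewrite eqxx /GRing.scale /= /barrier2 !fctE.
have -> : ((2 * lam) \*: (fun y : 'rV[R]_n => y 0 i)) y = 2 * lam * y 0 i by [].
by rewrite /GRing.scale /=; ring.
Qed.

Lemma continuous_sqnorm : continuous sqnorm.
Proof.
move=> y; rewrite /sqnorm.
have H (s : seq 'I_n) : {for y, continuous (fun x : 'rV[R]_n => \sum_(j <- s) x 0 j ^+ 2)}.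
  elim: s => [|j s IH].
    have -> : (fun x : 'rV[R]_n => \sum_(j <- [::]) x 0 j ^+ 2) = cst 0.
      by apply/funext => z; rewrite big_nil.
    exact: cst_continuous.
  have -> : (fun x : 'rV[R]_n => \sum_(j <- j :: s) x 0 j ^+ 2) =
    (fun x : 'rV[R]_n => x 0 j * x 0 j + \sum_(j <- s) x 0 j ^+ 2).
    by apply/funext => z; rewrite big_cons expr2.
  apply: continuousD; last exact: IH.
  by apply: continuousM; exact: coord_continuous.
exact: H.
Qed.

Let continuous_E : continuous E.
Proof.
move=> y; apply: (@continuous_comp _ _ _ (fun y => - lam * sqnorm y) expR).
  by apply: continuousM; [exact: cst_continuous|exact: continuous_sqnorm].
exact: continuous_expR.
Qed.

Lemma continuous_barrier2 (i : 'I_n) : continuous (barrier2 i).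
Proof.
have cA : continuous (fun y => A - E y).
  by move=> y; apply: continuousB; [exact: cst_continuous|exact: continuous_E].
have c1 : continuous (fun y => cutoff1 k (A - E y)).
  by move=> y; apply: (@continuous_comp _ _ _ (fun y => A - E y) (cutoff1 k));
    [exact: cA|exact: continuous_cutoff1].
have c2 : continuous (fun y => cutoff2 k (A - E y)).
  by move=> y; apply: (@continuous_comp _ _ _ (fun y => A - E y) (cutoff2 k));
    [exact: cA|exact: continuous_cutoff2].
have cc : continuous (fun y : 'rV[R]_n => y 0 i) by exact: coord_continuous.
have cl : continuous (fun y : 'rV[R]_n => 2 * lam * y 0 i * E y).
  move=> y; apply: (@continuousM _ _ (fun y => 2 * lam * y 0 i)); last exact: continuous_E.
  by apply: (@continuousM _ _ (cst (2 * lam))); [exact: cst_continuous|exact: cc].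
rewrite /barrier2 => y.
apply: (@continuousD _ _ _ (fun y => cutoff2 k (A - E y) * (2 * lam * y 0 i * E y) ^+ 2)).
  apply: continuousM; first exact: c2.
  have -> : (fun y : 'rV[R]_n => (2 * lam * y 0 i * E y) ^+ 2) =
     (fun y => (2 * lam * y 0 i * E y) * (2 * lam * y 0 i * E y)).
    by apply/funext => z; rewrite expr2.
  by apply: continuousM; exact: cl.
apply: (@continuousM _ _ (fun y => cutoff1 k (A - E y))); first exact: c1.
apply: (@continuousM _ _ (fun y : 'rV[R]_n => 2 * lam - 4 * lam ^+ 2 * y 0 i ^+ 2));
  last exact: continuous_E.
apply: continuousB; first exact: cst_continuous.
apply: continuousM; first exact: cst_continuous.
have -> : (fun y : 'rV[R]_n => y 0 i ^+ 2) = (fun y => y 0 i * y 0 i).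
  by apply/funext => z; rewrite expr2.
by apply: continuousM; exact: cc.
Qed.

(** The Laplacian of [A - E] is [(2 n lam - 4 lam^2 |y|^2) E]. With [lam = n / r^2] and [|y| >= r]
    the second term is at least [4 n lam E], so the total is at most [- 2 n lam E]. The squared
    gradient, [4 lam^2 |y|^2 E^2], is bounded using [E <= 1]. *)
Lemma sum_barrier2_le (r Q : R) y : (0 < n)%N -> 0 < r -> lam = n%:R / r ^+ 2 ->
  r ^+ 2 <= sqnorm y <= Q ->
  \sum_i barrier2 i y <= 4 * lam ^+ 2 * Q * cutoff2 k (A - E y)
    - 2 * n%:R * lam * expR (- lam * Q) * cutoff1 k (A - E y).
Proof.
move=> n0 r0 lamE /andP[rq qQ].
have lam0 : 0 < lam by rewrite lamE divr_gt0 ?ltr0n// exprn_gt0.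
have E0 : 0 < E y by exact: expR_gt0.
have E1 : E y <= 1.
  rewrite /E expR_le1 mulNr oppr_le0 mulr_ge0 ?(ltW lam0)//.
  by apply: le_trans rq; rewrite exprn_ge0// ltW.
have EQ : expR (- lam * Q) <= E y by rewrite /E ler_expR !mulNr lerN2 ler_pM2l.
have -> : \sum_i barrier2 i y =
   cutoff2 k (A - E y) * (4 * lam ^+ 2 * sqnorm y * E y ^+ 2) +
   cutoff1 k (A - E y) * ((2 * n%:R * lam - 4 * lam ^+ 2 * sqnorm y) * E y).
  rewrite big_split /= -!mulr_sumr; congr (_ * _ + _ * _).
    rewrite /sqnorm mulr_sumr mulr_suml; by apply: eq_bigr => i _; ring.
  rewrite -mulr_suml; congr (_ * _).
  rewrite sumrB -mulr_sumr; congr (_ - _).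
    by rewrite sumr_const card_ord -mulr_natr; ring.
  by rewrite /sqnorm mulr_sumr.
have c1 := cutoff1_ge0 (A - E y) k0; have c2 := cutoff2_ge0 (A - E y) k0.
apply: lerD.
  rewrite mulrC ler_wpM2r//.
  have s0 : 0 <= sqnorm y by apply: le_trans rq; rewrite exprn_ge0// ltW.
  have p0 : 0 <= 4 * lam ^+ 2 by rewrite mulr_ge0// exprn_ge0// ltW.
  rewrite -mulrA [leRHS]mulrC -[leRHS]mulrC ler_wpM2l//.
  rewrite -[leRHS]mulr1 ler_pM// ?exprn_ge0 ?exprn_ile1//; exact: ltW.
rewrite -[leRHS]mulNr [leLHS]mulrC; apply: ler_wpM2r => //.
have lr : 4 * n%:R * lam <= 4 * lam ^+ 2 * sqnorm y.
  have -> : 4 * n%:R * lam = 4 * lam ^+ 2 * r ^+ 2.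
    by rewrite lamE; field; rewrite gt_eqF.
  by rewrite ler_wpM2l// mulr_ge0// exprn_ge0// ltW.
have nl : 0 <= 2 * n%:R * lam by rewrite !mulr_ge0// ltW.
have : (2 * n%:R * lam) * expR (- lam * Q) <= (2 * n%:R * lam) * E y by rewrite ler_wpM2l.
have : (4 * n%:R * lam) * E y <= 4 * lam ^+ 2 * sqnorm y * E y by rewrite ler_wpM2r// ltW.
lra.
Qed.

End barrier.

(** * The distance to the complement and exterior balls *)

Section euclidean_norm.
Context {R : realType} {n : nat}.
Implicit Types x y z : 'rV[R]_n.

Lemma sqnorm_ge0 x : 0 <= sqnorm x.
Proof. by apply: sumr_ge0 => j _; exact: sqr_ge0. Qed.

Lemma enorm_ge0 x : 0 <= enorm x.
Proof. exact: sqrtr_ge0. Qed.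

Lemma enorm_sqr x : enorm x ^+ 2 = sqnorm x.
Proof. by rewrite /enorm sqr_sqrtr//; exact: sqnorm_ge0. Qed.

Lemma enorm_leP x (r : R) : 0 <= r -> (enorm x <= r) = (sqnorm x <= r ^+ 2).
Proof.
by move=> r0; rewrite -enorm_sqr ler_pXn2r ?nnegrE ?enorm_ge0.
Qed.

Lemma enormN x : enorm (- x) = enorm x.
Proof.
by congr Num.sqrt; apply: eq_bigr => j _; rewrite mxE sqrrN.
Qed.

Lemma enormZ (a : R) x : enorm (a *: x) = `|a| * enorm x.
Proof.
rewrite /enorm -sqrtr_sqr -sqrtrM ?sqr_ge0//; congr Num.sqrt.
by rewrite mulr_sumr; apply: eq_bigr => j _; rewrite mxE exprMn.
Qed.

Lemma coord_le_enorm x j : `|x 0 j| <= enorm x.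
Proof.
rewrite -sqrtr_sqr ler_wsqrtr// (bigD1 j)//= lerDl.
by apply: sumr_ge0 => i _; exact: sqr_ge0.
Qed.

Lemma norm_le_enorm x : `|x| <= enorm x.
Proof. by apply/rV_norm_leP => [|j]; [exact: enorm_ge0|exact: coord_le_enorm]. Qed.

Lemma enorm_le_norm x : enorm x <= n%:R * `|x|.
Proof.
rewrite enorm_leP ?mulr_ge0//.
apply: (@le_trans _ _ (\sum_(j < n) `|x| ^+ 2)).
  apply: ler_sum => j _; rewrite -[x 0 j ^+ 2]real_normK ?num_real//.
  by rewrite ler_pXn2r ?nnegrE// coord_le_norm.
rewrite sumr_const card_ord exprMn -[leLHS]mulr_natl.
apply: ler_wpM2r; first exact: sqr_ge0.
by rewrite -natrX ler_nat; case: (n) => // m; rewrite leq_pmulr.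
Qed.

Lemma cauchy_schwarz x y : \sum_j x 0 j * y 0 j <= enorm x * enorm y.
Proof.
have [x0|x0] := eqVneq (enorm x) 0.
  rewrite x0 mul0r big1// => j _.
  by have := coord_le_enorm x j; rewrite x0 normr_le0 => /eqP ->; rewrite mul0r.
have [y0|y0] := eqVneq (enorm y) 0.
  rewrite y0 mulr0 big1// => j _.
  by have := coord_le_enorm y j; rewrite y0 normr_le0 => /eqP ->; rewrite mulr0.
have xp : 0 < enorm x by rewrite lt_neqAle eq_sym x0 enorm_ge0.
have yp : 0 < enorm y by rewrite lt_neqAle eq_sym y0 enorm_ge0.
(* The square of [|y| x - |x| y]; expanding it leaves a positive multiple of the desired
   difference. *)
have : 0 <= \sum_j (x 0 j * enorm y - y 0 j * enorm x) ^+ 2.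
  by apply: sumr_ge0 => j _; exact: sqr_ge0.
have -> : \sum_j (x 0 j * enorm y - y 0 j * enorm x) ^+ 2 =
  2 * (enorm x * enorm y) * (enorm x * enorm y - \sum_j x 0 j * y 0 j).
  rewrite (eq_bigr (fun j => enorm y ^+ 2 * x 0 j ^+ 2 + enorm x ^+ 2 * y 0 j ^+ 2
     - 2 * (enorm x * enorm y) * (x 0 j * y 0 j))); last by move=> j _; ring.
  rewrite sumrB big_split /= -!mulr_sumr -/(sqnorm x) -/(sqnorm y) -!enorm_sqr; ring.
by rewrite pmulr_rge0 ?subr_ge0// !mulr_gt0.
Qed.

Lemma sqnormD x y :
  sqnorm (x + y) = sqnorm x + 2 * (\sum_j x 0 j * y 0 j) + sqnorm y.
Proof.
rewrite /sqnorm mulr_sumr -!big_split /=; apply: eq_bigr => j _.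
by rewrite mxE; ring.
Qed.

Lemma enormD x y : enorm (x + y) <= enorm x + enorm y.
Proof.
rewrite enorm_leP ?addr_ge0 ?enorm_ge0// sqnormD -!enorm_sqr.
have := cauchy_schwarz x y; set S := \sum_(_ < _) _; nra.
Qed.

Lemma enorm_dist x y z : enorm (x - z) <= enorm (x - y) + enorm (y - z).
Proof. by rewrite -[x - z](subrKA y) enormD. Qed.

Lemma enormC x y : enorm (x - y) = enorm (y - x).
Proof. by rewrite -enormN opprB. Qed.

Lemma continuous_enorm : continuous (@enorm R n).
Proof.
move=> x; apply: (@continuous_comp _ _ _ (@sqnorm R n) Num.sqrt).
  exact: continuous_sqnorm.
exact: sqrt_continuous.
Qed.

End euclidean_norm.

Section distance_to_complement.
Context {R : realType} {n : nat} (U : set 'rV[R]_n).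
Hypothesis oU : open U.
Hypothesis U0 : ~` U !=set0.
Implicit Types x y z p : 'rV[R]_n.

(** Unlike [dist_boundary], this distance vanishes outside [U], while being 1-Lipschitz on the whole
    space. The two agree on [U] by [dist_boundaryE]. *)
Definition cdist (x : 'rV[R]_n) : R := inf [set enorm (x - y) | y in ~` U].

Let has_inf_cdist x : has_inf [set enorm (x - y) | y in ~` U].
Proof.
split; first by case: U0 => y Uy; exists (enorm (x - y)); exists y.
by exists 0 => _ [y _ <-]; exact: enorm_ge0.
Qed.

Lemma cdist_le x y : ~ U y -> cdist x <= enorm (x - y).
Proof. by move=> Uy; apply: ge_inf; [exact: (has_inf_cdist x).2|exists y]. Qed.

Lemma cdist_ge0 x : 0 <= cdist x.
Proof.
apply: lb_le_inf; first exact: (has_inf_cdist x).1.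
by move=> _ [y _ <-]; exact: enorm_ge0.
Qed.

Lemma cdist_eq0 x : ~ U x -> cdist x = 0.
Proof.
move=> Ux; apply/eqP; rewrite eq_le cdist_ge0 andbT.
have := cdist_le x Ux; rewrite subrr; congr (_ <= _).
by rewrite -(scale0r 0) enormZ normr0 mul0r.
Qed.

Lemma cdist_lipschitz x y : `|cdist x - cdist y| <= enorm (x - y).
Proof.
have H a b : cdist a <= enorm (a - b) + cdist b.
  rewrite -lerBlDl; apply: lb_le_inf; first exact: (has_inf_cdist b).1.
  move=> _ [z Uz <-]; rewrite lerBlDl.
  by apply: le_trans (enorm_dist a b z); exact: cdist_le.
rewrite ler_norml; apply/andP; split.
  by have := H y x; rewrite enormC; lra.
by have := H x y; lra.
Qed.

Lemma cdist_attained x : exists2 p, ~ U p & cdist x = enorm (x - p).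
Proof.
have [y0 Uy0] := U0.
pose D := enorm (x - y0).
pose A := ~` U `&` [set y | enorm (x - y) <= D].
have cf : continuous (fun y => enorm (x - y)).
  move=> y; apply: (@continuous_comp _ _ _ (fun y => x - y) (@enorm R n)).
    by apply: continuousB; [exact: cst_continuous|exact: cvg_id].
  exact: continuous_enorm.
have cA : compact A.
  apply: bounded_closed_compact.
    exists (`|x| + D); split; first exact: num_real.
    move=> N DN y [_ /= yD]; apply: le_trans (ltW DN).
    rewrite -[y](subKr x); apply: (le_trans (ler_normB _ _)); rewrite lerD2l.
    exact: le_trans (norm_le_enorm _) yD.
  apply: closedI; first exact: open_closedC.
  apply: (@preimage_closed _ _ (fun y => enorm (x - y)) [set r | r <= D]).
    by move=> y _; exact: cf.
  exact: closed_le.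
have A0 : A !=set0 by exists y0; split => //=.
have [p pA pmin] := EVT_min_rV A0 cA (continuous_subspaceT cf).
rewrite inE in pA; have [Up pD] := pA; exists p => //.
apply/eqP; rewrite eq_le cdist_le//=.
apply: lb_le_inf; first exact: (has_inf_cdist x).1.
move=> _ [z Uz <-]; have [zD|/ltW Dz] := leP (enorm (x - z)) D.
  by apply: pmin; rewrite inE.
exact: le_trans pD Dz.
Qed.

Lemma cdist_gt0 x : U x -> 0 < cdist x.
Proof.
move=> Ux; have [p Up ->] := cdist_attained x.
rewrite lt_neqAle enorm_ge0 andbT eq_sym; apply/eqP => h.
apply: Up; suff -> : p = x by [].
apply/rowP => j; have := coord_le_enorm (x - p) j.
by rewrite h normr_le0 !mxE subr_eq0 => /eqP.
Qed.

Lemma lt_cdist x y : enorm (x - y) < cdist x -> U y.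
Proof. by move=> h; apply: contrapT => Uy; have := cdist_le x Uy; lra. Qed.

(** The points [p + t (x - p)] with small [t > 0] are closer to [x] than [cdist U x], hence lie in
    [U], and they tend to [p]. *)
Lemma nearest_boundary x p : U x -> ~ U p -> cdist x = enorm (x - p) ->
  boundary U p.
Proof.
move=> Ux Up dxp; split; last by move=> /interior_subset.
move=> B /nbhs_ballP[e /= e0 Be].
have d0 : 0 < cdist x by exact: cdist_gt0.
pose t := Num.min 1 (e / 2 / (1 + enorm (x - p))).
have e1 : 0 < 1 + enorm (x - p) by rewrite ltr_pwDl ?enorm_ge0.
have t0 : 0 < t by rewrite lt_min ltr01 !divr_gt0.
have t1 : t <= 1 by rewrite ge_min lexx.
have te : t * enorm (x - p) < e.
  have : t <= e / 2 / (1 + enorm (x - p)) by rewrite ge_min lexx orbT.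
  rewrite ler_pdivlMr// => h; rewrite dxp in d0; nra.
exists (p + t *: (x - p)); split.
  apply: (@lt_cdist x).
  have -> : x - (p + t *: (x - p)) = (1 - t) *: (x - p).
    by rewrite scalerBl scale1r opprD addrA.
  by rewrite enormZ ger0_norm ?subr_ge0//; rewrite dxp in d0 *; nra.
apply: Be; rewrite -ball_normE /= opprD addrA subrr sub0r normrN.
apply: (le_lt_trans (norm_le_enorm _)).
by rewrite enormZ gtr0_norm.
Qed.

Lemma boundary_subC p : boundary U p -> ~ U p.
Proof. by move=> [_ h] Up; apply: h; exact: open_nbhs_nbhs. Qed.

Lemma dist_boundaryE x : U x -> dist_boundary U x = cdist x.
Proof.
move=> Ux; have [p Up dxp] := cdist_attained x.
have bp := nearest_boundary Ux Up dxp.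
apply/eqP; rewrite eq_le; apply/andP; split.
  rewrite dxp; apply: ge_inf; last by exists p.
  by exists 0 => _ [y _ <-]; exact: enorm_ge0.
apply: lb_le_inf; first by exists (enorm (x - p)); exists p.
by move=> _ [y by_ <-]; apply: cdist_le; exact: boundary_subC.
Qed.

(** The segment from [x] to [c] crosses the sphere of radius [r] at a point outside [U], at distance
    [|x - c| - r] from [x]. *)
Lemma cdist_exterior_ball (r : R) x c : 0 < r -> U x ->
  (forall z, U z -> r < enorm (z - c)) -> r + cdist x <= enorm (x - c).
Proof.
move=> r0 Ux h; have := h _ Ux; set d := enorm (x - c) => rd.
have d0 : 0 < d by exact: lt_trans rd.
pose z := c + (r / d) *: (x - c).
have zc : enorm (z - c) = r.
  rewrite /z addrAC subrr add0r enormZ -/d ger0_norm ?divr_ge0 ?(ltW r0) ?(ltW d0)//.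
  by rewrite divfK// gt_eqF.
have Uz : ~ U z by move=> /h; rewrite zc ltxx.
have := cdist_le x Uz.
have -> : x - z = (1 - r / d) *: (x - c).
  by rewrite /z scalerBl scale1r opprD addrA.
rewrite enormZ -/d ger0_norm; last by rewrite subr_ge0 ler_pdivrMr// mul1r ltW.
by rewrite mulrBl mul1r divfK ?gt_eqF//; lra.
Qed.

End distance_to_complement.

(** Subtract the linear part [L] of [f] at [y] and apply [coordinate_path_bound] twice: to [f - L],
    and to each [g i] in order to bound the partial derivatives of [f - L]. *)
Lemma taylor2_bound (R : realType) m (f : 'rV[R]_m -> R)
    (g : 'I_m -> 'rV[R]_m -> R) (h : 'I_m -> 'I_m -> 'rV[R]_m -> R) (M : R)
    (y z : 'rV[R]_m) :
  (forall x i, is_derive (x : 'rV[R]_m) (delta_mx 0 i) f (g i x)) ->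
  (forall x i j, is_derive (x : 'rV[R]_m) (delta_mx 0 i) (g j) (h i j x)) ->
  (forall (x : 'rV[R]_m) i j, `|x - y| <= `|z - y| -> `|h i j x| <= M) ->
  `|f z - f y - \sum_j g j y * (z 0 j - y 0 j)| <=
    M * m%:R * m%:R * `|z - y| ^+ 2.
Proof.
move=> fg gh hM.
pose L (x : 'rV[R]_m) := \sum_j g j y * x 0 j.
have dL x i : is_derive (x : 'rV[R]_m) (delta_mx 0 i) L (g i y).
  have H : is_derive (0 : R) 1 (fun s : R => L (x + s *: delta_mx 0 i)) (g i y).
    have -> : (fun s : R => L (x + s *: delta_mx 0 i)) = (fun s => g i y * s + L x).
      apply/funext => s; rewrite /L [in LHS](bigD1 i)//= [in RHS](bigD1 i)//=.
      rewrite !mxE !eqxx mulr1 addrA; congr (_ + _); first ring.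
      by apply: eq_bigr => j ji; rewrite !mxE (negbTE ji) andbF mulr0 addr0.
    exact: is_derive_affine.
  by have := (is_derive_line L x (delta_mx 0 i) 0 _).2 H; rewrite scale0r addr0.
have dF x i : is_derive (x : 'rV[R]_m) (delta_mx 0 i) (f - L) (g i x - g i y).
  exact: is_deriveB (fg x i) (dL x i).
have -> : f z - f y - \sum_j g j y * (z 0 j - y 0 j) = (f - L) z - (f - L) y.
  rewrite !fctE /L -[RHS]addrA opprB.
  under eq_bigr do rewrite mulrBr.
  by rewrite sumrB; ring.
rewrite expr2 mulrA.
have -> : M * m%:R * m%:R * `|z - y| * `|z - y| =
  (M * m%:R * `|z - y|) * m%:R * `|z - y| by ring.
apply: coordinate_path_bound dF _ => x i xz.
(* In dimension [0] the sign of [M] is unknown, but the product vanishes. *)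
have M0 : 0 <= M * m%:R.
  have [m0|m0] := posnP m; first by rewrite m0 mulr0.
  have := hM y (Ordinal m0) (Ordinal m0).
  by rewrite subrr normr0 => /(_ (normr_ge0 _)) h0; rewrite mulr_ge0// (le_trans (normr_ge0 _) h0).
apply: (@le_trans _ _ (M * m%:R * `|x - y|)).
  apply: (coordinate_path_bound (fun x j => gh x j i)) => w j wx.
  by apply: hM; exact: le_trans wx xz.
by rewrite ler_wpM2l.
Qed.

(** The inequality is strict so that points of the sphere itself lie outside [U], as
    [cdist_exterior_ball] requires. *)
Definition has_exterior_ball {R : realType} {n} (U : set 'rV[R]_n) (r : R)
    (p : 'rV[R]_n) : Prop :=
  exists2 c, enorm (p - c) = r & forall z, U z -> r < enorm (z - c).

Lemma finite_upper_bound (R : realType) (T : finType) (a : T -> R) :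
  exists2 C, 0 <= C & forall t, a t <= C.
Proof.
exists (\sum_t `|a t|) => [|t]; first by apply: sumr_ge0.
by rewrite (bigD1 t)//= (le_trans (ler_norm _))// lerDl; apply: sumr_ge0.
Qed.

(* The ball of radius [r] centred on the outer normal [N] of the graph at [p] stays
   outside of the domain as soon as [2 r] times the second-order Taylor constant of
   the graph is at most [1]; this constant is uniform near [x0]. *)
Lemma exterior_ball_near (R : realType) n (U : set 'rV[R]_n) (x0 : 'rV[R]_n)
    (i : 'I_n) (b : bool) (g : 'rV[R]_n.-1 -> R) :
  smooth g ->
  (\forall y \near x0, U y <-> g (col' i y) < (-1) ^+ b * y 0 i) ->
  \forall p \near x0 & r \near (0 : R)^'+, ~ U p -> has_exterior_ball U r p.
Proof.
move=> sg /nbhs_ballP[e /= e0 Ue].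
have [g1 [g2 [dg dg1 cg2]]] : exists g1 : 'I_n.-1 -> 'rV[R]_n.-1 -> R,
    exists g2 : 'I_n.-1 -> 'I_n.-1 -> 'rV[R]_n.-1 -> R,
    [/\ forall x j, is_derive (x : 'rV[R]_n.-1) (delta_mx 0 j) g (g1 j x),
     forall x j k, is_derive (x : 'rV[R]_n.-1) (delta_mx 0 j) (g1 k) (g2 j k x)
     & forall j k, continuous (g2 j k)].
  exists (fun j => partial j g), (fun j k => partial j (partial k g)).
  split=> [x j|x j k|j k]; last exact: (sg [:: j; k]).1.
    by apply/derivableP; exact: (sg [::]).2.
  by apply/derivableP; exact: (sg [:: k]).2.
pose y0 := col' i x0.
have [C2 C20 C2E] := finite_upper_bound (fun jk => `|g2 jk.1 jk.2 y0| + 1).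
have : \forall y \near y0, forall jk : 'I_n.-1 * 'I_n.-1, `|g2 jk.1 jk.2 y| <= C2.
  have := @filter_forall _ ('I_n.-1 * 'I_n.-1)%type
    (fun jk y => `|g2 jk.1 jk.2 y| <= C2) (nbhs y0) _; apply => -[j k].
  have /cvgrPdist_lt/(_ _ ltr01) := cg2 j k y0.
  apply: filterS => y hy; apply: le_trans (C2E (j, k)); rewrite [_.1]/= [_.2]/=.
  rewrite -[g2 j k y](subKr (g2 j k y0)).
  by apply: (le_trans (ler_normB _ _)); rewrite lerD2l ltW.
move=> /nbhs_ballP[e' /= e'0 gC].
pose C := C2 * n.-1%:R * n.-1%:R.
have C0 : 0 <= C by rewrite !mulr_ge0.
pose eta := Num.min e e'.
have eta0 : 0 < eta by rewrite lt_min e0.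
(* The bound [eta / 4] keeps every point within [2 r] of [p] inside the ball where the graph
   description and the bound [C2] hold; the other bound gives [2 r C <= 1]. *)
pose r0 := Num.min (eta / 4) (2 * (C + 1))^-1.
have r00 : 0 < r0 by rewrite lt_min divr_gt0//= invr_gt0 mulr_gt0// ltr_pwDr.
exists (ball x0 (eta / 4), [set r : R | 0 < r < r0]).
  split; first by apply: nbhsx_ballx; rewrite divr_gt0.
  near=> r => /=; apply/andP; split; near: r; first exact: nbhs_right_gt.
  exact: nbhs_right_lt.
move=> [p r] [/= px /andP[r_gt0 rr0]] Up.
rewrite -ball_normE /= in px.
have eta_e : eta <= e by rewrite ge_min lexx.
have eta_e' : eta <= e' by rewrite ge_min lexx orbT.
have r_eta : r < eta / 4 by apply: lt_le_trans rr0 _; rewrite ge_min lexx.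
have r_C : 2 * r * C <= 1.
  have : r <= (2 * (C + 1))^-1 by apply: ltW; apply: lt_le_trans rr0 _; rewrite ge_min lexx orbT.
  by rewrite -[_^-1]mul1r ler_pdivlMr ?mulr_gt0 ?ltr_pwDr//; nra.
pose s : R := (-1) ^+ b.
have s2 : s ^+ 2 = 1 by rewrite /s -exprM mulnC exprM sqrrN expr1n expr1n.
pose p' := col' i p.
(* The gradient at [p] of [g (y') - s y_i], which is negative in the domain: [N] points outwards. *)
pose N : 'rV[R]_n := \row_k (if unlift i k is Some j then g1 j p' else - s).
have Ni : N 0 i = - s by rewrite mxE unlift_none.
have Nl j : N 0 (lift i j) = g1 j p' by rewrite mxE liftK.
have N2 : sqnorm N = 1 + \sum_j g1 j p' ^+ 2.
  rewrite /sqnorm (bigD1_ord i)//= Ni sqrrN s2; congr (_ + _).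
  by apply: eq_bigr => j _; rewrite Nl.
have N1 : 1 <= enorm N.
  rewrite -(sqrtr1 R) ler_wsqrtr// -/(sqnorm N) N2 lerDl.
  by apply: sumr_ge0 => j _; exact: sqr_ge0.
have N0 : 0 < enorm N by exact: lt_le_trans N1.
pose rho := r / enorm N.
have rho0 : 0 < rho by rewrite divr_gt0.
have rhoN : rho * enorm N = r by rewrite divfK// gt_eqF.
exists (p + rho *: N).
  by rewrite opprD addrA subrr sub0r enormN enormZ gtr0_norm.
move=> z Uz; rewrite ltNge; apply/negP => zc.
pose w := z - p.
have ew : enorm w <= 2 * r.
  rewrite /w -[z - p](subrKA (p + rho *: N)).
  apply: (le_trans (enormD _ _)).
  by rewrite [p + _ - p]addrAC subrr add0r enormZ gtr0_norm// rhoN; lra.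
have nw : `|w| <= 2 * r by exact: le_trans (norm_le_enorm _) ew.
have gz : g (col' i z) < s * z 0 i.
  apply/(Ue z) => //; rewrite -ball_normE /=.
  rewrite -(subrKA p); apply: (le_lt_trans (ler_normD _ _)).
  by rewrite distrC in nw; rewrite /w in nw; rewrite (distrC p); move: nw; rewrite distrC; lra.
have gp : s * p 0 i <= g p'.
  rewrite leNgt; apply/negP => h; apply: Up; apply/(Ue p) => //.
  by rewrite -ball_normE /=; lra.
have col_le (v v' : 'rV[R]_n) : `|col' i v - col' i v'| <= `|v - v'|.
  apply/rV_norm_leP => // j; rewrite !mxE.
  by have := coord_le_norm (v - v') (lift i j); rewrite !mxE.
have T : `|g (col' i z) - g p' - \sum_j g1 j p' * (col' i z 0 j - p' 0 j)| <=
    C * `|col' i z - p'| ^+ 2.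
  apply: (taylor2_bound dg dg1) => x j k xz.
  apply: (gC x _ (j, k)); rewrite -ball_normE /= -(subrKA p').
  apply: (le_lt_trans (ler_normD _ _)); rewrite [`|p' - x|]distrC.
  have := col_le x0 p; have := col_le z p; rewrite -/p' -/y0 -/w; lra.
have sq : `|col' i z - p'| ^+ 2 <= sqnorm w.
  rewrite -enorm_sqr ler_pXn2r ?nnegrE ?enorm_ge0//.
  exact: le_trans (col_le z p) (norm_le_enorm _).
(* Expanding [|w - rho N|^2 <= r^2 = rho^2 |N|^2] gives [|w|^2 <= 2 rho (w . N)]. *)
have key : sqnorm w <= 2 * rho * (\sum_j g1 j p' * (col' i z 0 j - p' 0 j) - s * w 0 i).
  move: zc; rewrite enorm_leP ?(ltW r_gt0)//.
  have -> : z - (p + rho *: N) = w + - rho *: N by rewrite opprD addrA scaleNr.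
  rewrite sqnormD -[sqnorm (- rho *: N)]enorm_sqr enormZ normrN gtr0_norm// rhoN.
  rewrite (bigD1_ord i)//= !mxE -/N unlift_none.
  rewrite (eq_bigr (fun j => - rho * (g1 j p' * (col' i z 0 j - p' 0 j)))); last first.
    by move=> j _; rewrite !mxE liftK; ring.
  by rewrite -mulr_sumr; set S := \sum_(_ < _) _; lra.
(* Since [rho <= r] and [2 r C <= 1], this says [C |w|^2 <= w . N]. Taylor's bound with
   [g (z') < s z_i] and [s p_i <= g (p')] gives the strict reverse inequality. *)
have C_key : C * sqnorm w <= \sum_j g1 j p' * (col' i z 0 j - p' 0 j) - s * w 0 i.
  move: key; set S := _ - _ => key.
  have : C * sqnorm w <= C * (2 * r * S) by rewrite ler_wpM2l//; nra.
  by nra.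
have wi : w 0 i = z 0 i - p 0 i by rewrite !mxE.
move: T; rewrite ler_norml => /andP[T _].
have : C * `|col' i z - p'| ^+ 2 <= C * sqnorm w by rewrite ler_wpM2l.
by rewrite wi in C_key; lra.
Unshelve. all: by end_near.
Qed.

(** [exterior_ball_near] lets [p] and [r] vary jointly, which is exactly the local hypothesis of the
    covering form of compactness; the compact set is the boundary. *)
Lemma uniform_exterior_ball (R : realType) n (U : set 'rV[R]_n) :
  open U -> bounded_set U -> smooth_boundary U ->
  exists2 r : R, 0 < r & forall p, boundary U p -> has_exterior_ball U r p.
Proof.
move=> oU bU sU.
have cB : compact (boundary U).
  apply: bounded_closed_compact.
    case: bU => M [Mr hM]; exists (M + 1); split; first exact: num_real.
    move=> N MN x [cx _].
    have N0 : 0 < N - (M + 1) by rewrite subr_gt0.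
    have [y [Uy xy]] := cx (ball x (N - (M + 1))) (nbhsx_ballx _ _ N0).
    have yM : `|y| <= M + 1 by apply: hM => //; rewrite ltrDl.
    rewrite -ball_normE /= in xy.
    rewrite -[x](subrK y); apply: (le_trans (ler_normD _ _)); lra.
  rewrite /boundary setDE; apply: closedI; first exact: closed_closure.
  exact/open_closedC/open_interior.
have /compact_near_coveringP := cB.
move=> /(_ R (0^'+) (fun r p => ~ U p -> has_exterior_ball U r p)).
case=> [x /sU[i [b [g [sg Ug]]]]|d /= d0 h].
  exact: exterior_ball_near sg Ug.
exists (d / 2); first by rewrite divr_gt0.
move=> p bp; apply: (h (d / 2)) => //=.
- by rewrite sub0r normrN gtr0_norm ?divr_gt0//; lra.
- by rewrite divr_gt0.
- by case: bp => _ ni Up; apply: ni; exact: open_nbhs_nbhs.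
Qed.

(** Take the exterior ball at a nearest point [p] of the complement. The lower bound is
    [cdist_exterior_ball]; equality at [x] is the triangle inequality through [p]. *)
Lemma touching_exterior_ball (R : realType) n (U : set 'rV[R]_n) :
  open U -> ~` U !=set0 -> bounded_set U -> smooth_boundary U ->
  exists2 r : R, 0 < r & forall x, U x ->
    exists2 c, enorm (x - c) = r + cdist U x &
      forall y, U y -> r + cdist U y <= enorm (y - c).
Proof.
move=> oU U0 bU sU; have [r r0 hr] := uniform_exterior_ball oU bU sU.
exists r => // x Ux.
have [p Up dxp] := cdist_attained oU U0 x.
have [c pc hc] := hr p (nearest_boundary oU U0 Ux Up dxp).
have H y : U y -> r + cdist U y <= enorm (y - c).
  by move=> Uy; exact: cdist_exterior_ball.
exists c => //; apply/eqP; rewrite eq_le H// andbT.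
by rewrite -pc dxp [leRHS]addrC enorm_dist.
Qed.

(** * Regularity of finite measures on Lebesgue sets *)

Lemma lipschitz_continuous (R : realType) n (f : 'rV[R]_n -> R) (K : R) :
  (forall x y, `|f x - f y| <= K * enorm (x - y)) -> continuous f.
Proof.
move=> fK x A /nbhs_ballP[e /= e0 eA].
apply/nbhs_ballP; exists (e / (`|K| * n%:R + 1)); first exact: divr_gt0.
move=> y; rewrite -ball_normE /= ltr_pdivlMr// mulrC => xy.
apply: eA; rewrite -ball_normE /=.
apply: (le_lt_trans (fK x y)); apply: le_lt_trans xy.
rewrite mulrDl mul1r -mulrA -[leLHS]addr0 lerD//.
apply: (@le_trans _ _ (`|K| * enorm (x - y))).
  by apply: ler_wpM2r; [exact: enorm_ge0|exact: ler_norm].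
by apply: ler_wpM2l => //; exact: enorm_le_norm.
Qed.

Lemma cvgn_exists_le (R : realFieldType) (u : (\bar R)^nat) (l e : \bar R) :
  u N @[N --> \oo] --> l -> (l < e)%E -> exists N, (u N <= e)%E.
Proof.
move=> ul le_.
have /ul[N _ /(_ N (leqnn N)) hN] : nbhs l [set y | (y < e)%E].
  by apply: open_nbhs_nbhs; split => //; exact: open_ereal_lt_ereal.
by exists N; exact: ltW.
Qed.

(* [lebesgue_space] is a Caratheodory completion on row vectors while the Borel
   structure lives on tuples, whence the transport along [row_of_tuple]. *)
Section borel_lebesgue.
Context {R : realType} {n : nat}.
Notation tupleR := (n.-tuple (measurableTypeR R)).
Notation mu := (lebesgue_Rn R n).

Definition row_of_tuple (t : tupleR) : 'rV[R]_n := \row_i tnth t i.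
Definition tuple_of_row (x : 'rV[R]_n) : tupleR := [tuple x 0 i | i < n].

Lemma row_of_tupleK : cancel row_of_tuple tuple_of_row.
Proof.
by move=> t; apply: eq_from_tnth => i; rewrite tnth_mktuple mxE.
Qed.

Lemma tuple_of_rowK : cancel tuple_of_row row_of_tuple.
Proof. by move=> x; apply/rowP => i; rewrite mxE tnth_mktuple. Qed.

(** An open set is the union of the countably many boxes with rational centre and radius [1/(k+1)]
    that it contains. *)
Lemma measurable_row_of_tuple_open (U : set 'rV[R]_n) : open U ->
  measurable (row_of_tuple @^-1` U).
Proof.
move=> oU.
pose box (p : {ffun 'I_n -> rat} * nat) : set 'rV[R]_n :=
  [set x | forall i, `|ratr (p.1 i) - x 0 i| < p.2.+1%:R^-1].
pose F p : set tupleR :=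
  row_of_tuple @^-1` (if `[< box p `<=` U >] then box p else set0).
have -> : row_of_tuple @^-1` U = \bigcup_p F p.
  apply/seteqP; split => [t /= Ut|t [p _]]; last first.
    by rewrite /F /=; case: asboolP => // h; exact: h.
  have : nbhs (row_of_tuple t) U by exact: open_nbhs_nbhs.
  move=> /nbhs_ballP[e /= e0 eU].
  have [k ke] : exists k, k.+1%:R^-1 < e / 2 :> R.
    have e2 : 0 < e / 2 by rewrite divr_gt0.
    have [k _ /(_ k (leqnn k)) hk] := near_infty_natSinv_lt (PosNum e2).
    by exists k.
  have hq i : exists q : rat, `|ratr q - row_of_tuple t 0 i| < k.+1%:R^-1.
    have lt1 : row_of_tuple t 0 i - k.+1%:R^-1 < row_of_tuple t 0 i + k.+1%:R^-1.
      by apply: (@lt_trans _ _ (row_of_tuple t 0 i)); rewrite ?ltrBlDr ltrDl.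
    have [q] := rat_in_itvoo lt1; rewrite in_itv /= => h.
    by exists q; rewrite ltr_distl.
  have [q hq'] := choice hq.
  exists ([ffun i => q i], k) => //; rewrite /F /=.
  case: asboolP => [_|]; first by move=> i /=; rewrite ffunE; exact: hq'.
  case=> x hx; apply: eU; rewrite -ball_normE /=.
  apply: (@le_lt_trans _ _ (k.+1%:R^-1 + k.+1%:R^-1)); last first.
    by move: ke; move: (k.+1%:R^-1) => a; lra.
  apply/rV_norm_leP => [|i]; first by rewrite addr_ge0.
  have := hx i; have := hq' i; rewrite /= ffunE => h1 h2.
  have -> : (row_of_tuple t - x) 0 i =
      (ratr (q i) - x 0 i) - (ratr (q i) - row_of_tuple t 0 i).
    by rewrite [LHS]mxE [(- x) 0 i]mxE opprB [RHS]addrC subrKA.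
  by apply: (le_trans (ler_normB _ _)); apply: lerD; exact: ltW.
apply: countable_bigcupT_measurable; first exact: countableP.
move=> p; rewrite /F; case: asboolP => _; last by rewrite preimage_set0.
have -> : row_of_tuple @^-1` box p = \bigcap_(i in [set: 'I_n])
    ((fun t : tupleR => tnth t i) @^-1` (ball (ratr (p.1 i) : R) p.2.+1%:R^-1)).
  apply/seteqP; split => t /= h i; first by move=> _; have := h i; rewrite mxE.
  by have := h i I; rewrite mxE.
apply: fin_bigcap_measurable; first exact: finite_finset.
move=> i _; rewrite -[X in measurable X]setTI.
apply: (@measurable_tnth _ (measurableTypeR R) n i) => //.
by apply: measurable_realfun.open_measurable; exact: ball_open.
Qed.

Lemma lebesgue_measurable_tuple (B : set tupleR) : measurable B ->
  measurable (tuple_of_row @^-1` B : set (lebesgue_space R n)).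
Proof.
move=> mB.
suff H : (@lebesgue_outer R n).-caratheodory (tuple_of_row @^-1` B) by exact: H.
move=> X; have := @caratheodory_measurable_mu_ext _ R _ (lebesgue_tuple R n) B mB.
move=> /(_ [set t | X (row_of_tuple t)]).
rewrite /lebesgue_outer => ->; congr (_ + _)%E; congr mu_ext;
  by apply/seteqP; split => t /=; rewrite -/(row_of_tuple t) row_of_tupleK.
Qed.

Lemma lebesgue_Rn_tuple (B : set tupleR) : measurable B ->
  mu (tuple_of_row @^-1` B) = lebesgue_tuple R n B.
Proof.
move=> mB; rewrite -[RHS]measurable_mu_extE// /lebesgue_Rn /lebesgue_outer.
congr (mu_ext _ _).
by apply/seteqP; split => t /=; rewrite -/(row_of_tuple t) row_of_tupleK.
Qed.

Lemma lebesgue_measurable_open (U : set 'rV[R]_n) : open U ->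
  measurable (U : set (lebesgue_space R n)).
Proof.
move=> /measurable_row_of_tuple_open/lebesgue_measurable_tuple.
congr measurable; apply/seteqP; split => x /=; by rewrite tuple_of_rowK.
Qed.

Lemma lebesgue_measurable_closed (F : set 'rV[R]_n) : closed F ->
  measurable (F : set (lebesgue_space R n)).
Proof.
move=> cF; rewrite -(setCK F); apply: measurableC.
by apply: lebesgue_measurable_open; exact: closed_openC.
Qed.

Lemma continuous_measurable_rV (f : 'rV[R]_n -> R) (D : set (lebesgue_space R n)) :
  continuous f -> measurable D -> measurable_fun D (f : lebesgue_space R n -> R).
Proof.
move=> cf mD; apply: (measurability (@measurable_realfun.RGenOpens.G R)).
  exact: measurable_realfun.RGenOpens.measurableE.
move=> _ [_ [a [b ->] <-]]; apply: measurableI => //.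
apply: lebesgue_measurable_open; apply: open_comp; last exact: interval_open.
by move=> x _; exact: cf.
Qed.

(** The outer measure is an infimum over measurable covers: intersect covers that are optimal up to
    [1/(k+1)]. *)
Lemma lebesgue_hull (A : set (lebesgue_space R n)) : (mu A < +oo)%E ->
  exists2 B : set tupleR, measurable B &
    A `<=` tuple_of_row @^-1` B /\ (mu (tuple_of_row @^-1` B) <= mu A)%E.
Proof.
move=> Aoo.
pose A' : set tupleR := [set t | A (row_of_tuple t)].
have muA : mu A = mu_ext (lebesgue_tuple R n) A' by [].
have Afin : mu A \is a fin_num by rewrite ge0_fin_numE.
have H k : exists B : set tupleR, [/\ measurable B, A' `<=` B &
    (lebesgue_tuple R n B <= mu A + k.+1%:R^-1%:E)%E].
  have k0 : 0 < k.+1%:R^-1 :> R by rewrite invr_gt0.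
  have Afin' := Afin; rewrite muA /mu_ext in Afin'.
  have [_ [F [mF AF] <-] hF] := lb_ereal_inf_adherent k0 Afin'.
  exists (\bigcup_i F i); split => //; first exact: bigcup_measurable.
  apply: le_trans (ltW hF).
  by apply: measure_sigma_subadditive => //; exact: bigcup_measurable.
have [B hB] := choice H.
have mB : measurable (\bigcap_k B k) by apply: bigcap_measurable => // k _; have [] := hB k.
exists (\bigcap_k B k) => //; split.
  move=> x Ax k _; have [_ h _] := hB k; apply: h.
  by rewrite /A' /= tuple_of_rowK.
rewrite lebesgue_Rn_tuple//.
apply/lee_addgt0Pr => e e0.
have [k _ /(_ k (leqnn k)) hk] := near_infty_natSinv_lt (PosNum e0).
have [mBk _ hBk] := hB k.
apply: (@le_trans _ _ (lebesgue_tuple R n (B k))).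
  by apply: le_measure; rewrite ?inE// => x; apply.
by apply: (le_trans hBk); rewrite leeD2l// lee_fin ltW.
Qed.

Lemma lebesgue_sigma_finite_cover : exists G : (set (lebesgue_space R n))^nat,
  [/\ forall k, measurable (G k), forall k, (mu (G k) < +oo)%E &
      \bigcup_k G k = setT].
Proof.
have [F FT hF] := sigma_finiteT (lebesgue_tuple R n).
exists (fun k => tuple_of_row @^-1` (F k)); split => [k|k|].
- by apply: lebesgue_measurable_tuple; have [] := hF k.
- by have [mF Fk] := hF k; rewrite lebesgue_Rn_tuple.
- apply/seteqP; split => // x _.
  have [k _ Fk] : (\bigcup_k F k) (tuple_of_row x) by rewrite -FT.
  by exists k.
Qed.

(** Replaces a Lebesgue set by a Borel one up to a null set, since regularity is obtained for Borel
    sets; finiteness allows the subtraction of measures. *)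
Lemma lebesgue_hull_negligible (A : set (lebesgue_space R n)) :
  measurable A -> (mu A < +oo)%E ->
  exists2 B : set tupleR, measurable B &
    A `<=` tuple_of_row @^-1` B /\ mu (tuple_of_row @^-1` B `\` A) = 0%E.
Proof.
move=> mA Aoo; have [B mB [AB BA]] := lebesgue_hull Aoo.
have mB' := lebesgue_measurable_tuple mB.
exists B => //; split => //.
have Boo : (mu (tuple_of_row @^-1` B) < +oo)%E by exact: le_lt_trans Aoo.
have BAE : mu (tuple_of_row @^-1` B) = mu A.
  by apply/eqP; rewrite eq_le BA/= le_measure ?inE.
by rewrite measureD// (setIidr AB) [X in (X - _)%E]BAE subee// ge0_fin_numE.
Qed.

End borel_lebesgue.

Section regular_sets.
Context {R : realType} {n : nat}.
Variable nu : {measure set (lebesgue_space R n) -> \bar R}.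
Hypothesis nuoo : (nu setT < +oo)%E.

(** Closed approximation from inside and open approximation from outside together, so that the
    condition is symmetric under complement. *)
Definition regular_set (A : set 'rV[R]_n) := forall e : R, 0 < e ->
  exists F V : set 'rV[R]_n,
    [/\ closed F, open V, F `<=` A, A `<=` V & (nu (V `\` F) <= e%:E)%E].

Lemma regular_setC A : regular_set A -> regular_set (~` A).
Proof.
move=> h e /h[F [V [cF oV FA AV nuVF]]].
exists (~` V), (~` F); split; [exact: open_closedC|exact: closed_openC
  |exact: subsetC|exact: subsetC|].
by rewrite setDE setCK setIC -setDE.
Qed.

Let finite_nu (A : set (lebesgue_space R n)) : measurable A -> (nu A < +oo)%E.
Proof.
by move=> mA; apply: le_lt_trans nuoo; apply: le_measure; rewrite ?inE.
Qed.

(** The errors [e / 2^(k+2)] add up to [e / 2]. The union of the inner closed sets need not be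
    closed, so it is cut at a finite stage; continuity from above of the finite measure absorbs the
    remainder. *)
Lemma regular_set_bigcup (A : (set 'rV[R]_n)^nat) :
  (forall k, regular_set (A k)) -> regular_set (\bigcup_k A k).
Proof.
move=> h e e0.
have H k : exists FV : set 'rV[R]_n * set 'rV[R]_n,
   [/\ closed FV.1, open FV.2, FV.1 `<=` A k, A k `<=` FV.2 &
     (nu (FV.2 `\` FV.1) <= (e / 2 / (2 ^ k.+1)%:R)%:E)%E].
  have ek : 0 < e / 2 / (2 ^ k.+1)%:R.
    by rewrite !divr_gt0// ltr0n expn_gt0.
  by have [F [V ?]] := h k _ ek; exists (F, V).
have [FV hFV] := choice H.
pose F k := (FV k).1; pose V k := (FV k).2.
have cF k : closed (F k) by have [] := hFV k.
have oV k : open (V k) by have [] := hFV k.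
have FA k : F k `<=` A k by have [] := hFV k.
have AV k : A k `<=` V k by have [] := hFV k.
have nuVF k : (nu (V k `\` F k) <= (e / 2 / (2 ^ k.+1)%:R)%:E)%E by have [] := hFV k.
have mF k : measurable (F k : set (lebesgue_space R n)) by exact: lebesgue_measurable_closed.
have mV k : measurable (V k : set (lebesgue_space R n)) by exact: lebesgue_measurable_open.
pose VV := \bigcup_k V k.
have oVV : open VV by apply: bigcup_open => k _.
have mVV : measurable (VV : set (lebesgue_space R n)) by exact: lebesgue_measurable_open.
pose W N : set (lebesgue_space R n) := VV `\` \big[setU/set0]_(k < N) F k.
have mW N : measurable (W N).
  by apply: measurableD => //; apply: bigsetU_measurable => k _.
have mWI : measurable (\bigcap_N W N) by apply: bigcap_measurable.
have nuWI : (nu (\bigcap_N W N) <= (e / 2)%:E)%E.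
  apply: (@le_trans _ _ (nu (\bigcup_k (V k `\` F k)))).
    apply: le_measure; rewrite ?inE//.
      by apply: bigcup_measurable => k _; exact: measurableD.
    move=> x hx; have [[k _ Vk] _] := hx 0%N I.
    exists k => //; split => // Fk.
    by have [_] := hx k.+1 I; apply; rewrite -bigcup_mkord; exists k => /=.
  apply: (@le_trans _ _ (\sum_(k <oo) nu (V k `\` F k))%E).
    apply: measure_sigma_subadditive => //.
      by move=> k; exact: measurableD.
    by apply: bigcup_measurable => k _; exact: measurableD.
  apply: (@le_trans _ _ (\sum_(k <oo) (e / 2 / (2 ^ k.+1)%:R)%:E)%E).
    by apply: lee_nneseries => // k _.
  by apply: epsilon_trick0; rewrite divr_ge0// ltW.
have cvgW : nu (W N) @[N --> \oo] --> nu (\bigcap_N W N).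
  apply: nonincreasing_cvg_mu => //; first exact: finite_nu.
  move=> k l kl; apply/subsetPset; apply: setDS.
  rewrite -!bigcup_mkord => x [i /= ik Fi]; exists i => //=.
  exact: leq_trans ik kl.
have [N hN] : exists N, (nu (W N) <= e%:E)%E.
  have lte : (nu (\bigcap_N W N) < e%:E)%E.
    by apply: le_lt_trans nuWI _; rewrite lte_fin; lra.
  exact: cvgn_exists_le cvgW lte.
exists (\big[setU/set0]_(k < N) F k), VV; split => //.
- rewrite -bigcup_mkord; apply: closed_bigcup => //.
- by rewrite -bigcup_mkord => x [k _ Fk]; exists k => //; exact: FA.
- by move=> x [k _ Ak]; exists k => //; exact: AV.
Qed.

(** The closed sets where [cdist U] is at least [1/(k+1)] exhaust [U]. The whole space is treated
    apart because [cdist] needs a nonempty complement. *)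
Lemma regular_set_open (U : set 'rV[R]_n) : open U -> regular_set U.
Proof.
move=> oU.
have [->|U0] := eqVneq U setT.
  move=> e e0; exists setT, setT; split => //; first exact: openT.
  by rewrite setDv measure0 lee_fin ltW.
have {}U0 : ~` U !=set0.
  apply/set0P; apply: contra U0 => /eqP UC0.
  by rewrite -(setCK U) UC0 setC0.
move=> e e0.
pose F k : set 'rV[R]_n := [set x | k.+1%:R^-1 <= cdist U x].
have cd : continuous (cdist U).
  by apply: (@lipschitz_continuous _ _ _ 1) => x y; rewrite mul1r; exact: cdist_lipschitz.
have cF k : closed (F k).
  apply: (@preimage_closed _ _ (cdist U) [set r | k.+1%:R^-1 <= r]).
    by move=> y _; exact: cd.
  exact: closed_ge.
have FU k : F k `<=` U.
  move=> x Fx; apply: contrapT => Ux; move: Fx.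
  by rewrite /F /= cdist_eq0// leNgt invr_gt0 ltr0Sn.
pose W k : set (lebesgue_space R n) := U `\` F k.
have mW k : measurable (W k).
  by apply: measurableD; [exact: lebesgue_measurable_open|exact: lebesgue_measurable_closed].
have WI : \bigcap_k W k = set0.
  apply/seteqP; split => // x hx.
  have [Ux _] := hx 0%N I.
  have [k _ /(_ k (leqnn k)) hk] := near_infty_natSinv_lt (PosNum (cdist_gt0 oU U0 Ux)).
  by have [_] := hx k I; apply; exact: ltW.
have cvgW : nu (W k) @[k --> \oo] --> nu (\bigcap_k W k).
  apply: nonincreasing_cvg_mu => //; first exact: finite_nu.
    by apply: bigcap_measurable.
  move=> k l kl; apply/subsetPset; apply: setDS => x /=; apply: le_trans.
  by rewrite lef_pV2 ?posrE// ler_nat.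
rewrite WI measure0 in cvgW.
have lte : (0 < e%:E)%E by rewrite lte_fin.
have [N hN] := cvgn_exists_le cvgW lte.
by exists (F N), U; split.
Qed.

(** Regular sets form a sigma-algebra, so generators suffice: preimages of open intervals under a
    coordinate, which are open. *)
Lemma regular_set_tuple (B : set (n.-tuple (measurableTypeR R))) :
  measurable B -> regular_set (tuple_of_row @^-1` B).
Proof.
have sa (T : Type) (f : 'rV[R]_n -> T) :
    sigma_algebra setT [set A | regular_set (f @^-1` A)].
  split => /= [|A|A hA].
  - by rewrite preimage_set0; apply: regular_set_open; exact: open0.
  - by rewrite setTD preimage_setC; exact: regular_setC.
  - by rewrite preimage_bigcup; exact: regular_set_bigcup.
move: B; apply: smallest_sub; first exact: sa.
elim/big_ind : _ => [//|A B hA hB|i _ B [A mA <-]] /=.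
  by move=> C [/hA|/hB].
rewrite setTI -comp_preimage.
have -> : (fun t : n.-tuple (measurableTypeR R) => tnth t i) \o tuple_of_row =
    (fun x : 'rV[R]_n => x 0 i).
  by apply/funext => x /=; rewrite tnth_mktuple.
move: mA; rewrite measurable_realfun.RGenOpens.measurableE; move: A.
apply: smallest_sub; first exact: sa.
move=> _ [a [b ->]] /=; apply: regular_set_open; apply: open_comp.
  by move=> x _; exact: coord_continuous.
exact: interval_open.
Qed.

End regular_sets.

(** * Testing with Lipschitz functions determines the sign *)

Section weighted_measure.
Context d (T : measurableType d) (R : realType) (mu : {measure set T -> \bar R}).
Context (g : T -> \bar R) (mg : measurable_fun setT g).
Hypothesis g_ge0 : forall x, (0 <= g x)%E.

(** The two proofs are arguments so that the measure structure attaches to the term itself. *)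
Definition weighted_measure of measurable_fun setT g & (forall x, (0 <= g x)%E) :=
  fun A : set T => (\int[mu]_(x in A) g x)%E.

Local Notation wmu := (weighted_measure mg g_ge0).

Let weighted_measure0 : wmu set0 = 0%E.
Proof. exact: integral_set0. Qed.

Let weighted_measure_ge0 A : (0 <= wmu A)%E.
Proof. exact: integral_ge0. Qed.

Let weighted_measure_sigma_additive : semi_sigma_additive wmu.
Proof. exact: semi_sigma_additive_nng_induced. Qed.

HB.instance Definition _ := isMeasure.Build _ _ _ wmu
  weighted_measure0 weighted_measure_ge0 weighted_measure_sigma_additive.

End weighted_measure.

Section fundamental_lemma.
Context {R : realType} {n : nat} (U : set 'rV[R]_n) (f : lebesgue_space R n -> R).
Notation mu := (lebesgue_Rn R n).
Hypothesis oU : open U.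
Hypothesis intf : mu.-integrable (U : set (lebesgue_space R n)) (EFin \o f).

Let mU : measurable (U : set (lebesgue_space R n)).
Proof. exact: lebesgue_measurable_open. Qed.

Let mf : measurable_fun (U : set (lebesgue_space R n)) f.
Proof. by apply/measurable_EFinP; exact: measurable_int intf. Qed.

Lemma integrable_Mbounded (chi : 'rV[R]_n -> R) (C : R) :
  continuous chi -> (forall x, U x -> `|chi x| <= C) ->
  mu.-integrable (U : set (lebesgue_space R n)) (fun x => (f x * chi x)%:E).
Proof.
move=> cchi hC.
apply: (@le_integrable _ (lebesgue_space R n) R mu U mU
  (fun x => (f x * chi x)%:E) (fun x => (C%:E * (EFin \o f) x)%E)) => //.
- apply/measurable_EFinP; apply: measurable_funM => //.
  exact: continuous_measurable_rV.
- move=> x Ux; rewrite /= lee_fin !normrM mulrC; apply: ler_wpM2r => //.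
  by rewrite (le_trans (hC x Ux))// ler_norm.
- exact: integrableZl.
Qed.

Let clamp (r : R) : R := Num.min 1 (Num.max 0 r).

Let clamp01 r : 0 <= clamp r <= 1.
Proof.
by rewrite /clamp ge_min lexx le_min ler01 le_max lexx.
Qed.

Let clamp_lip r s : `|clamp r - clamp s| <= `|r - s|.
Proof.
rewrite /clamp.
have H (a b : R) : a <= b -> `|Num.min 1 (Num.max 0 b) - Num.min 1 (Num.max 0 a)| <= b - a.
  move=> ab; rewrite ler_norml.
  case: (leP 0 a) => ?; case: (leP 0 b) => ?; try (case: (leP 1 a) => ?);
    try (case: (leP 1 b) => ?); try (case: (leP 1 0) => ?); apply/andP; split; lra.
have [rs|/ltW rs] := leP r s.
  by rewrite distrC [leRHS]distrC [leRHS]ger0_norm ?subr_ge0// H.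
by rewrite [leRHS]ger0_norm ?subr_ge0// H.
Qed.

Hypothesis U0 : ~` U !=set0.
Hypothesis test : forall (chi : 'rV[R]_n -> R) (K a : R),
  (forall x y, `|chi x - chi y| <= K * enorm (x - y)) ->
  (forall x, 0 <= chi x <= 1) -> 0 < a ->
  (forall x, chi x != 0 -> a <= cdist U x) ->
  \int[mu]_(x in U) (f x * chi x) <= 0.

(** The functions [clamp ((k + 1) cdist V - 1)] tend pointwise to the indicator of [V]; subtracting
    [1] keeps their supports at distance at least [1/(k+1)] from the complement. Dominated
    convergence with bound [|f|] concludes. *)
Lemma Rintegral_open_le0 (V : set 'rV[R]_n) : open V -> V `<=` U ->
  \int[mu]_(x in V) f x <= 0.
Proof.
move=> oV VU.
have V0 : ~` V !=set0 by case: U0 => x Ux; exists x => /VU.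
have cdVU x : cdist V x <= cdist U x.
  have [p Up ->] := cdist_attained oU U0 x.
  by apply: cdist_le => //; move/VU.
pose chi (k : nat) (x : 'rV[R]_n) := clamp (k.+1%:R * cdist V x - 1).
have lip k x y : `|chi k x - chi k y| <= k.+1%:R * enorm (x - y).
  apply: (le_trans (clamp_lip _ _)).
  rewrite opprD addrACA opprK addNr addr0 -mulrBr normrM ger0_norm//.
  by apply: ler_wpM2l => //; exact: cdist_lipschitz.
have cchi k : continuous (chi k) by apply: lipschitz_continuous; exact: lip.
have chi1 k x : `|chi k x| <= 1.
  by have /andP[h1 h2] := clamp01 (k.+1%:R * cdist V x - 1); rewrite ger0_norm.
have le0 k : \int[mu]_(x in U) (f x * chi k x) <= 0.
  apply: (test (K := k.+1%:R) (a := k.+1%:R^-1)) => //.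
  move=> x; exact: clamp01.
  move=> x chi0; rewrite leNgt; apply/negP => h; move/eqP: chi0; apply.
  rewrite /chi /clamp max_l ?min_r// subr_le0 -ler_pdivlMl// mulr1.
  exact: le_trans (cdVU x) (ltW h).
have mV : measurable (V : set (lebesgue_space R n)) by exact: lebesgue_measurable_open.
have [] := @dominated_convergence _ (lebesgue_space R n) R mu U mU
  (fun k x => (f x * chi k x)%:E) ((EFin \o f) \_ V) (fun x => `|f x|%:E).
- move=> k; apply/measurable_EFinP; apply: measurable_funM => //.
  exact: continuous_measurable_rV.
- apply/(measurable_restrict _ mV mU); apply: (measurable_funS mU) => //.
  exact/measurable_EFinP.
- apply: aeW => x Ux; apply: cvg_near_cst.
  rewrite patchE; case: ifPn => [|]; rewrite ?inE ?notin_setE => Vx.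
    have [k0 _ hk] := near_infty_natSinv_lt (PosNum (cdist_gt0 oV V0 Vx)).
    have : \forall k \near \oo, 2 <= k.+1%:R * cdist V x.
      have d0 := cdist_gt0 oV V0 Vx.
      near=> k; rewrite -ler_pdivrMr//.
      have : 2 / cdist V x <= k%:R by near: k; exact: nbhs_infty_ger.
      by move=> h; apply: le_trans h _; rewrite ler_nat.
    apply: filterS => k h /=; rewrite /chi /clamp max_r ?min_l ?mulr1//; lra.
  apply: nearW => k; rewrite /chi cdist_eq0// mulr0 sub0r /clamp max_l ?min_r//.
  by rewrite mulr0.
- exact: integrable_norm intf.
- apply: aeW => x k _; rewrite /= lee_fin normrM ler_piMr//.
move=> _ _ cv.
have -> : \int[mu]_(x in V) f x = fine (\int[mu]_(x in U) ((EFin \o f) \_ V) x)%E.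
  by rewrite -integral_mkcondr setIidr.
have : (\int[mu]_(x in U) ((EFin \o f) \_ V) x <= 0)%E.
  apply: (cvge_to_le cv); apply: nearW => k.
  rewrite [leLHS](_ : _ = (\int[mu]_(x in U) (f x * chi k x)%:E)%E)//.
  rewrite -[leLHS]fineK; last first.
    apply: integrable_fin_num => //; exact: integrable_Mbounded (cchi k) (fun x _ => chi1 k x).
  by rewrite lee_fin; exact: le0.
exact: fine_le0.
Unshelve. all: by end_near.
Qed.

Let g : lebesgue_space R n -> \bar R := (fun x => `|f x|%:E) \_ U.

Let mg : measurable_fun setT g.
Proof.
apply/(measurable_restrictT _ mU); apply/measurable_EFinP.
exact: measurableT_comp.
Qed.

Let g_ge0 x : (0 <= g x)%E.
Proof. by rewrite /g patchE; case: ifP => // _; rewrite lee_fin. Qed.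

Let nu := weighted_measure mu mg g_ge0.

Let nuoo : (nu setT < +oo)%E.
Proof.
rewrite /nu /weighted_measure /g -integral_mkcondr setTI.
by have /integrableP[] := intf.
Qed.

(** For [A] of finite measure inside the set where [f > 0], regularity of [|f| dx] yields an open
    [V'] between [A] and [U] whose excess over [A] has [|f|]-mass at most [e]. Then the integral of
    [f] over [A] is at most [e], so [A] is null; sigma-finiteness removes the finiteness of [A]. *)
Lemma ae_le0 : {ae mu, forall x, U x -> f x <= 0}.
Proof.
pose P : set (lebesgue_space R n) := U `&` [set x | 0 < f x].
have mP : measurable P.
  have := mf mU (measurable_itv `]0, +oo[).
  congr measurable; apply/seteqP; split => x /=; rewrite /P /= in_itv /= andbT//.
have PU : P `<=` U by move=> x [].
have intE (A : set (lebesgue_space R n)) : measurable A -> A `<=` U ->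
    mu.-integrable A (EFin \o f).
  by move=> mA AU; exact: integrableS intf.
have nuE (A : set (lebesgue_space R n)) : measurable A -> A `<=` U ->
    nu A = (\int[mu]_(x in A) `|f x|%:E)%E.
  by move=> mA AU; rewrite /nu /weighted_measure /g -integral_mkcondr setIidl.
have key (A : set (lebesgue_space R n)) : measurable A -> A `<=` P ->
    (mu A < +oo)%E -> mu A = 0%E.
  move=> mA AP Aoo; have AU := subset_trans AP PU.
  have [B mB [AB BA0]] := lebesgue_hull_negligible mA Aoo.
  have mB' := lebesgue_measurable_tuple mB.
  have : \int[mu]_(x in A) f x <= 0.
    apply/ler_addgt0Pr => e e0; rewrite add0r.
    have [F [V [cF oV FB BV hVF]]] := regular_set_tuple nuoo mB e0.
    have mF : measurable (F : set (lebesgue_space R n)) by exact: lebesgue_measurable_closed.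
    have mV : measurable (V : set (lebesgue_space R n)) by exact: lebesgue_measurable_open.
    pose V' := V `&` U.
    have oV' : open V' by exact: openI.
    have V'U : V' `<=` U by move=> x [].
    have mV' : measurable (V' : set (lebesgue_space R n)) by exact: lebesgue_measurable_open.
    have AV' : A `<=` V' by move=> x Ax; split; [exact/BV/AB|exact: AU].
    have V'0 := Rintegral_open_le0 oV' V'U.
    have mVA : measurable (V' `\` A : set (lebesgue_space R n)) by exact: measurableD.
    have VAU : V' `\` A `<=` U by move=> x [/V'U].
    have split_int : \int[mu]_(x in V') f x =
       \int[mu]_(x in A) f x + \int[mu]_(x in V' `\` A) f x.
      rewrite -Rintegral_setU//.
      - by rewrite setDUK.
      - by rewrite setDUK//; exact: intE.
      - by apply/disj_setPS => x [? []].
    have small : `|\int[mu]_(x in V' `\` A) f x| <= e.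
      apply: (le_trans (le_normr_Rintegral mVA (intE _ mVA VAU))).
      rewrite -lee_fin -[leLHS]/(_%:E) /Rintegral fineK; last first.
        apply: integrable_fin_num => //.
        exact: integrable_norm (intE _ mVA VAU).
      rewrite -nuE//; apply: le_trans hVF.
      have nuBA : nu (tuple_of_row @^-1` B `\` A) = 0%E.
        by apply: null_set_integral => //; [exact: measurableD|exact: measurable_funS mg].
      apply: (@le_trans _ _ (nu (V `\` F `|` (tuple_of_row @^-1` B `\` A)))%E).
        apply: le_measure; rewrite ?inE//.
          by apply: measurableU; exact: measurableD.
        move=> x [[Vx Ux] Ax]; have [Bx|Bx] := pselect ((tuple_of_row @^-1` B) x).
          by right.
        by left; split => // /FB.
      apply: (le_trans (measureU2 _ _ _)) => //; [exact: measurableD|exact: measurableD|].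
      by rewrite [X in (_ + X)%E]nuBA adde0.
    move: small; rewrite ler_norml => /andP[small _].
    move: V'0 small; rewrite split_int.
    by rewrite -lerBrDr sub0r => h1 h2; apply: (le_trans h1); rewrite lerNl.
  move=> le0.
  have f0 x : A x -> 0 <= f x by move=> /AP[_ /ltW].
  have int0 : (\int[mu]_(x in A) `|(EFin \o f) x| = 0)%E.
    have -> : (\int[mu]_(x in A) `|(EFin \o f) x|)%E = (\int[mu]_(x in A) (f x)%:E)%E.
      by apply: eq_integral => x; rewrite inE => Ax; rewrite /= ger0_norm// f0.
    rewrite -[LHS]fineK; last by apply: integrable_fin_num => //; exact: intE.
    congr EFin; apply/eqP; rewrite eq_le le0/=.
    by apply: Rintegral_ge0.
  have mfA : measurable_fun A (EFin \o f) by exact: measurable_int (intE _ mA AU).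
  have [N [mN N0 hN]] := (ae_eq_integral_abs mu mA mfA).1 int0.
  apply/eqP; rewrite eq_le measure_ge0 andbT -N0; apply: le_measure; rewrite ?inE//.
  move=> x Ax; apply: hN => /= /(_ Ax) [fx0].
  by have [_ /=] := AP _ Ax; rewrite fx0 ltxx.
have [G [mG Goo GT]] := @lebesgue_sigma_finite_cover R n.
exists P; split => //; last first.
  move=> x /= h; apply: contrapT => nPx; apply: h => Ux.
  by rewrite leNgt; apply/negP => fx; apply: nPx.
have PE : P = \bigcup_k (P `&` G k) by rewrite -setI_bigcupr GT setIT.
apply/eqP; rewrite eq_le measure_ge0 andbT.
have mPG k : measurable (P `&` G k) by exact: measurableI.
rewrite {1}PE; apply: (@le_trans _ _ (\sum_(k <oo) mu (P `&` G k))%E).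
  by apply: measure_sigma_subadditive => //; exact: bigcup_measurable.
rewrite eseries0// => k _ _; apply: key => //.
by apply: le_lt_trans (Goo k); apply: le_measure; rewrite ?inE//; exact: subIsetr.
Qed.

End fundamental_lemma.

(** * Discrete Laplacians *)

Section mollifier.
Context {R : realType} {n : nat}.
Implicit Types x y z : 'rV[R]_n.

(** Left unnormalised: lattice sums produce the factor [m^n] of [sum_mollifier], which is divided
    out at the end. The summand [0] matches [times_derivable_affine]. *)
Definition mollifier (eps : R) : 'rV[R]_n -> R :=
  prod_coord (fun _ s => bump (eps^-1 * s + 0)).

Lemma mollifier_ge0 eps z : 0 <= mollifier eps z.
Proof. by apply: prodr_ge0 => j _; exact: bump_ge0. Qed.

Lemma mollifier_neq0 eps z : 0 < eps -> mollifier eps z != 0 -> `|z| <= eps.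
Proof.
move=> e0 kz; apply/rV_norm_leP => [|j]; first exact: ltW.
rewrite leNgt; apply/negP => ez; move/negP: kz; apply; apply/eqP.
rewrite /mollifier /prod_coord (bigD1 j)//= bump_eq0 ?mul0r// addr0.
by rewrite normrM gtr0_norm ?invr_gt0// ler_pdivlMl// mulr1 ltW.
Qed.

Let derivable_bump eps k (y : R) :
  derivable (derive1n k (fun s : R => bump (eps^-1 * s + 0))) y 1.
Proof.
by apply: times_derivable_derive1n => k'; apply: times_derivable_affine;
  exact: times_derivable_bump.
Qed.

Lemma smooth_mollifier eps : smooth (mollifier eps).
Proof. by apply: smooth_prod_coord => j k y; exact: derivable_bump. Qed.

Lemma smooth_is_derive (f : 'rV[R]_n -> R) s i x : smooth f ->
  is_derive x (delta_mx 0 i) (iter_partial s f) (iter_partial (i :: s) f x).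
Proof. by move=> sf; apply/derivableP; exact: (sf s).2. Qed.

Lemma derive_shift_rV (f : 'rV[R]_n -> R) x v y :
  'D_v (fun y => f (y - x)) y = 'D_v f (y - x).
Proof.
rewrite /derive; set F := (X in lim (X @ _) = _); set G := (X in _ = lim (X @ _)).
suff -> : F = G by [].
by apply/funext => h; rewrite /F /G /= addrA.
Qed.

Lemma derivable_shift_rV (f : 'rV[R]_n -> R) x v y :
  derivable f (y - x) v -> derivable (fun y => f (y - x)) y v.
Proof.
rewrite /derivable => H; set F := (F in cvg (F @ _)) in H; set G := (G in cvg (G @ _)).
suff -> : G = F by [].
by apply/funext => h; rewrite /F /G /= addrA.
Qed.

Lemma iter_partial_shift (f : 'rV[R]_n -> R) x s :
  iter_partial s (fun y => f (y - x)) = (fun y => iter_partial s f (y - x)).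
Proof.
elim: s => [//|i s IH] /=; rewrite /partial IH; apply/funext => y.
exact: derive_shift_rV.
Qed.

Lemma continuous_shift_rV (f : 'rV[R]_n -> R) x :
  continuous f -> continuous (fun y => f (y - x)).
Proof.
move=> cf y; apply: (@continuous_comp _ _ _ (fun y => y - x) f); last exact: cf.
by apply: continuousB; [exact: cvg_id|exact: cst_continuous].
Qed.

Lemma smooth_shift (f : 'rV[R]_n -> R) x :
  smooth f -> smooth (fun y => f (y - x)).
Proof.
move=> sf s; rewrite iter_partial_shift; split.
  by apply: continuous_shift_rV; exact: (sf s).1.
by move=> i y; apply: derivable_shift_rV; exact: (sf s).2.
Qed.

Lemma laplacian_shift (f : 'rV[R]_n -> R) x y :
  laplacian (fun y => f (y - x)) y = laplacian f (y - x).
Proof.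
apply: eq_bigr => i _.
by have /(congr1 (@^~ y)) := iter_partial_shift f x [:: i; i].
Qed.

Lemma test_function_mollifier (U : set 'rV[R]_n) eps x : 0 < eps ->
  (forall y, `|y - x| <= eps -> U y) ->
  test_function U (fun y => mollifier eps (y - x)).
Proof.
move=> e0 xU.
have cB : closed [set y | `|y - x| <= eps].
  apply: (@preimage_closed _ _ (fun y : 'rV[R]_n => `|y - x|) [set r | r <= eps]).
    move=> y _; apply: (@continuous_comp _ _ _ (fun y => y - x) (fun y : 'rV[R]_n => `|y|)).
      by apply: continuousB; [exact: cvg_id|exact: cst_continuous].
    exact: norm_continuous.
  exact: closed_le.
have sB : supp (fun y => mollifier eps (y - x)) `<=` [set y | `|y - x| <= eps].
  rewrite [X in _ `<=` X](closure_id _).1//; apply: closureS => y /=.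
  exact: mollifier_neq0.
split; first exact: smooth_shift (smooth_mollifier eps).
- apply: bounded_closed_compact; last exact: closed_closure.
  exists (`|x| + eps); split; first exact: num_real.
  move=> M eM y /sB /= yx; apply: le_trans (ltW eM).
  by rewrite -[y](subrK x) addrC (le_trans (ler_normD _ _))// lerD2l.
- by move=> y /sB; exact: xU.
Qed.

Definition discrete_laplacian (h : R) (f : 'rV[R]_n -> R) x : R :=
  \sum_i (f (x + h *: delta_mx 0 i) + f (x - h *: delta_mx 0 i) - 2 * f x).

Lemma discrete_laplacian_unif (f : 'rV[R]_n -> R)
    (g1 g2 : 'I_n -> 'rV[R]_n -> R) (M e : R) :
  (forall x i, is_derive x (delta_mx 0 i) f (g1 i x)) ->
  (forall x i, is_derive x (delta_mx 0 i) (g1 i) (g2 i x)) ->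
  (forall i, continuous (g2 i)) -> 0 < e ->
  exists2 d : R, 0 < d & forall x h, `|x| <= M -> 0 < h < d ->
    `|discrete_laplacian h f x - h ^+ 2 * \sum_i g2 i x| <= e * h ^+ 2.
Proof.
move=> fg1 g12 cg2 e0.
have e1 : 0 < e / n.+1%:R by rewrite divr_gt0.
have H i : exists d : R, 0 < d /\ forall x h, `|x| <= M -> 0 < h < d ->
    `|f (x + h *: delta_mx 0 i) + f (x - h *: delta_mx 0 i) - 2 * f x
      - h ^+ 2 * g2 i x| <= e / n.+1%:R * h ^+ 2.
  have [d d0 hd] := second_difference_unif M (fg1 ^~ i) (g12 ^~ i) (cg2 i) e1.
  by exists d.
have [d hd] := choice H.
exists (\big[Num.min/1]_i d i).
  by apply: (big_ind (fun r => 0 < r)) => // [r s r0 s0|i _]; [rewrite lt_min r0|have [] := hd i].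
move=> x h xM /andP[h0 hh].
rewrite /discrete_laplacian mulr_sumr -sumrB.
apply: (le_trans (ler_norm_sum _ _ _)).
apply: (@le_trans _ _ (\sum_(i < n) e / n.+1%:R * h ^+ 2)).
  apply: ler_sum => i _; apply: (hd i).2 => //; rewrite h0/=.
  by apply: (lt_le_trans hh); rewrite (bigD1 i)//= ge_min lexx.
rewrite sumr_const card_ord -[leLHS]mulr_natl mulrA.
apply: ler_wpM2r; first exact: sqr_ge0.
rewrite mulrCA ler_piMr ?(ltW e0)// ler_pdivrMr// mul1r ler_nat//.
Qed.

(** A finite cubic lattice with corner at [-L]. Indexing by finite functions lets a sum of products
    become a product of sums. *)
Definition lattice_point (L h : R) (N : nat) (k : {ffun 'I_n -> 'I_N}) : 'rV[R]_n :=
  \row_j (- L + h * (k j)%:R).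

(** Distributivity reduces the claim to [sum_bump] in each coordinate; the hypotheses keep [y] at
    least [eps] away from the faces of the lattice. *)
Lemma sum_mollifier (L eps : R) (m N : nat) y : 0 < eps -> (0 < m)%N ->
  `|y| + eps <= L -> L + `|y| + eps <= eps * (N%:R / m%:R) ->
  \sum_k mollifier eps (y - @lattice_point L (eps / m%:R) N k) = m%:R ^+ n.
Proof.
move=> e0 m0 yL yN.
have en0 : eps != 0 by rewrite gt_eqF.
have mn0 : m%:R != 0 :> R by rewrite pnatr_eq0 -lt0n.
rewrite (eq_bigr (fun k : {ffun 'I_n -> 'I_N} =>
    \prod_j bump (eps^-1 * (y 0 j + L) - (k j)%:R / m%:R))); last first.
  move=> k _; apply: eq_bigr => j _; rewrite !mxE addr0; congr bump.
  by field; rewrite en0 mn0.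
rewrite -(bigA_distr_bigA (fun j (k : 'I_N) =>
  bump (eps^-1 * (y 0 j + L) - k%:R / m%:R))).
rewrite (eq_bigr (fun=> m%:R)) ?prodr_const ?card_ord// => j _.
have := coord_le_norm y j; rewrite ler_norml => /andP[y1 y2].
apply: sum_bump => //.
  by rewrite ler_pdivlMl//; lra.
have -> : eps^-1 * (y 0 j + L) + 1 = eps^-1 * (y 0 j + L + eps).
  by rewrite [RHS]mulrDr mulVf.
by rewrite ler_pdivrMl//; lra.
Qed.

Lemma sum_lattice_shift (L h : R) (N : nat) (i : 'I_n) (G : 'rV[R]_n -> R) :
  (forall x, G x != 0 -> - L < x 0 i < - L + h * N%:R) ->
  \sum_(k : {ffun 'I_n -> 'I_N}) G (lattice_point L h k + h *: delta_mx 0 i) =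
  \sum_(k : {ffun 'I_n -> 'I_N}) G (lattice_point L h k).
Proof.
case: N => [|N] GN.
  have e0 (k : {ffun 'I_n -> 'I_0}) : False by case: (k i).
  by rewrite !big1// => k; case: (e0 k).
(* Cyclic shift of the index: the terms that wrap around vanish. *)
pose T (k : {ffun 'I_n -> 'I_N.+1}) : {ffun 'I_n -> 'I_N.+1} :=
  [ffun j => if j == i then ordS (k j) else k j].
have Tinj : injective T.
  move=> k k' /ffunP kk'; apply/ffunP => j; have := kk' j; rewrite !ffunE.
  by case: ifP => // _ /(can_inj (@ordSK N.+1)).
rewrite [RHS](reindex_inj Tinj); apply: eq_bigr => k _.
have [kN|kN] := ltnP (k i).+1 N.+1.
  congr G; apply/rowP => j; rewrite !mxE eqxx /= ffunE.
  case: eqP => [->|_]; last by rewrite mulr0 addr0.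
  by rewrite /ordS /= modn_small// mulr1 -natr1 mulrDr mulr1 addrA.
have kE : (k i : nat) = N by apply/eqP; rewrite eqn_leq -ltnS ltn_ord.
rewrite [LHS](_ : _ = 0) ?[RHS](_ : _ = 0)//.
  apply/eqP; apply: contraT => /GN; rewrite !mxE ffunE eqxx /= kE modnn mulr0 addr0.
  by rewrite ltxx.
apply/eqP; apply: contraT => /GN; rewrite !mxE !eqxx kE /= mulr1.
by rewrite -[N.+1%:R]natr1 mulrDr mulr1 addrA ltxx andbF.
Qed.

(** Translation of the lattice moves each shift from [psi] to [f]. The support of [psi] stays more
    than [h] inside the lattice, so there are no boundary terms. *)
Lemma discrete_summation_by_parts (L h L0 : R) (N : nat) (f psi : 'rV[R]_n -> R) :
  0 < h -> L0 + h < L -> L + L0 + h < h * N%:R ->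
  (forall x, psi x != 0 -> `|x| <= L0) ->
  \sum_(k : {ffun 'I_n -> 'I_N}) f (lattice_point L h k) *
     discrete_laplacian h psi (lattice_point L h k) =
  \sum_(k : {ffun 'I_n -> 'I_N}) discrete_laplacian h f (lattice_point L h k) *
     psi (lattice_point L h k).
Proof.
move=> h0 hL hN psiL.
under eq_bigr do rewrite mulr_sumr.
under [RHS]eq_bigr do rewrite mulr_suml.
rewrite exchange_big [RHS]exchange_big /=; apply: eq_bigr => i _.
set e := delta_mx 0 i.
have psi_i (x : 'rV[R]_n) : psi x != 0 -> - L0 <= x 0 i <= L0.
  by move=> /psiL xL; rewrite -ler_norml (le_trans (coord_le_norm x i)).
have S1 := @sum_lattice_shift L h N i (fun x => f (x - h *: e) * psi x).
have S2 := @sum_lattice_shift L h N i (fun x => f x * psi (x - h *: e)).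
have {}S1 : \sum_(k : {ffun 'I_n -> 'I_N})
      f (lattice_point L h k + h *: e - h *: e) * psi (lattice_point L h k + h *: e) =
    \sum_(k : {ffun 'I_n -> 'I_N}) f (lattice_point L h k - h *: e) * psi (lattice_point L h k).
  apply: S1 => x; rewrite mulf_eq0 negb_or => /andP[_ /psi_i/andP[? ?]].
  by apply/andP; split; lra.
have {}S2 : \sum_(k : {ffun 'I_n -> 'I_N})
      f (lattice_point L h k + h *: e) * psi (lattice_point L h k + h *: e - h *: e) =
    \sum_(k : {ffun 'I_n -> 'I_N}) f (lattice_point L h k) * psi (lattice_point L h k - h *: e).
  apply: S2 => x; rewrite mulf_eq0 negb_or => /andP[_ /psi_i].
  by rewrite !mxE !eqxx mulr1 => /andP[? ?]; apply/andP; split; lra.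
under eq_bigr do rewrite !mulrDr.
under [RHS]eq_bigr do rewrite !mulrDl.
rewrite !big_split /= -S2.
under [in LHS]eq_bigr do rewrite -[X in f X](addrK (h *: e)).
rewrite S1.
under [X in _ + X + _ = _]eq_bigr do rewrite addrK.
rewrite [in LHS]addrC [in RHS]addrC; congr (_ + _).
  by apply: eq_bigr => k _; ring.
by rewrite addrC.
Qed.

End mollifier.

Lemma le_add_small (R : realType) (X Y Z t0 : R) : 0 < t0 ->
  (forall t, 0 < t < t0 -> X <= Y + t * Z) -> X <= Y.
Proof.
move=> t00 h; apply/ler_addgt0Pr => e e0.
pose t := Num.min (t0 / 2) (e / (`|Z| + 1)).
have t_gt0 : 0 < t by rewrite lt_min !divr_gt0.
have tt0 : t < t0.
  by have : t <= t0 / 2 by [rewrite ge_min lexx]; lra.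
have : t <= e / (`|Z| + 1) by rewrite ge_min lexx orbT.
rewrite ler_pdivlMr// => te.
apply: (le_trans (h t _)); first by rewrite t_gt0.
rewrite lerD2l; apply: le_trans te; rewrite ler_wpM2l ?(ltW t_gt0)//.
by apply: (le_trans (ler_norm _)); rewrite lerDl.
Qed.

(** * The integral inequality for subharmonic functions *)

Lemma continuous_bounded_on (R : realType) n (f : 'rV[R]_n -> R) (M : R) :
  continuous f -> exists C : R, forall x, `|x| <= M -> `|f x| <= C.
Proof.
move=> cf.
have cK := @compact_norm_le R n M.
have [C [_ hC]] := compact_bounded (continuous_compact (continuous_subspaceT cf) cK).
exists (C + 1) => x xM; apply: (hC (C + 1)); first by rewrite ltrDl.
by exists x.
Qed.

Section weighted_integral.
Context {R : realType} {n : nat} (U : set 'rV[R]_n).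
Notation mu := (lebesgue_Rn R n).
Hypothesis oU : open U.
Implicit Types (w : lebesgue_space R n -> R) (phi : 'rV[R]_n -> R).

Definition wint w phi := \int[mu]_(y in U) (w y * phi y).
Definition wintegrable w phi :=
  mu.-integrable (U : set (lebesgue_space R n)) (fun y => (w y * phi y)%:E).

Let mU : measurable (U : set (lebesgue_space R n)).
Proof. exact: lebesgue_measurable_open. Qed.

Lemma wintegrableD w phi psi : wintegrable w phi -> wintegrable w psi ->
  wintegrable w (fun y => phi y + psi y).
Proof.
move=> h1 h2; have := integrableD mU h1 h2; apply: eq_integrable => // y _.
by rewrite /= mulrDr.
Qed.

Lemma wintegrableZ w phi (c : R) : wintegrable w phi ->
  wintegrable w (fun y => c * phi y).
Proof.
move=> h; have := integrableZl mU c h; apply: eq_integrable => // y _.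
by rewrite /= mulrCA.
Qed.

Lemma wintD w phi psi : wintegrable w phi -> wintegrable w psi ->
  wint w (fun y => phi y + psi y) = wint w phi + wint w psi.
Proof.
by move=> h1 h2; rewrite /wint -RintegralD//; apply: eq_Rintegral => y _; rewrite mulrDr.
Qed.

Lemma wintZ w phi (c : R) : wintegrable w phi ->
  wint w (fun y => c * phi y) = c * wint w phi.
Proof.
by move=> h; rewrite /wint -RintegralZl//; apply: eq_Rintegral => y _; rewrite mulrCA.
Qed.

Lemma wintegrable_sum w (I : Type) (s : seq I) (phi : I -> 'rV[R]_n -> R) :
  (forall i, wintegrable w (phi i)) ->
  wintegrable w (fun y => \sum_(i <- s) phi i y) /\
  wint w (fun y => \sum_(i <- s) phi i y) = \sum_(i <- s) wint w (phi i).
Proof.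
move=> h; elim: s => [|i s [IH1 IH2]].
  have E : (fun y => \sum_(i <- [::]) phi i y) = cst 0.
    by apply/funext => y; rewrite big_nil.
  rewrite E big_nil; split.
    have := @integrable0 _ _ _ mu (U : set (lebesgue_space R n)).
    by apply: eq_integrable => // y _; rewrite /= mulr0.
  by rewrite /wint /Rintegral integral0_eq// => y _; rewrite mulr0.
have E : (fun y => \sum_(j <- i :: s) phi j y) =
    (fun y => phi i y + \sum_(j <- s) phi j y).
  by apply/funext => y; rewrite big_cons.
rewrite E big_cons -IH2; split; first exact: wintegrableD.
exact: wintD.
Qed.

Lemma le_wint w w' phi phi' : wintegrable w phi -> wintegrable w' phi' ->
  (forall y, U y -> w y * phi y <= w' y * phi' y) -> wint w phi <= wint w' phi'.
Proof. by move=> h1 h2 h; apply: le_Rintegral. Qed.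

Lemma eq_wint w phi phi' : (forall y, U y -> phi y = phi' y) ->
  wint w phi = wint w phi'.
Proof. by move=> h; apply: eq_Rintegral => y; rewrite inE => /h ->. Qed.

Lemma continuous_wintegrable w phi (L0 : R) : (forall x, U x -> `|x| <= L0) ->
  mu.-integrable (U : set (lebesgue_space R n)) (EFin \o w) ->
  continuous phi -> wintegrable w phi.
Proof.
move=> UL iw cphi; have [C hC] := continuous_bounded_on L0 cphi.
exact: (integrable_Mbounded oU iw cphi (fun x Ux => hC x (UL x Ux))).
Qed.

End weighted_integral.

(** Read with [F = h^2] and [A], [B], [D] the lattice sums of [W G1], [W G2] and [W]; [E] is the
    number of lattice points. *)
Lemma lattice_arith1 (R : realType) (t F I C E A B D : R) :
  - (t * F * I * C * E) <= F * (B - A + t * D) ->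
  F * A <= F * (B + t * D + t * I * C * E).
Proof. by rewrite !mulrDr mulrN; lra. Qed.

Lemma lattice_arith2 (R : realType) (X Y A C0 t I C B : R) :
  X <= A * C0 -> Y <= t * (A * I) ->
  X + Y + t * I * C * (A * B) <= A * (C0 + t * (I + I * C * B)).
Proof. by lra. Qed.

Section lattice_inequality.
Context {R : realType} {n : nat} (U : set 'rV[R]_n) (u : lebesgue_space R n -> R).
Context (L0 : R).
Notation mu := (lebesgue_Rn R n).
Hypothesis oU : open U.
Hypothesis U0 : ~` U !=set0.
Hypothesis L0_ge0 : 0 <= L0.
Hypothesis UL0 : forall x, U x -> `|x| <= L0.
Hypothesis intu : mu.-integrable (U : set (lebesgue_space R n)) (EFin \o u).
Hypothesis subharm : forall phi : 'rV[R]_n -> R,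
  test_function U phi -> (forall x, 0 <= phi x) ->
  (- (\int[mu]_(x in U) (u x * laplacian phi x)%:E) <= 0)%E.

Let absu : lebesgue_space R n -> R := fun y => `|u y|.
Let intabs : mu.-integrable (U : set (lebesgue_space R n)) (EFin \o absu).
Proof. exact: integrable_norm intu. Qed.

Let J := wint U u.
Let J' := wint U absu.
Let I1 := J' (cst 1).

Let adm w phi : mu.-integrable (U : set (lebesgue_space R n)) (EFin \o w) ->
  continuous phi -> wintegrable U w phi.
Proof. exact: continuous_wintegrable UL0. Qed.

Let I1_ge0 : 0 <= I1.
Proof. by apply: Rintegral_ge0 => x _; rewrite mulr1 /absu. Qed.

Let absu_le x : u x <= absu x. Proof. exact: ler_norm. Qed.

Let abs_le (x : 'rV[R]_n) (a b : R) : `|a| <= b -> u x * a <= absu x * b.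
Proof.
move=> ab; apply: (le_trans (ler_norm _)); rewrite normrM /absu.
by apply: ler_wpM2l.
Qed.

Let continuous_moll (eps : R) x : continuous (fun y : 'rV[R]_n => mollifier eps (y - x)).
Proof.
apply: continuous_shift_rV; exact: (smooth_mollifier eps [::]).1.
Qed.

Let continuous_laplacian_moll (eps : R) : continuous (laplacian (@mollifier R n eps)).
Proof.
rewrite /laplacian => x.
have H (s : seq 'I_n) : {for x, continuous (fun x : 'rV[R]_n =>
    \sum_(i <- s) partial i (partial i (mollifier eps)) x)}.
  elim: s => [|i s IH].
    have -> : (fun x : 'rV[R]_n => \sum_(i <- [::]) partial i (partial i (mollifier eps)) x) = cst 0.
      by apply/funext => y; rewrite big_nil.
    exact: cst_continuous.
  have -> : (fun x : 'rV[R]_n => \sum_(j <- i :: s) partial j (partial j (mollifier eps)) x) =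
      (fun x => partial i (partial i (mollifier eps)) x +
        \sum_(j <- s) partial j (partial j (mollifier eps)) x).
    by apply/funext => y; rewrite big_cons.
  apply: continuousD; last exact: IH.
  exact: (smooth_mollifier eps [:: i; i]).1.
exact: H.
Qed.

(** By linearity the difference operator in [x] passes to [rho (y - x)] under the integral; its
    symmetry makes the sign of [x] harmless. Replacing it by [h^2 g] costs at most [c] times the
    integral of [|u|]. *)
Let discrete_laplacian_wint_ge (rho g : 'rV[R]_n -> R) (h c : R) x :
  continuous rho -> continuous g ->
  (forall y, U y -> `|discrete_laplacian h rho (y - x) - h ^+ 2 * g (y - x)| <= c) ->
  0 <= J (fun y => g (y - x)) ->
  - (c * I1) <= discrete_laplacian h (fun x => J (fun y => rho (y - x))) x.
Proof.
move=> crho cg hc Jg.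
have mU : measurable (U : set (lebesgue_space R n)) by exact: lebesgue_measurable_open.
have Ai z : wintegrable U u (fun y => rho (y - z)).
  by apply: adm => //; exact: continuous_shift_rV.
pose phi (i : 'I_n) y := (rho (y - (x + h *: delta_mx 0 i)) +
    rho (y - (x - h *: delta_mx 0 i))) + (- 2) * rho (y - x).
have Az : wintegrable U u (fun y => - 2 * rho (y - x)) by apply: wintegrableZ.
have Axx (i : 'I_n) : wintegrable U u (fun y => rho (y - (x + h *: delta_mx 0 i)) +
    rho (y - (x - h *: delta_mx 0 i))) by apply: wintegrableD.
have Aphi i : wintegrable U u (phi i) by apply: wintegrableD.
have [Aphis E] := wintegrable_sum oU (index_enum 'I_n) Aphi.
have -> : discrete_laplacian h (fun x => J (fun y => rho (y - x))) x =
    J (fun y => \sum_i phi i y).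
  rewrite [RHS]E; apply: eq_bigr => i _.
  rewrite [RHS](wintD oU (Axx i) Az) (wintD oU (Ai _) (Ai _)) (wintZ oU _ (Ai x)).
  by rewrite mulNr.
have phiE y : \sum_i phi i y = discrete_laplacian h rho (y - x).
  apply: eq_bigr => i _; rewrite /phi mulNr; congr (_ - _).
  by rewrite addrC; congr (rho _ + rho _); rewrite opprD ?opprK addrA.
have Ag : wintegrable U u (fun y => g (y - x)).
  by apply: adm => //; exact: continuous_shift_rV.
have A1 : wintegrable U absu (cst 1) by apply: adm => //; exact: cst_continuous.
have Ac := wintegrableZ oU c A1.
have A2 := wintegrableZ oU (h ^+ 2) Ag.
have : h ^+ 2 * J (fun y => g (y - x)) <= J (fun y => \sum_i phi i y) + c * I1.
  rewrite -(wintZ oU _ Ag) -(wintZ oU _ A1) -RintegralD//.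
  apply: le_Rintegral => //; first by have := integrableD mU Aphis Ac; exact: eq_integrable.
  move=> y Uy; rewrite phiE mulr1.
  rewrite -lerBlDl.
  have : `|h ^+ 2 * g (y - x) - discrete_laplacian h rho (y - x)| <= c.
    by rewrite distrC; exact: hc.
  by move=> /(abs_le y); rewrite mulrBr.
have hJ : 0 <= h ^+ 2 * J (fun y => g (y - x)) by rewrite mulr_ge0// sqr_ge0.
by move=> /(le_trans hJ); rewrite -lerBlDr sub0r.
Qed.

(* The mollification of [u], which is discretely almost subharmonic; no
   differentiability of [v] is used. *)
Let v (eps : R) (x : 'rV[R]_n) := J (fun y => mollifier eps (y - x)).

(** The translated mollifier is an admissible test function at [x]. The threshold [d] does not
    depend on [x], because [|y - x| <= 2 L0] for all [x] and [y] in [U]. *)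
Let discrete_subharmonic (eps tau : R) : 0 < eps -> 0 < tau ->
  exists2 d : R, 0 < d & forall h x, 0 < h < d ->
    (forall y, `|y - x| <= eps -> U y) ->
    - (tau * h ^+ 2 * I1) <= discrete_laplacian h (v eps) x.
Proof.
move=> e0 tau0.
have srho := @smooth_mollifier R n eps.
have [d d0 hd] := discrete_laplacian_unif (2 * L0)
  (fun x i => smooth_is_derive [::] i x srho)
  (fun x i => smooth_is_derive [:: i] i x srho)
  (fun i => (srho [:: i; i]).1) tau0.
exists d => // h x hh xU.
have Ux : U x by apply: xU; rewrite subrr normr0 ltW.
apply: (discrete_laplacian_wint_ge (g := laplacian (mollifier eps))).
- exact: (srho [::]).1.
- exact: continuous_laplacian_moll.
- move=> y Uy; apply: hd => //.
  apply: (le_trans (ler_normB _ _)).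
  by rewrite mulr2n mulrDl !mul1r lerD// UL0.
- have := subharm (test_function_mollifier e0 xU) (fun y => mollifier_ge0 eps (y - x)).
  rewrite oppe_le0.
  rewrite (_ : (\int[mu]_(y in U) _)%E =
    (\int[mu]_(y in U) (u y * laplacian (mollifier eps) (y - x))%:E)%E).
    exact: (@fine_ge0 _ (\int[mu]_(y in U) (u y * laplacian (mollifier eps) (y - x))%:E)%E).
  by apply: eq_integral => y _; rewrite laplacian_shift.
Qed.

(** A discrete Kato inequality. Where [f x <= 0] the positive part has a minimum; where [f x > 0]
    truncation can only raise the neighbouring values. *)
Let discrete_kato (h c : R) (f : 'rV[R]_n -> R) x : 0 <= c ->
  - c <= discrete_laplacian h f x ->
  - c <= discrete_laplacian h (fun x => Num.max (f x) 0) x.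
Proof.
move=> c0 hc; have [fx0|fx0] := leP (f x) 0.
  apply: (@le_trans _ _ 0); first by rewrite oppr_le0.
  apply: sumr_ge0 => i _; rewrite (max_r fx0) mulr0 subr0 addr_ge0// le_max lexx orbT//.
apply: (le_trans hc); apply: ler_sum => i _; rewrite (max_l (ltW fx0)).
by rewrite lerD2r lerD// le_max lexx.
Qed.

(** The weights sum to [m^n] and are supported within sup-distance [eps] of [y], where [G] varies by
    at most [K n eps]. *)
Let average_mollifier (G : 'rV[R]_n -> R) (K L eps : R) (m N : nat) y :
  0 <= K -> (forall x z, `|G x - G z| <= K * enorm (x - z)) ->
  0 < eps -> (0 < m)%N -> `|y| + eps <= L ->
  L + `|y| + eps <= eps * (N%:R / m%:R) ->
  `|\sum_k (G (@lattice_point R n L (eps / m%:R) N k) *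
       mollifier eps (y - @lattice_point R n L (eps / m%:R) N k))
     - m%:R ^+ n * G y| <= m%:R ^+ n * (K * (n%:R * eps)).
Proof.
move=> K0 GK e0 m0 yL yN.
have S := sum_mollifier e0 m0 yL yN.
rewrite -S !mulr_suml -sumrB; apply: (le_trans (ler_norm_sum _ _ _)).
apply: ler_sum => k _; set p := lattice_point _ _ _.
rewrite [G p * _]mulrC -mulrBr normrM ger0_norm ?mollifier_ge0//.
have [->|kz] := eqVneq (mollifier eps (y - p)) 0; first by rewrite !mul0r.
apply: ler_wpM2l; first exact: mollifier_ge0.
apply: (le_trans (GK _ _)); apply: ler_wpM2l => //.
rewrite enormC; apply: (le_trans (enorm_le_norm _)); apply: ler_wpM2l => //.
exact: mollifier_neq0 kz.
Qed.

(** To be used with [psi] the cutoff of [zeta], [G1 = m0 * cutoff1] and [G2 = C * cutoff2]. The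
    bound on the Laplacian of [psi] is asked for in discrete form, as [psi] need not be of class
    C^2. *)
Context (psi G1 G2 chi : 'rV[R]_n -> R) (a Cpsi K1 K2 : R).
Hypothesis a0 : 0 < a.
Hypothesis psi_ge0 : forall x, 0 <= psi x.
Hypothesis psi_le : forall x, psi x <= Cpsi.
Hypothesis psi_supp : forall x, psi x != 0 -> a < cdist U x.
Hypothesis psi_lap : forall tau, 0 < tau -> exists2 h0 : R, 0 < h0 &
  forall h x, 0 < h < h0 ->
    discrete_laplacian h psi x <= h ^+ 2 * (G2 x - G1 x + tau).
Hypothesis G2_ge0 : forall x, 0 <= G2 x.
Hypothesis K1_ge0 : 0 <= K1.
Hypothesis K2_ge0 : 0 <= K2.
Hypothesis G2_lip : forall x y, `|G2 x - G2 y| <= K2 * enorm (x - y).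
Hypothesis chi_lip : forall x y, `|chi x - chi y| <= K1 * enorm (x - y).
Hypothesis chi_ge0 : forall x, 0 <= chi x.
Hypothesis chi_le : forall x, chi x <= G1 x.

Let Cpsi_ge0 : 0 <= Cpsi. Proof. exact: le_trans (psi_ge0 0) (psi_le 0). Qed.

Let psi_norm x : psi x != 0 -> `|x| <= L0.
Proof.
by move=> /psi_supp ax; apply: UL0; apply: contrapT => Ux;
  move: ax; rewrite cdist_eq0// ltNge (ltW a0).
Qed.

(* The error [tau * P ^ n] is uniform in the mesh because the lattice has
   [(m * P) ^ n] points and everything is divided by [m ^ n]. Only then does
   [tau] tend to [0], for fixed [eps] and [P]. *)
Let lattice_estimate (eps tau : R) : 0 < eps -> eps <= 1 -> n%:R * eps <= a ->
  0 < tau ->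
  forall P : nat, 2 * L0 + 5 < eps * P%:R ->
  J chi - K1 * (n%:R * eps) * I1 <= J' G2 + K2 * (n%:R * eps) * I1
    + tau * (I1 + I1 * Cpsi * P%:R ^+ n).
Proof.
move=> e0 e1 ea tau0 P PL.
have [d d0 hd] := discrete_subharmonic e0 tau0.
have [h0 h00 hpsi] := psi_lap tau0.
(* Refine the mesh [eps / m] below both thresholds while [eps] stays fixed. *)
have [m m0 [md mh]] : exists2 m : nat, (0 < m)%N & eps / m%:R < d /\ eps / m%:R < h0.
  have dh0 : 0 < Num.min d h0 by rewrite lt_min d0.
  have [m [m0 hm]] : exists m : nat, (0 < m)%N /\ eps / Num.min d h0 < m%:R.
    exists (Num.bound (eps / Num.min d h0)).+1; split => //.
    have := @archi_boundP R (eps / Num.min d h0) (divr_ge0 (ltW e0) (ltW dh0)).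
    by move=> /lt_trans; apply; rewrite ltr_nat.
  exists m => //; rewrite ltr_pdivrMr// in hm.
  have mR : 0 < m%:R :> R by rewrite ltr0n.
  by apply/andP; rewrite -lt_min ltr_pdivrMr// mulrC.
have mR : 0 < m%:R :> R by rewrite ltr0n.
have mn0 : m%:R != 0 :> R by rewrite gt_eqF.
set h := eps / m%:R in md mh *.
have h_gt0 : 0 < h by rewrite divr_gt0.
have h1 : h <= 1.
  by apply: le_trans e1; rewrite ler_pdivrMr// ler_peMr ?(ltW e0)// ler1n.
have h2 : 0 < h ^+ 2 by rewrite exprn_gt0.
pose N := (m * P)%N.
have NP : N%:R / m%:R = P%:R :> R by rewrite /N natrM mulrC mulKf.
have hN : h * N%:R = eps * P%:R by rewrite /h -mulrA [m%:R^-1 * _]mulrC NP.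
(* The lattice then spans at least from [-L0 - 3] to [L0 + 2], a margin larger than [eps] and [h],
   both at most [1]. *)
pose L := L0 + 3.
pose p (k : {ffun 'I_n -> 'I_N}) : 'rV[R]_n := lattice_point L h k.
pose W x := Num.max (v eps x) 0.
have W0 x : 0 <= W x by rewrite le_max lexx orbT.
have parts := @discrete_summation_by_parts R n L h L0 N W psi h_gt0.
have {}parts : \sum_k W (p k) * discrete_laplacian h psi (p k) =
    \sum_k discrete_laplacian h W (p k) * psi (p k).
  apply: parts => //; rewrite /L; first by move: h1; lra.
  by rewrite hN; move: h1 PL; lra.
(* Where [psi] is nonzero, [n eps <= a < cdist] puts the whole [eps]-ball in [U], so [discrete_kato]
   applies; elsewhere the term is zero. *)
have lower : - (tau * h ^+ 2 * I1 * Cpsi * N%:R ^+ n) <=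
    \sum_k discrete_laplacian h W (p k) * psi (p k).
  have -> : - (tau * h ^+ 2 * I1 * Cpsi * N%:R ^+ n) =
     \sum_(k : {ffun 'I_n -> 'I_N}) - (tau * h ^+ 2 * I1 * Cpsi).
    by rewrite sumr_const card_ffun !card_ord -[RHS]mulr_natr natrX mulNr.
  apply: ler_sum => k _.
  have c0 : 0 <= tau * h ^+ 2 * I1 by rewrite !mulr_ge0// ltW.
  have [->|pk] := eqVneq (psi (p k)) 0.
    by rewrite mulr0 oppr_le0 mulr_ge0.
  have H : - (tau * h ^+ 2 * I1) <= discrete_laplacian h W (p k).
    apply: discrete_kato => //; apply: hd; first by rewrite h_gt0.
    move=> y yp; apply: (@lt_cdist _ _ _ U0 (p k)).
    apply: le_lt_trans (psi_supp pk); rewrite enormC.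
    apply: (le_trans (enorm_le_norm _)); apply: le_trans ea.
    exact: ler_wpM2l.
  apply: (@le_trans _ _ (- (tau * h ^+ 2 * I1) * psi (p k))).
    by rewrite mulNr lerN2; apply: ler_wpM2l.
  by apply: ler_wpM2r.
have upper : \sum_k W (p k) * discrete_laplacian h psi (p k) <=
    h ^+ 2 * (\sum_k W (p k) * G2 (p k) - \sum_k W (p k) * G1 (p k)
              + tau * \sum_k W (p k)).
  rewrite mulr_sumr -sumrB -big_split /= mulr_sumr; apply: ler_sum => k _.
  have -> : h ^+ 2 * (W (p k) * G2 (p k) - W (p k) * G1 (p k) + tau * W (p k)) =
     W (p k) * (h ^+ 2 * (G2 (p k) - G1 (p k) + tau)) by ring.
  by apply: ler_wpM2l => //; apply: hpsi; rewrite h_gt0.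
have key : \sum_k W (p k) * G1 (p k) <= \sum_k W (p k) * G2 (p k)
    + tau * \sum_k W (p k) + tau * I1 * Cpsi * N%:R ^+ n.
  rewrite -(ler_pM2l h2); apply: lattice_arith1.
  by apply: (le_trans lower); rewrite -parts.
have mn : 0 < m%:R ^+ n :> R by rewrite exprn_gt0.
have yU y : U y -> `|y| + eps <= L /\ L + `|y| + eps <= eps * (N%:R / m%:R).
  move=> /UL0 yL; rewrite NP /L; split; first by move: e1 yL; lra.
  by move: e1 yL PL; lra.
have adm_sum w (c : 'rV[R]_n -> R) : mu.-integrable (U : set (lebesgue_space R n)) (EFin \o w) ->
   wintegrable U w (fun y => \sum_k c (p k) * mollifier eps (y - p k)) /\
   wint U w (fun y => \sum_k c (p k) * mollifier eps (y - p k)) =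
   \sum_k c (p k) * wint U w (fun y => mollifier eps (y - p k)).
  move=> iw.
  have A k : wintegrable U w (fun y => c (p k) * mollifier eps (y - p k)).
    by apply: wintegrableZ => //; exact: adm.
  have [B1 B2] := wintegrable_sum oU (index_enum _) A; split => //.
  by rewrite B2; apply: eq_bigr => k _; rewrite wintZ//; exact: adm.
have WJ k : W (p k) <= J' (fun y => mollifier eps (y - p k)).
  rewrite ge_max; apply/andP; split.
    apply: le_wint => //; [exact: adm|exact: adm|].
    by move=> y _; apply: ler_wpM2r; [exact: mollifier_ge0|exact: absu_le].
  by apply: Rintegral_ge0 => y _; rewrite mulr_ge0 ?mollifier_ge0// /absu.
have A1 : wintegrable U absu (cst 1) by apply: adm => //; exact: cst_continuous.
have sumW : \sum_k W (p k) <= m%:R ^+ n * I1.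
  apply: (@le_trans _ _ (\sum_k 1 * J' (fun y => mollifier eps (y - p k)))).
    by apply: ler_sum => k _; rewrite mul1r.
  have [_ <-] := adm_sum absu (cst 1) intabs.
  rewrite -(wintZ oU _ A1) le_eqVlt; apply/orP; left; apply/eqP.
  apply: eq_wint => y Uy; have [y1 y2] := yU y Uy.
  rewrite mulr1 -(sum_mollifier e0 m0 y1 y2); apply: eq_bigr => k _.
  by rewrite /= mul1r.
have cG2 : continuous G2 by exact: lipschitz_continuous G2_lip.
have cchi : continuous chi by exact: lipschitz_continuous chi_lip.
have AG2 : wintegrable U absu G2 by apply: adm.
have Achi : wintegrable U u chi by apply: adm.
have sumG2 : \sum_k W (p k) * G2 (p k) <=
    m%:R ^+ n * (J' G2 + K2 * (n%:R * eps) * I1).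
  apply: (@le_trans _ _ (\sum_k G2 (p k) * J' (fun y => mollifier eps (y - p k)))).
    by apply: ler_sum => k _; rewrite mulrC; apply: ler_wpM2l.
  have [B1 <-] := adm_sum absu G2 intabs.
  rewrite -(wintZ oU _ A1) -(wintD oU AG2 (wintegrableZ oU _ A1)).
  have B2 := wintegrableD oU AG2 (wintegrableZ oU (K2 * (n%:R * eps)) A1).
  rewrite -(wintZ oU _ B2); apply: (le_wint oU B1 (wintegrableZ oU _ B2)) => y Uy.
  apply: ler_wpM2l; first exact: normr_ge0.
  have [y1 y2] := yU y Uy.
  have := average_mollifier K2_ge0 G2_lip e0 m0 y1 y2.
  rewrite ler_distl => /andP[_]; rewrite mulr1 mulrDr; exact.
(* Termwise [chi v <= chi W <= G1 W], by [chi >= 0] and [W >= 0]: here the positive part takes over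
   from [u]. *)
have sumchi : m%:R ^+ n * (J chi - K1 * (n%:R * eps) * I1) <=
    \sum_k W (p k) * G1 (p k).
  apply: (@le_trans _ _ (\sum_k chi (p k) * v eps (p k))); last first.
    apply: ler_sum => k _; rewrite mulrC.
    apply: (@le_trans _ _ (W (p k) * chi (p k))).
      by apply: ler_wpM2r => //; rewrite le_max lexx.
    by apply: ler_wpM2l.
  have [B1 <-] := adm_sum u chi intu.
  rewrite mulrBr lerBlDr.
  have C1 := wintegrableZ oU (m%:R ^+ n) Achi.
  have C2 := wintegrableZ oU (m%:R ^+ n * (K1 * (n%:R * eps))) A1.
  have -> : m%:R ^+ n * (K1 * (n%:R * eps) * I1) =
      wint U absu (fun y => m%:R ^+ n * (K1 * (n%:R * eps)) * cst 1 y).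
    by rewrite (wintZ oU _ A1) mulrA.
  have mU : measurable (U : set (lebesgue_space R n)) by exact: lebesgue_measurable_open.
  rewrite -(wintZ oU _ Achi) -RintegralD//.
  apply: le_Rintegral => //; first by have := integrableD mU B1 C2; exact: eq_integrable.
  move=> y Uy; rewrite -lerBlDl -mulrBr; apply: abs_le; rewrite mulr1 distrC.
  have [y1 y2] := yU y Uy.
  exact: average_mollifier.
have final : m%:R ^+ n * (J chi - K1 * (n%:R * eps) * I1) <=
   m%:R ^+ n * (J' G2 + K2 * (n%:R * eps) * I1 + tau * (I1 + I1 * Cpsi * P%:R ^+ n)).
  apply: (le_trans sumchi); apply: (le_trans key).
  have -> : N%:R ^+ n = m%:R ^+ n * P%:R ^+ n :> R by rewrite /N natrM exprMn.
  have : tau * \sum_k W (p k) <= tau * (m%:R ^+ n * I1) by rewrite ler_pM2l.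
  exact: lattice_arith2 sumG2.
by rewrite ler_pM2l in final.
Qed.

Lemma lattice_inequality : J chi <= J' G2.
Proof.
pose t0 := Num.min 1 (a / (n%:R + 1)).
have t00 : 0 < t0 by rewrite lt_min ltr01 divr_gt0.
apply: (@le_add_small _ _ _ ((K1 + K2) * n%:R * I1) t0) => // eps /andP[e0 et].
have e1 : eps <= 1 by apply: le_trans (ltW et) _; rewrite ge_min lexx.
have ea : n%:R * eps <= a.
  have : eps <= a / (n%:R + 1) by apply: le_trans (ltW et) _; rewrite ge_min lexx orbT.
  rewrite ler_pdivlMr// mulrDr mulr1 mulrC => h; apply: le_trans h.
  by rewrite lerDl ltW.
(* [P] depends on [eps] alone, so it is fixed while [tau] tends to [0]. *)
pose P := (Num.bound ((2 * L0 + 5) / eps)).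
have PL : 2 * L0 + 5 < eps * P%:R.
  rewrite [eps * _]mulrC -ltr_pdivrMr//; apply: archi_boundP.
  by rewrite divr_ge0 ?(ltW e0)// addr_ge0// mulr_ge0.
suff : J chi - K1 * (n%:R * eps) * I1 <= J' G2 + K2 * (n%:R * eps) * I1.
  rewrite lerBlDr => /le_trans; apply; rewrite le_eqVlt; apply/orP; left.
  by apply/eqP; ring.
apply: (@le_add_small _ _ _ (I1 + I1 * Cpsi * P%:R ^+ n) 1) => // tau /andP[tau0 _].
exact: lattice_estimate.
Qed.

End lattice_inequality.

(** * The maximum principle *)

Lemma expRN_lipschitz (R : realType) (a b : R) : 0 <= a -> 0 <= b ->
  `|expR (- a) - expR (- b)| <= `|a - b|.
Proof.
wlog ab : a b / a <= b.
  move=> H a0 b0; have [/H|/ltW /H] := leP a b; first exact.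
  by move=> /(_ b0 a0); rewrite (distrC (expR (- b))) (distrC b).
move=> a0 b0; rewrite [leRHS]distrC [leRHS]ger0_norm ?subr_ge0//.
rewrite ger0_norm ?subr_ge0 ?ler_expR ?lerN2//.
have -> : - b = - a + (a - b) by ring.
rewrite expRD -[X in X - _]mulr1 -mulrBr.
have h1 := expR_ge1Dx (a - b).
have h2 : expR (- a) <= 1 by rewrite expR_le1 oppr_le0.
have h3 : 0 <= 1 - expR (a - b) by rewrite subr_ge0 expR_le1 subr_le0.
apply: (@le_trans _ _ (1 - expR (a - b))); last by lra.
by rewrite ler_piMl.
Qed.

(** Where the hat is nonzero, [c d <= z < 3 k], so its height bound [1 / k] is at most [3 / (c d)],
    uniformly in [k]. *)
Lemma cutoff2_dominated (R : realType) (k z c d a : R) :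
  0 < k -> 0 < c -> 0 < d -> c * d <= z ->
  `| `|a| * cutoff2 k z| <= 3 / c * `|a / d|.
Proof.
move=> k0 c0 d0 cdz.
rewrite [`|a / d|]normrM [`|d^-1|]normfV (gtr0_norm d0) normrM normr_id.
rewrite (ger0_norm (cutoff2_ge0 z k0)).
rewrite [leRHS]mulrCA; apply: ler_wpM2l => //.
have [zk|zk] := leP (3 * k) z.
  rewrite cutoff2_eq0 ?zk ?orbT// mulr_ge0 ?invr_ge0 ?(ltW d0)//.
  by rewrite divr_ge0// ltW.
apply: (le_trans (cutoff2_le _ k0)).
rewrite -[leLHS]mul1r ler_pdivrMr// mulrAC ler_pdivlMr// mulrAC ler_pdivlMr// mul1r.
by rewrite mulrC; apply: ltW; exact: le_lt_trans cdz zk.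
Qed.

Section weak_maximum_principle.
Context {R : realType} {n : nat} (n_gt0 : (0 < n)%N) (U : set 'rV[R]_n).
Context (u : lebesgue_space R n -> R).
Notation mu := (lebesgue_Rn R n).
Hypothesis oU : open U.
Hypothesis bU : bounded_set U.
Hypothesis sU : smooth_boundary U.
Hypothesis int_u : mu.-integrable (U : set (lebesgue_space R n))
  (fun x => (u x * (cdist U x)^-1)%:E).
Hypothesis subharm : forall phi : 'rV[R]_n -> R,
  test_function U phi -> (forall x, 0 <= phi x) ->
  (- (\int[mu]_(x in U) (u x * laplacian phi x)%:E) <= 0)%E.

Let bounded_domain : exists2 L0 : R, 0 <= L0 & forall x, U x -> `|x| <= L0.
Proof.
case: bU => M [_ hM]; exists (`|M| + 1); first by rewrite addr_ge0.
by apply: hM; rewrite (le_lt_trans (ler_norm M))// ltrDl.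
Qed.

Let complement_nonempty : ~` U !=set0.
Proof.
have [L0 L00 UL0] := bounded_domain.
exists (const_mx (L0 + 1)) => /UL0.
have := coord_le_norm (const_mx (L0 + 1) : 'rV[R]_n) (Ordinal n_gt0).
rewrite mxE => h1 h2; have := le_trans h1 h2.
by rewrite ger0_norm ?addr_ge0// leNgt ltrDl ltr01.
Qed.

Let U0 := complement_nonempty.

Let cdist_bounded : exists2 D : R, 0 < D & forall x, cdist U x <= D.
Proof.
have [L0 L00 UL0] := bounded_domain; have [p0 Up0] := U0.
exists (n%:R * (L0 + `|p0|) + 1).
  by rewrite ltr_wpDl// mulr_ge0// addr_ge0.
move=> x; have [Ux|Ux] := pselect (U x); last first.
  by rewrite cdist_eq0// addr_ge0// mulr_ge0// addr_ge0.
apply: (le_trans (cdist_le U0 x Up0)); apply: (le_trans (enorm_le_norm _)).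
apply: (@le_trans _ _ (n%:R * (L0 + `|p0|))); last by rewrite lerDl.
apply: ler_wpM2l => //; apply: (le_trans (ler_normB _ _)).
by rewrite lerD2r UL0.
Qed.

Let mU : measurable (U : set (lebesgue_space R n)).
Proof. exact: lebesgue_measurable_open. Qed.

Let continuous_cdist : continuous (cdist U).
Proof.
apply: (@lipschitz_continuous _ _ _ 1) => x y; rewrite mul1r.
exact: cdist_lipschitz.
Qed.

(** [u] is the product of the integrable [u / cdist] and the bounded [cdist]. *)
Let intu : mu.-integrable (U : set (lebesgue_space R n)) (EFin \o u).
Proof.
have [D D0 hD] := cdist_bounded.
have hb x : U x -> `|cdist U x| <= D by move=> _; rewrite ger0_norm ?cdist_ge0.
have := @integrable_Mbounded R n U _ oU int_u (cdist U) D continuous_cdist hb.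
apply: eq_integrable => // x; rewrite inE => Ux; congr EFin.
by rewrite divfK// gt_eqF// cdist_gt0.
Qed.

Section touching.
Context (r D : R).
Hypothesis r0 : 0 < r.
Hypothesis D0 : 0 < D.
Hypothesis hD : forall x, cdist U x <= D.
Hypothesis touch : forall x, U x ->
    exists2 c, enorm (x - c) = r + cdist U x &
      forall y, U y -> r + cdist U y <= enorm (y - c).

Let lam : R := n%:R / r ^+ 2.
Let A : R := expR (- lam * r ^+ 2).
Let Q : R := (r + D) ^+ 2.
(* [zeta] is comparable to the distance to the complement, and it is touched from
   above at each point by the translate of [A - exp (- lam |y|^2)] centred at the
   centre of the exterior ball; [lam] makes the latter superharmonic for
   [|y| >= r]. *)
Let zeta (x : 'rV[R]_n) : R := A - expR (- lam * (r + cdist U x) ^+ 2).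
Let C : R := 4 * lam ^+ 2 * Q.
Let m0 : R := 2 * n%:R * lam * expR (- lam * Q).
Let c1 : R := 2 * lam * r * expR (- lam * Q).
Let c2 : R := lam * (2 * r + D).
Let Kz : R := lam * (2 * r + 2 * D).

Let lam0 : 0 < lam. Proof. by rewrite divr_gt0 ?ltr0n// exprn_gt0. Qed.
Let Q0 : 0 < Q. Proof. by rewrite exprn_gt0// addr_gt0. Qed.
Let C0 : 0 < C.
Proof. by apply: mulr_gt0 => //; apply: mulr_gt0 => //; exact: exprn_gt0. Qed.
Let m00 : 0 < m0.
Proof.
apply: mulr_gt0; last exact: expR_gt0.
by apply: mulr_gt0 => //; apply: mulr_gt0 => //; rewrite ltr0n.
Qed.
Let c10 : 0 < c1.
Proof.
apply: mulr_gt0; last exact: expR_gt0.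
by apply: mulr_gt0 => //; exact: mulr_gt0.
Qed.
Let c20 : 0 < c2. Proof. by rewrite mulr_gt0// addr_gt0// mulr_gt0. Qed.
Let Kz0 : 0 <= Kz.
Proof. by apply: mulr_ge0; [exact: ltW|rewrite addr_ge0// mulr_ge0// ltW]. Qed.
Let A1 : A <= 1.
Proof. by rewrite expR_le1 mulNr oppr_le0 mulr_ge0 ?sqr_ge0// ltW. Qed.

Let zeta_le_A x : zeta x <= A.
Proof. by rewrite /zeta gerBl expR_ge0. Qed.

Let zeta_out x : ~ U x -> zeta x = 0.
Proof. by move=> Ux; rewrite /zeta cdist_eq0// addr0 subrr. Qed.

Let zetaE x : zeta x = A * (1 - expR (- (lam * (2 * r * cdist U x + cdist U x ^+ 2)))).
Proof.
rewrite mulrBr mulr1 -expRD; congr (_ - expR _).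
by ring.
Qed.

Let zeta_le x : zeta x <= c2 * cdist U x.
Proof.
have d0 := cdist_ge0 U0 x; have dD := hD x.
rewrite zetaE; set b := lam * _.
have b0 : 0 <= b by rewrite mulr_ge0 ?(ltW lam0)// addr_ge0 ?sqr_ge0// !mulr_ge0// ltW.
have h := expR_ge1Dx (- b).
have bb : b <= c2 * cdist U x.
  rewrite /b /c2 -[leRHS]mulrA; apply: ler_wpM2l; first exact: ltW.
  by rewrite [leRHS]mulrDl lerD2l expr2; exact: ler_wpM2r.
apply: le_trans bb; apply: (@le_trans _ _ (1 - expR (- b))); last by lra.
by apply: ler_piMl => //; rewrite subr_ge0 expR_le1 oppr_le0.
Qed.

Let zeta_ge x : c1 * cdist U x <= zeta x.
Proof.
have d0 := cdist_ge0 U0 x; have dD := hD x.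
set d := cdist U x in d0 dD *.
(* With the smaller exponential factored out, [exp t >= 1 + t] applies; keeping only the linear term
   [2 lam r d] gives the constant [c1]. *)
have E : zeta x = expR (- lam * (r + d) ^+ 2) * (expR (lam * (2 * r * d + d ^+ 2)) - 1).
  by rewrite mulrBr mulr1 -expRD /zeta -/d; congr (expR _ - _); ring.
rewrite E; have h := expR_ge1Dx (lam * (2 * r * d + d ^+ 2)).
have hQ : expR (- lam * Q) <= expR (- lam * (r + d) ^+ 2).
  rewrite ler_expR !mulNr lerN2 ler_pM2l// ler_pXn2r ?nnegrE ?addr_ge0 ?(ltW r0) ?(ltW D0)//.
  by rewrite lerD2l.
have -> : c1 * d = expR (- lam * Q) * (2 * lam * r * d) by rewrite /c1; ring.
have ld : 0 <= 2 * lam * r * d.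
  apply: mulr_ge0 => //; apply: mulr_ge0; last exact: ltW.
  by apply: mulr_ge0 => //; exact: ltW.
have ld2 : 0 <= lam * d ^+ 2 by rewrite mulr_ge0 ?sqr_ge0// ltW.
apply: ler_pM; [exact: expR_ge0|exact: ld|exact: hQ|].
by move: h ld2; rewrite mulrDr; move: (expR _) => X; lra.
Qed.

Let zeta_lip x y : `|zeta x - zeta y| <= Kz * enorm (x - y).
Proof.
have dx0 := cdist_ge0 U0 x; have dxD := hD x.
have dy0 := cdist_ge0 U0 y; have dyD := hD y.
have -> : zeta x - zeta y = expR (- (lam * (r + cdist U y) ^+ 2)) - expR (- (lam * (r + cdist U x) ^+ 2)).
  by rewrite /zeta !mulNr opprD opprK addrACA subrr add0r addrC.
apply: le_trans.
  by apply: expRN_lipschitz; rewrite mulr_ge0 ?sqr_ge0// ltW.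
have -> : lam * (r + cdist U y) ^+ 2 - lam * (r + cdist U x) ^+ 2 =
   lam * (2 * r + (cdist U x + cdist U y)) * (cdist U y - cdist U x) by ring.
have p0 : 0 <= lam * (2 * r + (cdist U x + cdist U y)).
  by rewrite mulr_ge0 ?(ltW lam0)// !addr_ge0// mulr_ge0// ltW.
rewrite normrM (ger0_norm p0); apply: ler_pM => //.
  apply: ler_wpM2l; first exact: ltW.
  by rewrite lerD2l mulr2n mulrDl mul1r lerD.
by rewrite distrC; exact: cdist_lipschitz.
Qed.

(** Discrete Laplacians respect touching from above: the translated barrier dominates the cutoff of
    [zeta] everywhere and equals it at [x]. The estimate for the barrier is uniform since
    [|x - c| <= r + D]. *)
Let barrier_discrete (k tau : R) : 0 < k -> 0 < tau -> exists2 h0 : R, 0 < h0 &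
  forall h x, 0 < h < h0 ->
    discrete_laplacian h (fun x => cutoff k (zeta x)) x <=
    h ^+ 2 * (C * cutoff2 k (zeta x) - m0 * cutoff1 k (zeta x) + tau).
Proof.
move=> k0 tau0.
have [d d0 hd] := @discrete_laplacian_unif R n (barrier k A lam)
  (fun i => barrier1 k A lam i) (fun i => barrier2 k A lam i) (r + D) tau
  (fun x i => is_derive_barrier A lam k0 x i)
  (fun x i => is_derive_barrier1 A lam k0 x i)
  (@continuous_barrier2 R n k A lam k0) tau0.
(* The bound [k / c2] serves points outside [U]: their neighbours at distance [h] have
   [zeta <= c2 h <= k], so all the cutoffs vanish. *)
exists (Num.min d (k / c2)); first by rewrite lt_min d0 divr_gt0.
move=> h x /andP[h0]; rewrite lt_min => /andP[hd' hk].
have h2 : 0 <= h ^+ 2 by exact: sqr_ge0.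
have [Ux|Ux] := pselect (U x); last first.
  rewrite (zeta_out Ux) cutoff2_eq0 ?(ltW k0)// cutoff1_eq0 ?(ltW k0)//.
  rewrite !mulr0 subr0 add0r.
  apply: (@le_trans _ _ 0); last by rewrite mulr_ge0// ltW.
  apply: sumr_le0 => i _.
  have H (s : R) : `|s| = h -> cutoff k (zeta (x + s *: delta_mx 0 i)) = 0.
    move=> sh; apply: cutoff_eq0 => //; apply: (le_trans (zeta_le _)).
    have /(cdist_le U0 (x + s *: delta_mx 0 i)) := Ux.
    rewrite addrAC subrr add0r enormZ sh.
    have -> : enorm (delta_mx 0 i : 'rV[R]_n) = 1.
      rewrite /enorm (bigD1 i)//= big1 ?addr0 => [|j ji].
        by rewrite mxE !eqxx expr1n sqrtr1.
      by rewrite mxE (negbTE ji) andbF expr0n.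
    rewrite mulr1 => dh; rewrite mulrC -ler_pdivlMr//.
    exact: le_trans dh (ltW hk).
  have E1 := H h (gtr0_norm h0).
  have E2 := H (- h) (etrans (normrN h) (gtr0_norm h0)).
  rewrite scaleNr in E2.
  have E0 : cutoff k (zeta x) = 0 by rewrite (zeta_out Ux); apply: cutoff_eq0 => //; exact: ltW.
  have sum0 (p q s : R) : p = 0 -> q = 0 -> s = 0 -> p + q - 2 * s <= 0.
    by move=> -> -> ->; rewrite mulr0 subr0 addr0.
  exact: sum0 E1 E2 E0.
have [c xc hc] := touch Ux.
have barrierE y : barrier k A lam (y - c) = cutoff k (A - expR (- lam * enorm (y - c) ^+ 2)).
  by rewrite enorm_sqr.
have rd z : 0 <= r + cdist U z by rewrite addr_ge0 ?cdist_ge0// ltW.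
have lek y : cutoff k (zeta y) <= barrier k A lam (y - c).
  rewrite barrierE; have [Uy|Uy] := pselect (U y); last first.
    by rewrite (zeta_out Uy) cutoff_eq0 ?(ltW k0)// cutoff_ge0.
  apply: le_cutoff => //; rewrite /zeta lerD2l lerN2 ler_expR !mulNr lerN2 ler_pM2l//.
  by rewrite ler_pXn2r ?nnegrE ?enorm_ge0// hc.
have xcE : A - expR (- lam * sqnorm (x - c)) = zeta x.
  by rewrite -enorm_sqr xc.
have eqk : cutoff k (zeta x) = barrier k A lam (x - c) by rewrite -xcE.
apply: (@le_trans _ _ (discrete_laplacian h (barrier k A lam) (x - c))).
  apply: ler_sum => i _; rewrite -eqk lerD2r.
  by apply: lerD; apply: (le_trans (lek _)); rewrite addrAC.
have nxc : `|x - c| <= r + D.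
  by apply: (le_trans (norm_le_enorm _)); rewrite xc lerD2l.
have := hd (x - c) h nxc; rewrite h0 => /(_ hd').
rewrite ler_distl => /andP[_ hup]; apply: (le_trans hup).
rewrite [leRHS]mulrDr [tau * _]mulrC lerD2r; apply: ler_wpM2l => //.
rewrite -xcE; apply: (@sum_barrier2_le R n k A lam k0 r Q (x - c) n_gt0 r0 erefl).
rewrite -enorm_sqr xc; apply/andP; split.
  by rewrite ler_pXn2r ?nnegrE ?(ltW r0)// lerDl cdist_ge0.
by rewrite /Q ler_pXn2r ?nnegrE ?addr_ge0 ?cdist_ge0 ?(ltW r0) ?(ltW D0)// lerD2l.
Qed.

Let absu : lebesgue_space R n -> R := fun y => `|u y|.

Let kappa_inequality (k K : R) (chi : 'rV[R]_n -> R) : 0 < k -> 0 <= K ->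
  (forall x y, `|chi x - chi y| <= K * enorm (x - y)) ->
  (forall x, 0 <= chi x) -> (forall x, chi x <= m0 * cutoff1 k (zeta x)) ->
  wint U u chi <= wint U absu (fun x => C * cutoff2 k (zeta x)).
Proof.
move=> k0 K0 chi_lip chi_ge0 chi_le.
have [L0 L00 UL0] := bounded_domain.
have K2 : 0 <= C * (4 / k ^+ 2 * Kz).
  apply: mulr_ge0; first exact: ltW.
  by apply: mulr_ge0 => //; rewrite divr_ge0// exprn_ge0// ltW.
apply: (@lattice_inequality R n U u L0 oU U0 L00 UL0 intu subharm
  (fun x => cutoff k (zeta x)) (fun x => m0 * cutoff1 k (zeta x)) _ chi
  (k / c2) (cutoff k A) K (C * (4 / k ^+ 2 * Kz))) => //.
- exact: divr_gt0.
- by move=> x; exact: cutoff_ge0.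
- by move=> x; exact: le_cutoff.
- move=> x cx; rewrite ltNge; apply/negP => h; move/eqP: cx; apply; apply: cutoff_eq0 => //.
  by apply: (le_trans (zeta_le x)); rewrite mulrC -ler_pdivlMr.
- by move=> tau; exact: barrier_discrete.
- by move=> x; rewrite mulr_ge0 ?cutoff2_ge0// ltW.
- move=> x y; rewrite -mulrBr normrM (gtr0_norm C0) -[leRHS]mulrA.
  apply: ler_wpM2l; first exact: ltW.
  apply: (le_trans (lipschitz_cutoff2 _ _ k0)); rewrite -[leRHS]mulrA.
  apply: ler_wpM2l; last exact: zeta_lip.
  by rewrite divr_ge0// exprn_ge0// ltW.
Qed.

Lemma test_le0 (chi : 'rV[R]_n -> R) (K a : R) :
  (forall x y, `|chi x - chi y| <= K * enorm (x - y)) ->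
  (forall x, 0 <= chi x <= 1) -> 0 < a ->
  (forall x, chi x != 0 -> a <= cdist U x) ->
  \int[mu]_(x in U) (u x * chi x) <= 0.
Proof.
move=> chi_lip chi01 a0 chi_supp.
have cchi : continuous chi by exact: lipschitz_continuous chi_lip.
have czeta : continuous zeta by exact: lipschitz_continuous zeta_lip.
have [L0 L00 UL0] := bounded_domain.
(* On the support of [chi], [zeta >= c1 a = 3 k0], so [cutoff1 k] equals [1] there for every
   [k <= k0] and [m0 chi] is an admissible lower function. *)
pose k0 := c1 * a / 3.
have k00 : 0 < k0 by rewrite divr_gt0// mulr_gt0.
pose k (j : nat) := k0 / j.+1%:R.
have kgt0 j : 0 < k j by rewrite divr_gt0.
have kle j : k j <= k0 by rewrite ler_pdivrMr// ler_peMr ?(ltW k00)// ler1n.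
have step j : m0 / C * wint U u chi <= wint U absu (fun x => cutoff2 (k j) (zeta x)).
  have c2c : continuous (fun x => cutoff2 (k j) (zeta x)).
    by move=> x; apply: (@continuous_comp _ _ _ zeta (cutoff2 (k j)));
      [exact: czeta|exact: continuous_cutoff2].
  have iabs : mu.-integrable (U : set (lebesgue_space R n)) (EFin \o absu).
    exact: integrable_norm intu.
  have A2 : wintegrable U absu (fun x => cutoff2 (k j) (zeta x)).
    exact: continuous_wintegrable UL0 iabs c2c.
  have Ac : wintegrable U u chi by exact: continuous_wintegrable UL0 intu cchi.
  have H := @kappa_inequality (k j) (m0 * `|K|) (fun x => m0 * chi x) (kgt0 j).
  rewrite mulrAC ler_pdivrMr// [leRHS]mulrC -(wintZ oU _ A2) -(wintZ oU _ Ac).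
  apply: H.
  - by rewrite mulr_ge0// ltW.
  - move=> x y; rewrite -mulrBr normrM (gtr0_norm m00) -mulrA.
    apply: ler_wpM2l; first exact: ltW.
    apply: (le_trans (chi_lip x y)); apply: ler_wpM2r; first exact: enorm_ge0.
    exact: ler_norm.
  - by move=> x; rewrite mulr_ge0 ?(ltW m00)//; have /andP[] := chi01 x.
  - move=> x; apply: ler_wpM2l; first exact: ltW.
    have [->|cx] := eqVneq (chi x) 0; first exact: cutoff1_ge0.
    rewrite cutoff1_eq1//; first by have /andP[] := chi01 x.
    apply: le_trans (zeta_ge x).
    apply: (@le_trans _ _ (3 * k0)); first by rewrite ler_pM2l.
    by rewrite /k0 mulrC divfK// ler_pM2l// chi_supp.
(* [cutoff2 (k j) (zeta x)] vanishes unless [k j <= zeta x <= 3 * k j], where it is at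
   most [(k j)^-1 <= 3 / zeta x]: this is where the integrability of [u / delta] enters. *)
have cv : (\int[mu]_(x in U) (absu x * cutoff2 (k j) (zeta x))%:E)%E @[j --> \oo] --> 0%E.
  have [] := @dominated_convergence _ (lebesgue_space R n) R mu U mU
    (fun j x => (absu x * cutoff2 (k j) (zeta x))%:E) (cst 0%E)
    (fun x => ((3 / c1)%:E * `|(u x * (cdist U x)^-1)%:E|)%E).
  - move=> j; apply/measurable_EFinP; apply: measurable_funM.
      apply: measurableT_comp => //; apply/measurable_EFinP.
      exact: measurable_int intu.
    apply: continuous_measurable_rV => // x.
    apply: (@continuous_comp _ _ _ zeta (cutoff2 (k j))); first exact: czeta.
    exact: continuous_cutoff2.
  - exact: measurable_cst.
  - apply: aeW => x Ux; apply: cvg_near_cst.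
    have d0 := cdist_gt0 oU U0 Ux.
    have z0 : 0 < zeta x by apply: lt_le_trans (zeta_ge x); rewrite mulr_gt0.
    near=> j; rewrite cutoff2_eq0 ?mulr0//; apply/orP; right.
    have : 3 * k0 / zeta x <= j%:R by near: j; exact: nbhs_infty_ger.
    rewrite /k mulrA !ler_pdivrMr// => h; apply: (le_trans h); rewrite mulrC.
    by apply: ler_wpM2l; [exact: ltW|rewrite ler_nat].
  - apply: integrableZl => //; exact: integrable_abse int_u.
  - apply: aeW => x j Ux.
    have d0 := cdist_gt0 oU U0 Ux.
    rewrite !abse_EFin -EFinM lee_fin.
    exact: (cutoff2_dominated (u x) (kgt0 j) c10 d0 (zeta_ge x)).
  by move=> _ _; rewrite integral0.
have : ((m0 / C * wint U u chi)%:E <= 0)%E.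
  apply: (cvge_to_ge cv); apply: nearW => j.
  rewrite -[leRHS]fineK; first by rewrite lee_fin; exact: step.
  apply: integrable_fin_num => //.
  have iabs : mu.-integrable (U : set (lebesgue_space R n)) (EFin \o absu).
    exact: integrable_norm intu.
  apply: (continuous_wintegrable oU UL0 iabs) => x.
  apply: (@continuous_comp _ _ _ zeta (cutoff2 (k j))); first exact: czeta.
  exact: continuous_cutoff2.
by rewrite lee_fin pmulr_rle0// divr_gt0.
Unshelve. all: by end_near.
Qed.

End touching.

Lemma subharmonic_le0 : {ae mu, forall x, U x -> u x <= 0}.
Proof.
have [r r0 touch] := touching_exterior_ball oU U0 bU sU.
have [D D0 hD] := cdist_bounded.
apply: (ae_le0 oU intu U0) => chi K a.
exact: test_le0 r0 D0 hD touch chi K a.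
Qed.

End weak_maximum_principle.

Theorem theorem4p12 (R : realType) (n : nat) (n_gt0 : (0 < n)%N)
    (Omega : set 'rV[R]_n) (domOmega : domain Omega)
    (bndOmega : bounded_set Omega) (smoothOmega : smooth_boundary Omega)
    (u : lebesgue_space R n -> R) (mu_u : measurable_fun (Omega : set (lebesgue_space R n)) u)
    (int_u : (lebesgue_Rn R n).-integrable Omega
       (fun x => (u x * (dist_boundary Omega x)^-1)%:E))
    (subharm : forall phi : 'rV[R]_n -> R,
       test_function Omega phi -> (forall x, 0 <= phi x) ->
       (- (\int[lebesgue_Rn R n]_(x in Omega)
            (u x * laplacian phi x)%:E) <= 0)%E) :
  {ae lebesgue_Rn R n, forall x, Omega x -> u x <= 0}.
Proof.
have [_ oO _] := domOmega.
apply: subharmonic_le0 => //.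
apply: eq_integrable int_u; first exact: lebesgue_measurable_open.
move=> x; rewrite inE => Ox; congr (_ * _^-1)%:E.
apply: dist_boundaryE => //.
(* The complement is nonempty: a constant vector with entries [|M| + 2] exceeds the bound [|M| + 1],
   the dimension being positive. *)
case: bndOmega => M [_ hM].
exists (const_mx (`|M| + 2)) => Oc.
have := hM (`|M| + 1) (le_lt_trans (ler_norm M) _) _ Oc; rewrite ltrDl ltr01 => /(_ isT) /=.
have := coord_le_norm (const_mx (`|M| + 2) : 'rV[R]_n) (Ordinal n_gt0).
rewrite mxE => h1 h2; have := le_trans h1 h2.
by rewrite ger0_norm ?addr_ge0// lerD2l; lra.
Qed.
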